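(* Let $G=\mathbb{Z}^2$ (nearest-neighbour graph) and $0\le p<p_T(\mathbb{Z}^2)$. Then, as $n\to\infty$: (a) $\displaystyle \Big|\widetilde E^p[U_n]-\frac{n}{\log n}\pi\Big|=O\Big(\frac{n}{(\log n)^2}\Big)$. (b) $\displaystyle \mathrm{Var}_p(U_n)=O\Big(\frac{n^2}{(\log n)^4}\Big)$. (c) For every $1\le q<+\infty$, $\displaystyle \lim_{n\to\infty}\frac{\log n}{n}U_n=\pi$, $\widetilde P^p$-a.s. and in $L^q(\widetilde P^p)$.
   Context: $(S_n)_{n\ge0}$ is the simple random walk on $\mathbb{Z}^2$ started at the origin, with law $P^0$. $\mathbb{P}_p$ is the law of Bernoulli bond percolation on $\mathbb{Z}^2$ with parameter $p$; $C_x$ is the open cluster of $x$. $p_T(\mathbb{Z}^2):=\inf\{p\in[0,1]:E^{\mathbb{P}_p}[|C_0|]=+\infty\}$. $\widetilde P^p:=P^0\otimes\mathbb{P}_p$, with expectation $\widetilde E^p$ and variance $\mathrm{Var}_p$. $U_n:=\big|\bigcup_{x\in\{S_0,\dots,S_n\}}C_x\big|$. *)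

(* Defs.v *)
From HB Require Import structures.
From mathcomp Require Import all_boot all_order all_algebra.
From mathcomp Require Import all_classical all_reals all_analysis.

Set Implicit Arguments.
Unset Strict Implicit.
Unset Printing Implicit Defensive.
Import Order.TTheory GRing.Theory Num.Theory.
Import numFieldNormedType.Exports.
Local Open Scope classical_set_scope.
Local Open Scope ring_scope.

(* g_sigma_algebraType requires a pointed type. *)
HB.instance Definition _ := isPointed.Build int 0.

Notation Z2 := (int * int)%type.

Definition nearest_neighbor (x y : Z2) : bool :=
  `|x.1 - y.1| + `|x.2 - y.2| == 1.

(* Each undirected nearest-neighbour edge of Z^2 is encoded exactly once, as
   (x, b): the edge {x, x + (1, 0)} if b, and {x, x + (0, 1)} otherwise. *)
Notation edge := (Z2 * bool)%type.

Definition endpoints (e : edge) : Z2 * Z2 :=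
  (e.1, e.1 + (if e.2 then (1, 0) else (0, 1))).

(* For a countable T, these sets generate the product over I of the discrete
   sigma-algebras on T. *)
Definition coordinate_sets (I T : Type) : set (set (I -> T)) :=
  [set A | exists i a, A = [set f | f i = a]].

Notation walk_space := (g_sigma_algebraType (@coordinate_sets nat Z2)).
Notation config_space := (g_sigma_algebraType (@coordinate_sets edge bool)).

Section RandomWalkPercolation.
Variable R : realType.

Definition transition (x y : Z2) : R :=
  if nearest_neighbor x y then 4^-1 else 0.

(* P is the law, on the space of trajectories, of the simple random walk on Z^2
   started at 0; the position S_n is the n-th coordinate.  The
   finite-dimensional laws below determine P uniquely. *)
Definition simple_random_walk_law (P : probability walk_space R) : Prop :=
  forall (n : nat) (x : nat -> Z2),
    P [set s : walk_space | forall i, (i <= n)%N -> s i = x i] =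
    ((x 0%N == 0)%:R * \prod_(i < n) transition (x i) (x i.+1))%:E.

(* P is the product measure under which each edge is open (value true) with
   probability p, independently; it is unique by the cylinder formula below. *)
Definition bernoulli_percolation_law (p : R) (P : probability config_space R) :
    Prop :=
  forall (A : seq edge) (v : edge -> bool), uniq A ->
    P [set w : config_space | forall e, e \in A -> w e = v e] =
    (\prod_(e <- A) (if v e then p else 1 - p))%:E.

Definition open_step (w : config_space) : rel Z2 := fun x y =>
  `[< exists2 e : edge, w e & (x, y) = endpoints e \/ (y, x) = endpoints e >].

Definition open_cluster (w : config_space) (x : Z2) : set Z2 :=
  [set y | exists2 s : seq Z2, path (open_step w) x s & last x s = y].

(* The law P is unique and exists for every p in [0, 1] (product measure), so the
   quantifier over P merely names E_p. *)
Definition p_T : R :=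
  inf [set p : R | 0 <= p <= 1 /\
    exists2 P : probability config_space R, bernoulli_percolation_law p P &
      (\int[P]_w counting (open_cluster w 0%R) = +oo)%E].

(* Extended-real valued: clusters may be infinite, even if p < p_T (with
   probability 0). *)
Definition U (n : nat) (sw : walk_space * config_space) : \bar R :=
  counting (\bigcup_(i in [set i | (i <= n)%N]) open_cluster sw.2 (sw.1 i)).

(* The library's 'E_P[X] and 'V_P[X] take a real-valued X; these are their
   analogues for an extended-real-valued X. *)
Definition expect d (T : measurableType d) (P : probability T R)
    (X : T -> \bar R) : \bar R := (\int[P]_w X w)%E.

Definition var d (T : measurableType d) (P : probability T R)
    (X : T -> \bar R) : \bar R := expect P (fun w => (X w - expect P X) ^+ 2)%E.

End RandomWalkPercolation.

(* Main.v *)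
From HB Require Import structures.
Require Import Defs.
From mathcomp Require Import all_boot all_order all_algebra.
From mathcomp Require Import all_classical all_reals all_analysis.
From mathcomp Require Import measurable_realfun.
From mathcomp Require Import zify ring lra.

(* Write F A for the mean size of the union of the clusters of A. Adding the origin
   to B increases F by sum_z D z B, where D z B = P(0 <-> z, C_0 avoids B), so E[U_n]
   is a sum of the increments d_k = sum_z E[D z (S_1, ..., S_k)]. Decomposing the walk
   at its last visit to the cluster of the origin gives 1 = sum_k sum_z p_k(z)
   E[D z (S_1, ..., S_{n-k})]; as G_n(z) = sum_{k <= n} p_k(z) is log n / pi + O(1) with
   error controlled by 1 + |z|^2, and the cluster size has all moments, this forces
   d_n = pi / log n + O(1 / log^2 n), hence (a).

   For (b), given the walk the variance of the union is at most linear in the number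
   of sites visited, because connection events at distance k depend on disjoint sets
   of edges up to the probability of a cluster of radius k/2. The variance of F(trace)
   is bounded by halving the walk: the two halves are independent and their
   interaction is a sum of kappa(b - a) over pairs of visited sites, with second
   moment O(n^2 / log^4 n). This gives E[(log n / n U_n - pi)^2] = O(1 / log^2 n), which
   is summable along n_k ~ exp(k^{3/4}); U_n is monotone and n_{k+1} / n_k -> 1, so almost
   sure convergence follows. L^q convergence follows from the L^2 one and the
   boundedness of all moments of log n / n U_n.

   All moments of the cluster size are finite for p < p_T because the radius decays
   exponentially: exploring the cluster of 0 in a ball bounds the probability of
   reaching distance m + 1 + k by a multiple of sum_{|x| = m} P(0 <-> x) times that of
   reaching distance k, and the first factor is small for some m. *)

Set Implicit Arguments.
Unset Strict Implicit.
Unset Printing Implicit Defensive.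
Import Order.TTheory GRing.Theory Num.Theory.
Import numFieldNormedType.Exports.
Local Open Scope classical_set_scope.
Local Open Scope ring_scope.

(** * Finite simple random walk *)

(** The power of the logarithm in (b) comes from the bound $G_{2n}(x)/G_n(0)$ on the probability of
    visiting $x$ within $n$ steps, together with $\sum_x G_{2n}(x)^2=O(n)$: squared hitting
    probabilities sum to $O(n/\log^2 n)$, those of pairs to $O(n^2/\log^4 n)$. In the last-visit
    identity the remaining walk has length $n-k$, which varies with the visit time $k$. Monotonicity
    in the length settles the upper bound on $d_n$; the lower bound runs the identity over $2n$
    steps, where visits after time $n$ are rare because $p_k\le 2/(k+1)$. The comparison of $G_n(z)$
    with $G_n(0)$ is crude, quadratic in $z$ instead of logarithmic, which is affordable because the
    cluster size has a third moment. The walk is treated as a finite average over words, and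
    percolation enters that part only through hypotheses on abstract functionals, so that neither
    measure appears there. Clusters may be infinite: sizes live in $[0,+\infty]$, and squares are
    expanded without subtraction. *)

Definition dirs : seq Z2 := [:: (1, 0); (-1, 0); (0, 1); (0, -1)].

Fixpoint words (n : nat) : seq (seq Z2) :=
  if n is m.+1 then [seq d :: s | d <- dirs, s <- words m]
  else [:: [::]].

Lemma wordsS n : words n.+1 = [seq d :: s | d <- dirs, s <- words n].
Proof. by []. Qed.

Definition endpoint (s : seq Z2) : Z2 := \sum_(d <- s) d.

Definition shift (x : Z2) (l : seq Z2) : seq Z2 := [seq x + y | y <- l].

Fixpoint trace (s : seq Z2) : seq Z2 :=
  if s is d :: t then 0 :: shift d (trace t) else [:: 0].

Lemma size_words n s : s \in words n -> size s = n.
Proof.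
elim: n s => [|n IHn] s; first by rewrite /= inE => /eqP ->.
by move=> /allpairsP [[d t] [_ /IHn <- ->]].
Qed.

Lemma mem_words n s : s \in words n -> {subset s <= dirs}.
Proof.
elim: n s => [|n IHn] s; first by rewrite /= inE => /eqP -> x.
move=> /allpairsP [[d t] [/= dd /IHn tn ->]] x.
by rewrite inE => /orP [/eqP -> //|/tn].
Qed.

Lemma shiftP x l y : (y \in shift x l) = (y - x \in l).
Proof.
apply/mapP/idP => [[z zl ->]|yl]; first by rewrite addrC addKr.
by exists (y - x) => //; rewrite addrC subrK.
Qed.

Lemma shift_shift x y l : shift x (shift y l) = shift (x + y) l.
Proof. by rewrite /shift -map_comp; apply: eq_map => z /=; rewrite addrA. Qed.

Lemma shift0 l : shift 0 l = l.
Proof. by rewrite /shift -[RHS]map_id; apply: eq_map => z; rewrite add0r. Qed.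

Lemma shift_cat x l m : shift x (l ++ m) = shift x l ++ shift x m.
Proof. exact: map_cat. Qed.

Lemma endpoint_nil : endpoint [::] = 0.
Proof. by rewrite /endpoint big_nil. Qed.

Lemma endpoint_cons d s : endpoint (d :: s) = d + endpoint s.
Proof. by rewrite /endpoint big_cons. Qed.

Lemma endpoint_cat s t : endpoint (s ++ t) = endpoint s + endpoint t.
Proof. by rewrite /endpoint big_cat. Qed.

Lemma size_trace s : size (trace s) = (size s).+1.
Proof. by elim: s => //= d s IHs; rewrite size_map IHs. Qed.

Lemma trace_head s : trace s = 0 :: behead (trace s).
Proof. by case: s. Qed.

Lemma trace0 s : 0 \in trace s.
Proof. by rewrite trace_head inE eqxx. Qed.

Lemma trace_cat s t :
  trace (s ++ t) = trace s ++ shift (endpoint s) (behead (trace t)).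
Proof.
elim: s => [|d s IHs] /=; first by rewrite endpoint_nil shift0 -trace_head.
by rewrite IHs shift_cat shift_shift endpoint_cons.
Qed.

Lemma endpoint_trace s : endpoint s \in trace s.
Proof.
elim: s => [|d s IHs] /=; first by rewrite endpoint_nil inE.
by rewrite endpoint_cons inE shiftP [d + _]addrC addrK IHs orbT.
Qed.

Lemma mem_trace_cat s t :
  trace (s ++ t) =i trace s ++ shift (endpoint s) (trace t).
Proof.
move=> x; rewrite trace_cat !mem_cat [in RHS](trace_head t) [shift _ (_ :: _)]/=.
rewrite inE addr0; case: eqP => // ->; by rewrite endpoint_trace.
Qed.

(** The reversed walk with opposite steps starts at the endpoint of [s] and revisits the same sites,
    in coordinates centred there. This turns the two halves of a walk into two independent walks
    issued from the midpoint. *)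
Lemma trace_rev s :
  trace (rev (map -%R s)) =i shift (- endpoint s) (trace s).
Proof.
elim: s => [|d s IHs] x; first by rewrite endpoint_nil oppr0 shift0.
have er : endpoint (rev (map -%R s)) = - endpoint s.
  by rewrite /endpoint big_rev /= big_map -sumrN; apply: eq_bigr.
rewrite map_cons rev_cons -cats1 mem_trace_cat mem_cat IHs er endpoint_cons.
rewrite !shiftP /= !inE !shiftP !opprK addr0.
have -> : x + (d + endpoint s) - d = x + endpoint s by rewrite addrCA addrAC subrr add0r.
have -> : (x + endpoint s == - d) = (x + (d + endpoint s) == 0).
  by rewrite -(inj_eq (addrI d)) addrN addrCA.
case: (x + endpoint s =P 0) => [->|_]; last by rewrite orbC.
by rewrite trace0 orbT.
Qed.

Section WalkMean.
Variable R : realType.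
Implicit Types f g : seq Z2 -> R.

(** Expectation for the walk of [n] steps in elementary form, as a uniform mean over words;
    [integral_path] later identifies it with integration against the walk law. *)
Definition walkE (n : nat) f : R := (\sum_(s <- words n) f s) / 4 ^+ n.

Lemma walkE0 f : walkE 0 f = f [::].
Proof. by rewrite /walkE /= big_seq1 expr0 divr1. Qed.

Lemma walkES n f :
  walkE n.+1 f = 4^-1 * \sum_(d <- dirs) walkE n (fun s => f (d :: s)).
Proof.
rewrite /walkE wordsS big_allpairs_dep mulr_suml mulr_sumr.
apply: eq_bigr => d _; rewrite exprS invfM; ring.
Qed.

Lemma eq_walkE n f g :
  (forall s, s \in words n -> f s = g s) -> walkE n f = walkE n g.
Proof. by move=> fg; rewrite /walkE (eq_big_seq g). Qed.

Lemma ler_walkE n f g :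
  (forall s, s \in words n -> f s <= g s) -> walkE n f <= walkE n g.
Proof.
move=> fg; rewrite ler_wpM2r ?invr_ge0 ?exprn_ge0//.
by rewrite big_seq [leRHS]big_seq; apply: ler_sum.
Qed.

Lemma walkED n f g : walkE n (fun s => f s + g s) = walkE n f + walkE n g.
Proof. by rewrite /walkE big_split mulrDl. Qed.

Lemma walkEZ n c f : walkE n (fun s => c * f s) = c * walkE n f.
Proof. by rewrite /walkE -mulr_sumr mulrA. Qed.

Lemma walkEZr n c f : walkE n (fun s => f s * c) = walkE n f * c.
Proof. by rewrite mulrC -walkEZ; apply: eq_walkE => s _; rewrite mulrC. Qed.

Lemma walkEN n f : walkE n (fun s => - f s) = - walkE n f.
Proof. by rewrite /walkE sumrN mulNr. Qed.

Lemma walkEB n f g : walkE n (fun s => f s - g s) = walkE n f - walkE n g.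
Proof. by rewrite walkED walkEN. Qed.

Lemma walkE_cst n c : walkE n (fun=> c) = c.
Proof.
elim: n => [|n IHn]; first by rewrite walkE0.
rewrite walkES (eq_bigr (fun=> c)) => [|d _]; last by rewrite IHn.
by rewrite /dirs !big_cons big_nil; field.
Qed.

Lemma walkE_sum n (I : Type) (r : seq I) (P : pred I) (h : I -> seq Z2 -> R) :
  walkE n (fun s => \sum_(i <- r | P i) h i s) =
  \sum_(i <- r | P i) walkE n (h i).
Proof. by rewrite /walkE exchange_big mulr_suml. Qed.

Lemma walkE_ge0 n f : (forall s, s \in words n -> 0 <= f s) -> 0 <= walkE n f.
Proof. by move=> f0; rewrite -(walkE_cst n 0); apply: ler_walkE. Qed.

(** This is the Markov property at a fixed time. *)
Lemma walkE_cat m n f :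
  walkE (m + n) f = walkE m (fun s => walkE n (fun t => f (s ++ t))).
Proof.
elim: m f => [|m IHm] f; first by rewrite add0n walkE0.
rewrite addSn !walkES; congr (_ * _); apply: eq_bigr => d _.
by rewrite IHm.
Qed.

Lemma walkE1 f : walkE 1 f = 4^-1 * \sum_(d <- dirs) f [:: d].
Proof. by rewrite walkES; congr (_ * _); apply: eq_bigr => d _; rewrite walkE0. Qed.

Lemma walkE_rcons n f :
  walkE n.+1 f = 4^-1 * \sum_(d <- dirs) walkE n (fun s => f (rcons s d)).
Proof.
rewrite -addn1 walkE_cat -walkE_sum -walkEZ.
apply: eq_walkE => s _; rewrite walkE1; congr (_ * _).
by apply: eq_bigr => d _; rewrite cats1.
Qed.

Lemma walkE_rev n f : walkE n (fun s => f (rev s)) = walkE n f.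
Proof.
elim: n f => [|n IHn] f; first by rewrite !walkE0.
rewrite walkES walkE_rcons; congr (_ * _); apply: eq_bigr => d _.
by rewrite -(IHn (fun s => f (rcons s d))); apply: eq_walkE => s _; rewrite rev_cons.
Qed.

Lemma sum_dirsN (h : Z2 -> R) : \sum_(d <- dirs) h (- d) = \sum_(d <- dirs) h d.
Proof.
rewrite /dirs !big_cons !big_nil.
have -> : - (1, 0) = (-1, 0) :> Z2 by rewrite /GRing.opp/= /GRing.opp/=.
have -> : - (-1, 0) = (1, 0) :> Z2 by rewrite /GRing.opp/= /GRing.opp/=.
have -> : - (0, 1) = (0, -1) :> Z2 by rewrite /GRing.opp/= /GRing.opp/=.
have -> : - (0, -1) = (0, 1) :> Z2 by rewrite /GRing.opp/= /GRing.opp/=.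
ring.
Qed.

Lemma walkE_opp n f : walkE n (fun s => f (map -%R s)) = walkE n f.
Proof.
elim: n f => [|n IHn] f; first by rewrite !walkE0.
rewrite !walkES -[in RHS]sum_dirsN; congr (_ * _); apply: eq_bigr => d _.
exact: (IHn (fun s => f (- d :: s))).
Qed.

End WalkMean.

(** * Wallis bounds *)

Section Wallis.
Variable R : realType.
Notation mu := (@lebesgue_measure R).

Let itv0 := `[0%R, (pi / 2 : R)]%classic.
(** Wallis integrals. Those of even index are multiples of the return probability [wallis], those of
    odd index of its inverse, so their monotonicity pins down [wallis m ^+ 2] on both sides with the
    constant $\pi$. *)
Let I (n : nat) : R := (\int[mu]_(x in itv0) (sin x ^+ n))%R.

Let cont_sinX n : continuous (fun x : R => sin x ^+ n).
Proof. move=> x; apply: (@continuous_comp _ _ _ (@sin R) (fun y => y ^+ n)).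
  exact: continuous_sin.
exact: exprn_continuous. Qed.

Let integrable_cont (f : R -> R) : continuous f -> mu.-integrable itv0 (EFin \o f).
Proof.
move=> cf; apply: continuous_compact_integrable; first exact: segment_compact.
exact: continuous_subspaceT.
Qed.

Let FTC (f F : R -> R) : continuous f ->
  (forall x : R, is_derive x 1 F (f x)) ->
  (\int[mu]_(x in itv0) f x)%R = F (pi / 2) - F 0.
Proof.
move=> cf dF; have cF : continuous F.
  by move=> x; apply/differentiable_continuous/derivable1_diffP; case: (dF x).
rewrite /Rintegral (@continuous_FTC2 _ f F)//.
- by rewrite divr_gt0// pi_gt0.
- exact: continuous_subspaceT.
- split=> [x _| |]; first by case: (dF x).
    by apply: cvg_at_right_filter; exact: cF.
  by apply: cvg_at_left_filter; exact: cF.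
- by move=> x _; rewrite derive1E; case: (dF x).
Qed.

Let I0 : I 0 = pi / 2.
Proof.
apply: etrans (@FTC (fun x => sin x ^+ 0) id _ _) _.
- exact: cont_sinX.
- by rewrite subr0.
Qed.

Let I1 : I 1 = 1.
Proof.
apply: etrans (@FTC (fun x => sin x ^+ 1) (fun x => - cos x) _ _) _.
- exact: cont_sinX.
- by move=> x; apply: is_derive_eq; rewrite expr1 opprK.
- by rewrite cos_pihalf cos0 oppr0 opprK add0r.
Qed.

(** The derivative of $\sin^{n+1}\cos$ is the difference of the two weighted integrands, and this
    function vanishes at both ends of the interval. *)
Let Irec n : n.+1%:R * I n = n.+2%:R * I n.+2.
Proof.
pose f (x : R) := n.+1%:R * sin x ^+ n - n.+2%:R * sin x ^+ n.+2.
have cf : continuous f.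
  by move=> x; apply: cvgB; apply: cvgMr; exact: cont_sinX.
have : (\int[mu]_(x in itv0) f x)%R = 0.
  apply: etrans (@FTC f ((@sin R) ^+ n.+1 * (@cos R)) cf _) _; last first.
    by rewrite !fctE cos_pihalf mulr0 sin0 expr0n mul0r subrr.
  move=> x; apply: is_derive_eq.
  rewrite /f !fctE /GRing.scale/= !exprS -[n.+2]add1n natrD -![n.+1]add1n natrD.
  have -> : cos x * ((1 + n%:R) * sin x ^+ n * cos x)
      = (1 + n%:R) * sin x ^+ n * cos x ^+ 2 by ring.
  have := cos2Dsin2 x; set s := sin x; set c := cos x => /eqP.
  rewrite -[_ == _]subr_eq0 => /eqP e; rewrite -[RHS]addr0 -[X in _ = _ + X](mulr0 ((1 + n%:R) * s ^+ n)) -e; ring.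
rewrite RintegralB//; [|exact: measurable_itv| |].
  rewrite !RintegralZl//; try exact: measurable_itv.
  - by move=> /eqP; rewrite subr_eq0 => /eqP.
  - exact: integrable_cont.
  - exact: integrable_cont.
- by apply: integrable_cont => x; apply: cvgMr; exact: cont_sinX.
- by apply: integrable_cont => x; apply: cvgMr; exact: cont_sinX.
Qed.

Let Idecr n : I n.+1 <= I n.
Proof.
apply: le_Rintegral; [exact: measurable_itv| | |].
- exact: (@integrable_cont (fun x => sin x ^+ n.+1)).
- exact: (@integrable_cont (fun x => sin x ^+ n)).
- move=> x; rewrite /itv0 /= in_itv/= => /andP [x0 xp].
  have s0 : 0 <= sin x by apply: sin_ge0_pi; rewrite x0 (le_trans xp)// ler_pdivrMr// ler_peMr ?pi_ge0// ler1n.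
  by rewrite exprS ler_piMl ?exprn_ge0// sin_le1.
Qed.

(** Probability that a one-dimensional simple walk is back at its start after $2m$ steps. *)
Definition wallis (m : nat) : R := 'C(m.*2, m)%:R / 4 ^+ m.

Lemma wallis0 : wallis 0 = 1.
Proof. by rewrite /wallis bin0 expr0 divr1. Qed.

Lemma wallis_gt0 m : 0 < wallis m.
Proof. by rewrite divr_gt0 ?exprn_gt0// ltr0n bin_gt0 -addnn leq_addr. Qed.

Lemma wallisS m : m.+1.*2%:R * wallis m.+1 = m.*2.+1%:R * wallis m.
Proof.
have e : (m.+1 * 'C(m.+1.*2, m.+1) = (m.*2.+1).*2 * 'C(m.*2, m))%N.
  apply/eqP; rewrite -(@eqn_pmul2l m.+1)//; apply/eqP.
  have h1 := mul_bin_diag m.*2.+2 m.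
  have h2 := mul_bin_diag m.*2.+1 m.
  have h3 : 'C(m.*2.+1, m) = 'C(m.*2.+1, m.+1).
    rewrite -(@bin_sub _ m.+1); last by rewrite ltnS -addnn leq_addr.
    by congr 'C(_, _); lia.
  rewrite -pred_Sn in h1; rewrite -pred_Sn in h2; rewrite doubleS -h1 h3; nia.
have e' : m.+1%:R * 'C(m.+1.*2, m.+1)%:R = m.*2.+1%:R * 2 * 'C(m.*2, m)%:R :> R.
  by rewrite -!natrM e -muln2.
have -> : m.+1.*2%:R = m.+1%:R * 2 :> R by rewrite -muln2 natrM.
have E4 : (4 : R) ^+ m != 0 by rewrite expf_neq0.
rewrite /wallis exprS; transitivity (m.+1%:R * 'C(m.+1.*2, m.+1)%:R / (2 * 4 ^+ m) : R); first by field.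
by rewrite e'; field.
Qed.

Let IE m : I m.*2 = pi / 2 * wallis m /\ I m.*2.+1 = (m.*2.+1%:R * wallis m)^-1.
Proof.
elim: m => [|m [IHe IHo]]; first by rewrite wallis0 I0 I1 !mulr1 invr1.
have w0 := wallis_gt0 m; have w1 := wallis_gt0 m.+1.
have e := wallisS m.
split.
  have := Irec m.*2; rewrite IHe -doubleS => h.
  apply: (@mulfI _ m.+1.*2%:R); first by rewrite pnatr_eq0.
  by rewrite -h [RHS]mulrCA e mulrCA.
have := Irec m.*2.+1; rewrite IHo -doubleS => h.
apply: (@mulfI _ m.+1.*2.+1%:R); first by rewrite pnatr_eq0.
by rewrite -h -e !invfM !mulrA !divff ?mul1r// ?pnatr_eq0//; rewrite divff ?pnatr_eq0// mul1r.
Qed.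

Lemma wallis_sqr_ge m : (pi * (m%:R + 2^-1))^-1 <= wallis m ^+ 2.
Proof.
have [he ho] := IE m; have := Idecr m.*2; rewrite he ho.
have w0 := wallis_gt0 m; have p0 := pi_gt0 R.
have -> : m.*2.+1%:R = (m%:R + 2^-1) * 2 :> R by rewrite -addn1 natrD -muln2 natrM; field.
have m0 : 0 < m%:R + 2^-1 :> R by rewrite ltr_wpDl// ler0n.
move=> h; rewrite -div1r ler_pdivrMr ?mulr_gt0//.
move: h; set w := wallis m in w0 *; set a := _ + 2^-1 in m0 * => h.
clearbody w a; have a2w : 0 < a * 2 * w by rewrite !mulr_gt0.
move: h; rewrite -div1r ler_pdivrMr // => h.
by apply: le_trans h _; rewrite le_eqVlt; apply/orP; left; apply/eqP; field.
Qed.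

Lemma wallis_sqr_le m : (0 < m)%N -> wallis m ^+ 2 <= (pi * m%:R)^-1.
Proof.
case: m => // m _; have [he _] := IE m.+1; have [_ ho] := IE m.
have := Idecr m.*2.+1; rewrite -doubleS he ho -wallisS -muln2 natrM.
have w0 := wallis_gt0 m.+1; have p0 := pi_gt0 R.
have m0 : 0 < m.+1%:R :> R by rewrite ltr0n.
set w := wallis m.+1 in w0 *; set a := m.+1%:R in m0 * => h.
clearbody w a; have a2w : 0 < a * 2 * w by rewrite !mulr_gt0.
move: h; rewrite -[(a * 2 * w)^-1]div1r ler_pdivlMr // => h.
rewrite -[(pi * a)^-1]div1r ler_pdivlMr ?mulr_gt0//.
by apply: le_trans h; rewrite le_eqVlt; apply/orP; left; apply/eqP; field.
Qed.

End Wallis.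

(** * Transition probabilities and Green function *)

Section Kernel.
Variable R : realType.

Definition pk (k : nat) (z : Z2) : R := walkE k (fun s => (endpoint s == z)%:R).

Lemma pk0 z : pk 0 z = (z == 0)%:R.
Proof. by rewrite /pk walkE0 endpoint_nil eq_sym. Qed.

Lemma pkS k z : pk k.+1 z = 4^-1 * \sum_(d <- dirs) pk k (z - d).
Proof.
rewrite /pk walkES; congr (_ * _); apply: eq_bigr => d _.
apply: eq_walkE => s _; rewrite endpoint_cons; congr (_%:R).
by rewrite -(inj_eq (addrI d) (endpoint s)) addrCA subrr addr0.
Qed.

Lemma pk_ge0 k z : 0 <= pk k z.
Proof. by apply: walkE_ge0 => s _. Qed.

(** Law of the one-dimensional simple walk after [k] steps. *)
Fixpoint coin (k : nat) (u : int) : R :=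
  if k is k'.+1 then (coin k' (u - 1) + coin k' (u + 1)) / 2 else (u == 0)%:R.

Lemma coin_ge0 k u : 0 <= coin k u.
Proof.
by elim: k u => [|k IHk] u //=; rewrite divr_ge0// addr_ge0.
Qed.

(* Rotating the lattice by 45 degrees turns the planar walk into two independent
   one-dimensional walks. *)
Lemma pk_coin k (z : Z2) : pk k z = coin k (z.1 + z.2) * coin k (z.1 - z.2).
Proof.
elim: k z => [|k IHk] [a b] /=.
  rewrite pk0 -natrM mulnb; congr ((nat_of_bool _)%:R).
  apply/idP/idP => [/eqP [-> ->] //|/andP [/eqP h1 /eqP h2]]; apply/eqP.
  by have [-> ->] : a = 0 /\ b = 0 by lia.
rewrite pkS /dirs !big_cons big_nil !IHk /=.
have e (x y : int) : (a, b) - (x, y) = (a - x, b - y) by [].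
rewrite !subr0 !opprK.
have -> : a - 1 + b = a + b - 1 by lia.
have -> : a + 1 + b = a + b + 1 by lia.
have -> : a - 1 - b = a - b - 1 by lia.
have -> : a + 1 - b = a - b + 1 by lia.
have -> : a + (b - 1) = a + b - 1 by lia.
have -> : a + (b + 1) = a + b + 1 by lia.
have -> : a - (b - 1) = a - b + 1 by lia.
have -> : a - (b + 1) = a - b - 1 by lia.
by field.
Qed.

Lemma coinN k u : coin k (- u) = coin k u.
Proof.
elim: k u => [|k IHk] u /=; first by rewrite oppr_eq0.
have e1 : - u - 1 = - (u + 1) by rewrite opprD.
have e2 : - u + 1 = - (u - 1) by rewrite opprB addrC.
by rewrite e1 e2 !IHk addrC.
Qed.

Lemma pkN k z : pk k (- z) = pk k z.
Proof.
case: z => a b; rewrite !pk_coin /= -opprD coinN; congr (_ * _).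
by rewrite -coinN; congr coin; lia.
Qed.

Lemma coin_parity k u : odd (absz u) != odd k -> coin k u = 0.
Proof.
elim: k u => [|k IHk] u /= h.
  by case: (eqVneq u 0) h => [->|].
rewrite !IHk ?addr0 ?mul0r//.
  by move: h; case: (odd k) => /=; lia.
by move: h; case: (odd k) => /=; lia.
Qed.

Lemma coin_out k u : (k < absz u)%N -> coin k u = 0.
Proof.
elim: k u => [|k IHk] u /= h; first by case: eqP h => // ->.
by rewrite !IHk ?addr0 ?mul0r//; lia.
Qed.

Lemma coin_bin k (j : nat) : coin k (j.*2%:Z - k%:Z) = 'C(k, j)%:R / 2 ^+ k.
Proof.
elim: k j => [|k IHk] [|j] /=.
- by rewrite bin0 divr1.
- by rewrite bin0n mul0r.
- rewrite coin_out ?add0r; last lia.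
  have -> : - k.+1%:Z + 1 = 0.*2%:Z - k%:Z by lia.
  by rewrite IHk !bin0 exprS; field.
- have -> : j.+1.*2%:Z - k.+1%:Z - 1 = j.*2%:Z - k%:Z by lia.
  have -> : j.+1.*2%:Z - k.+1%:Z + 1 = j.+1.*2%:Z - k%:Z by lia.
  by rewrite !IHk binS natrD exprS; field.
Qed.

Lemma coin0 m : coin m.*2 0 = wallis R m.
Proof.
have -> : 0 = m.*2%:Z - m.*2%:Z by rewrite subrr.
by rewrite coin_bin /wallis -mul2n exprM; congr (_ / _ ^+ _); ring.
Qed.

(** Ratio of the neighbouring binomial coefficients $\binom{2m}{m+i+1}$ and $\binom{2m}{m+i}$,
    cleared of denominators. *)
Lemma coin_step m i : (i < m)%N ->
  (m%:R + i%:R + 1) * coin m.*2 i.+1.*2%:Z = (m%:R - i%:R) * coin m.*2 i.*2%:Z.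
Proof.
move=> im; have -> : i.+1.*2%:Z = (m + i.+1)%N.*2%:Z - m.*2%:Z by lia.
have -> : i.*2%:Z = (m + i)%N.*2%:Z - m.*2%:Z by lia.
rewrite !coin_bin !mulrA; congr (_ / _).
have := mul_bin_left m.*2 (m + i); rewrite addnS.
have -> : (m.*2 - (m + i) = m - i)%N by lia.
move=> /(congr1 (fun k => k%:R : R)); rewrite !natrM natrB 1?ltnW// => <-.
by rewrite -addn1 !natrD.
Qed.

Lemma coin_decr m (i : nat) : coin m.*2 i.+1.*2%:Z <= coin m.*2 i.*2%:Z.
Proof.
have [mi|im] := leqP m i; first by rewrite coin_out ?coin_ge0//; lia.
have e := coin_step im.
have c0 := coin_ge0 m.*2 i.+1.*2%:Z.
have c0' := coin_ge0 m.*2 i.*2%:Z.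
have m0 : 0 < m%:R :> R by rewrite ltr0n; lia.
have i0 : 0 <= i%:R :> R by [].
nra.
Qed.

Lemma coin_le m (u : int) : coin m.*2 u <= wallis R m.
Proof.
wlog : u / 0 <= u => [h|].
  by have [/h//|u0] := lerP 0 u; rewrite -coinN h// oppr_ge0 ltW.
case: u => // n _; have [on|en] := boolP (odd n).
  rewrite coin_parity ?(ltW (wallis_gt0 _ _))//.
  by rewrite odd_double on.
have -> : n = n./2.*2 by rewrite -[LHS]odd_double_half (negbTE en).
elim: n./2 => [|i IHi]; first by rewrite coin0.
exact: le_trans (coin_decr _ _) IHi.
Qed.

(** By [coin_step], passing from $2i$ to $2i+2$ loses at most a fraction $(2i+1)/m$ of the central
    value, and $1+3+\dots+(2i-1)=i^2$. *)
Lemma coin_ge m (i : nat) : (0 < m)%N ->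
  wallis R m * (1 - i%:R ^+ 2 / m%:R) <= coin m.*2 i.*2%:Z.
Proof.
move=> m_gt0; have w0 := wallis_gt0 R m.
have m0 : 0 < m%:R :> R by rewrite ltr0n.
elim: i => [|i IH].
  by rewrite coin0 expr0n mul0r subr0 mulr1.
have [mi|im] := leqP m i.
  apply: le_trans (coin_ge0 _ _).
  rewrite mulr_ge0_le0 ?(ltW w0)// subr_le0 ler_pdivlMr// mul1r.
  by rewrite -natrX ler_nat; nia.
have e := coin_step im; have d := coin_decr m i.
have i0 : 0 <= i%:R :> R by [].
have L := coin_le m i.*2%:Z.
have -> : i.+1%:R = i%:R + 1 :> R by rewrite -addn1 natrD.
set x := coin _ _ in e d *; set y := coin _ _ in e d L IH.
have : wallis R m * (1 - i%:R ^+ 2 / m%:R) - wallis R m * ((2 * i%:R + 1) / m%:R) <= x.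
  have : y - x <= wallis R m * ((2 * i%:R + 1) / m%:R); last by lra.
  have : (y - x) * m%:R <= wallis R m * (2 * i%:R + 1).
    have h1 : 0 <= (y - x) * (i%:R + 1) by rewrite mulr_ge0 ?subr_ge0// addr_ge0.
    have h2 : 0 <= (wallis R m - y) * (2 * i%:R + 1).
      by rewrite mulr_ge0 ?subr_ge0// addr_ge0// mulr_ge0.
    lra.
  by rewrite mulrA ler_pdivlMr.
apply: le_trans; rewrite -mulrBr ler_pM2l// le_eqVlt; apply/orP; left; apply/eqP.
by field; rewrite gt_eqF.
Qed.

Definition green (n : nat) (z : Z2) : R := \sum_(k < n.+1) pk k z.

Lemma green_ge0 n z : 0 <= green n z.
Proof. by apply: sumr_ge0 => k _; apply: pk_ge0. Qed.

Lemma green0 z : green 0 z = (z == 0)%:R.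
Proof. by rewrite /green big_ord_recl big_ord0 addr0 pk0. Qed.

Lemma greenS n z : green n.+1 z = green n z + pk n.+1 z.
Proof. by rewrite /green big_ord_recr. Qed.

Lemma greenSl n z :
  green n.+1 z = (z == 0)%:R + 4^-1 * \sum_(d <- dirs) green n (z - d).
Proof.
rewrite /green big_ord_recl pk0; congr (_ + _).
rewrite exchange_big /= mulr_sumr; apply: eq_bigr => k _; exact: pkS.
Qed.

Lemma green_le n m z : (n <= m)%N -> green n z <= green m z.
Proof.
elim: m => [|m IHm]; first by rewrite leqn0 => /eqP ->.
rewrite leq_eqVlt => /orP [/eqP ->//|/IHm h].
by rewrite greenS ler_wpDr// pk_ge0.
Qed.

(** At an odd time the law is an average of four values at the preceding even time, hence the
    rounding down in [k./2]. *)
Lemma pk_le k z : pk k z <= wallis R k./2 ^+ 2.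
Proof.
have even_le m u v : coin m.*2 u * coin m.*2 v <= wallis R m ^+ 2.
  by rewrite expr2 ler_pM ?coin_ge0 ?coin_le.
rewrite -[k in pk k]odd_double_half; case: (odd k); last first.
  by rewrite add0n pk_coin even_le.
rewrite add1n pkS /dirs !big_cons big_nil !pk_coin.
have h := even_le k./2.
set a := coin _ _ * coin _ _; set b := coin _ _ * coin _ _; set c := coin _ _ * coin _ _; set d := coin _ _ * coin _ _.
have ha : a <= wallis R k./2 ^+ 2 by apply: h.
have hb : b <= wallis R k./2 ^+ 2 by apply: h.
have hc : c <= wallis R k./2 ^+ 2 by apply: h.
have hd : d <= wallis R k./2 ^+ 2 by apply: h.
lra.
Qed.

Lemma pk_parity k (z : Z2) : odd (absz (z.1 + z.2)) != odd k -> pk k z = 0.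
Proof. by move=> h; rewrite pk_coin coin_parity ?mul0r. Qed.

Lemma pk_even0 m : pk m.*2 0 = wallis R m ^+ 2.
Proof.
rewrite pk_coin; have -> : (0 : Z2).1 + (0 : Z2).2 = 0 by [].
by rewrite coin0 expr2.
Qed.

Lemma pk_le_inv k z : pk k z <= 2 / k.+1%:R.
Proof.
apply: le_trans (pk_le k z) _; have p2 := pi_ge2 R.
have [k2|k2] := leqP k 1.
  have -> : k./2 = 0%N by case: k k2 => [|[]].
  rewrite wallis0 expr1n ler_pdivlMr// mul1r.
  by rewrite (ler_nat R k.+1 2).
have m0 : (0 < k./2)%N by lia.
apply: le_trans (wallis_sqr_le R m0) _.
have m0' : 0 < k./2%:R :> R by rewrite ltr0n.
rewrite -[X in X <= _]div1r ler_pdivrMr; last by rewrite mulr_gt0// pi_gt0.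
rewrite mulrAC ler_pdivlMr// mul1r.
have : k.+1%:R <= 4 * k./2%:R :> R by rewrite -natrM ler_nat; lia.
nra.
Qed.

Lemma green0_wallis n : green n 0 = \sum_(m < n./2.+1) wallis R m ^+ 2.
Proof.
elim: n => [|n IHn]; first by rewrite green0 eqxx big_ord_recl big_ord0 wallis0 expr1n addr0.
have -> : n.+1./2 = (odd n + n./2)%N by rewrite /= uphalf_half.
rewrite greenS IHn; case: (boolP (odd n)) => on.
  rewrite add1n [RHS]big_ord_recr /=; congr (_ + _).
  have -> : n.+1 = n./2.+1.*2 by rewrite -[in LHS](odd_double_half n) on.
  by rewrite pk_even0.
by rewrite pk_parity ?addr0// /= on.
Qed.

Definition sqn (z : Z2) : R := (z.1 ^+ 2 + z.2 ^+ 2)%:~R.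

Lemma sqn_ge0 z : 0 <= sqn z.
Proof. by rewrite ler0z addr_ge0// sqr_ge0. Qed.

(** In the coordinates $a=(x+y)/2$, $b=(x-y)/2$ the relative losses of the two factors are at most
    $a^2/m$ and $b^2/m$, with $a^2+b^2=|z|^2/2$, and [wallis R m ^+ 2] is at most $1/(2m)$. The
    result is summable in [m], which keeps $G_n(0)-G_n(z)$ bounded in [n]. *)
Lemma pk_sub m (z : Z2) : ~~ odd (absz (z.1 + z.2)) -> (0 < m)%N ->
  pk m.*2 0 - pk m.*2 z <= sqn z / 4 / m%:R ^+ 2.
Proof.
case: z => x y /= ev m0; rewrite pk_even0 pk_coin /=.
pose a := (absz (x + y))./2; pose b := (absz (x - y))./2.
have ha : coin m.*2 (x + y) = coin m.*2 a.*2%:Z.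
  have [h|h] := lerP 0 (x + y); first by congr coin; rewrite /a; lia.
  by rewrite -coinN; congr coin; rewrite /a; lia.
have hb : coin m.*2 (x - y) = coin m.*2 b.*2%:Z.
  have [h|h] := lerP 0 (x - y); first by congr coin; rewrite /b; lia.
  by rewrite -coinN; congr coin; rewrite /b; lia.
have -> : sqn (x, y) = 2 * (a%:R ^+ 2 + b%:R ^+ 2).
  have -> : 2 * (a%:R ^+ 2 + b%:R ^+ 2) = (2 * (a%:Z ^+ 2 + b%:Z ^+ 2))%:~R :> R.
    have sq (n : nat) : n%:R ^+ 2 = (n%:Z ^+ 2)%:~R :> R by rewrite !expr2 intrM.
    by rewrite intrM (intrD _ (a%:Z ^+ 2)) !sq.
  congr (_%:~R) => /=.
  have h1 : (x + y) ^+ 2 = 4 * a%:Z ^+ 2.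
    have [->|->] : x + y = 2 * a%:Z \/ x + y = - (2 * a%:Z) by rewrite /a; lia.
      by ring.
    by ring.
  have h2 : (x - y) ^+ 2 = 4 * b%:Z ^+ 2.
    have [->|->] : x - y = 2 * b%:Z \/ x - y = - (2 * b%:Z) by rewrite /b; lia.
      by ring.
    by ring.
  have h3 : (x + y) ^+ 2 + (x - y) ^+ 2 = 2 * (x ^+ 2 + y ^+ 2) by ring.
  by apply: (@mulfI _ (2 : int)) => //; rewrite -h3 h1 h2; ring.
rewrite ha hb.
have A := coin_ge a m0; have B := coin_ge b m0.
have A0 := coin_ge0 m.*2 a.*2%:Z; have B0 := coin_ge0 m.*2 b.*2%:Z.
have w0 := wallis_gt0 R m; have wl := wallis_sqr_le R m0.
have m0' : 0 < m%:R :> R by rewrite ltr0n.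
set u := coin _ _ in A A0 *; set v := coin _ _ in B B0 *.
set s := a%:R ^+ 2 / m%:R in A *; set t := b%:R ^+ 2 / m%:R in B *.
have s0 : 0 <= s by rewrite divr_ge0 ?sqr_ge0// ltW.
have t0 : 0 <= t by rewrite divr_ge0 ?sqr_ge0// ltW.
have step : wallis R m ^+ 2 - u * v <= wallis R m ^+ 2 * (s + t).
  have [s1|s1] := lerP 1 s.
    have : 0 <= wallis R m ^+ 2 * (s + t - 1) by rewrite mulr_ge0 ?sqr_ge0//; lra.
    by have := mulr_ge0 A0 B0; lra.
  have [t1|t1] := lerP 1 t.
    have : 0 <= wallis R m ^+ 2 * (s + t - 1) by rewrite mulr_ge0 ?sqr_ge0//; lra.
    by have := mulr_ge0 A0 B0; lra.
  have : (wallis R m * (1 - s)) * (wallis R m * (1 - t)) <= u * v.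
    by rewrite ler_pM// mulr_ge0 ?(ltW w0)//; lra.
  have : 0 <= wallis R m ^+ 2 * (s * t) by rewrite !mulr_ge0 ?sqr_ge0.
  by rewrite expr2; lra.
apply: le_trans step _.
have -> : s + t = (a%:R ^+ 2 + b%:R ^+ 2) / m%:R by rewrite /s /t mulrDl.
have p2 := pi_ge2 R.
have wl2 : wallis R m ^+ 2 <= (2 * m%:R)^-1.
  apply: le_trans wl _; rewrite lef_pV2 ?posrE ?mulr_gt0 ?pi_gt0//.
  by rewrite ler_pM2r.
apply: (@le_trans _ _ ((2 * m%:R)^-1 * ((a%:R ^+ 2 + b%:R ^+ 2) / m%:R))).
  by rewrite ler_wpM2r// divr_ge0 ?addr_ge0 ?sqr_ge0// ltW.
rewrite le_eqVlt; apply/orP; left; apply/eqP; field.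
by rewrite gt_eqF.
Qed.

End Kernel.

(** * Green function: logarithmic growth at 0, comparison between sites, square sums *)

Section GreenBounds.
Variable R : realType.
Local Notation green := (@green R).
Local Notation pk := (@pk R).
Local Notation sqn := (@sqn R).

Lemma ln_succ_sub (x : R) : 0 < x -> ln (x + 1) - ln x <= x^-1.
Proof.
move=> x0; rewrite -ln_div ?posrE ?addr_gt0// mulrDl divff ?gt_eqF// mul1r.
by apply: le_ln1Dx; apply: lt_trans (_ : 0 < _); rewrite ?ltrN10 ?invr_gt0.
Qed.

Lemma ln_succ_sub_ge (x : R) : 0 < x -> (x + 1)^-1 <= ln (x + 1) - ln x.
Proof.
move=> x0; have x1 : 0 < x + 1 by rewrite addr_gt0.
rewrite -[leLHS]opprK lerNl opprB -ln_div ?posrE//.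
have -> : x / (x + 1) = 1 - (x + 1)^-1 by field; rewrite gt_eqF.
by apply: le_ln1Dx; rewrite ltrN2 invf_lt1// ltrDr.
Qed.

Lemma pk_le1 k z : pk k z <= 1.
Proof.
rewrite -(walkE_cst k (1 : R)); apply: ler_walkE => s _.
by case: eqP => // _; rewrite ler01.
Qed.

Lemma green_sub_even n (z : Z2) : ~~ odd (absz (z.1 + z.2)) ->
  green n 0 - green n z <= 1 + 2 * sqn z.
Proof.
move=> ev; have s0 := sqn_ge0 R z.
(* The sharper claim telescopes, since $(n+1)^{-2}\le n^{-1}-(n+1)^{-1}$. At $n=0$ the convention
   $0^{-1}=0$ makes the factor equal to 2. *)
suff : green n 0 - green n z <= 1 + sqn z * (2 - n%:R^-1).
  have : 0 <= sqn z * n%:R^-1 by rewrite mulr_ge0 ?invr_ge0.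
  lra.
elim: n => [|n IHn].
  rewrite !green0 eqxx invr0 subr0; case: eqP => _ /=; lra.
rewrite !greenS.
have step : pk n.+1 0 - pk n.+1 z <= sqn z / n.+1%:R ^+ 2.
  have n1 : 0 < n.+1%:R :> R by rewrite ltr0n.
  have [on|en] := boolP (odd n.+1).
    rewrite (@pk_parity _ _ 0) ?on// (@pk_parity _ _ z) ?on ?(negbTE ev)// subrr.
    by rewrite divr_ge0// exprn_ge0// ltW.
  have -> : n.+1 = n.+1./2.*2 by rewrite -[LHS]odd_double_half (negbTE en).
  apply: le_trans (pk_sub R ev _) _; first lia.
  rewrite -mulrA -invfM; set m := n.+1./2.
  by rewrite -muln2 natrM exprMn [_ * 2 ^+ 2]mulrC (_ : 2 ^+ 2 = 4)// expr2; ring.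
case: (posnP n) IHn step => [-> _|n0 IHn step].
  rewrite !green0 eqxx (_ : 1%:R = 1 :> R)// invr1 expr1n divr1 => step.
  move: step.
  case: eqP => _ /=; lra.
have n0' : 0 < n%:R :> R by rewrite ltr0n.
have nS : n.+1%:R = n%:R + 1 :> R by rewrite -addn1 natrD.
have tel : (n.+1%:R ^+ 2)^-1 <= n%:R^-1 - n.+1%:R^-1 :> R.
  rewrite nS; have n1 : 0 < n%:R + 1 :> R by rewrite addr_gt0.
  have -> : n%:R^-1 - (n%:R + 1)^-1 = (n%:R * (n%:R + 1))^-1 :> R.
    by field; rewrite !gt_eqF.
  by rewrite lef_pV2 ?posrE ?mulr_gt0// expr2 ler_pM2r// lerDl.
move: step IHn (ler_wpM2l s0 tel); clear.
set a := n%:R^-1; set b := n.+1%:R^-1; set c := (n.+1%:R ^+ 2)^-1.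
by clearbody a b c; rewrite !mulrBr; lra.
Qed.

Lemma sum_sqn_dirs (z : Z2) : \sum_(d <- dirs) sqn (z - d) = 4 * sqn z + 4.
Proof.
case: z => x y; rewrite /dirs !big_cons big_nil /sqn /= !subr0 !opprK.
by rewrite !(intrD, intrM, intrB, expr2); ring.
Qed.

Lemma odd_sub_dirs (z d : Z2) : d \in dirs ->
  odd (absz ((z - d).1 + (z - d).2)) = ~~ odd (absz (z.1 + z.2)).
Proof.
case: z => x y; rewrite !inE => /or4P [] /eqP -> /=; lia.
Qed.

(** The neighbours of an odd site are even: averaging the even bound over them turns [sqn z] into
    [sqn z + 1]. The constant 4 is $1+2$ from that average, plus 1 for the extra time step. *)
Lemma green_sub n (z : Z2) : green n 0 - green n z <= 4 + 2 * sqn z.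
Proof.
have s0 := sqn_ge0 R z.
have [od|ev] := boolP (odd (absz (z.1 + z.2))); last first.
  by have := green_sub_even n ev; lra.
case: n => [|n]; first by rewrite !green0 eqxx; case: eqP => _ /=; lra.
have zn0 : z != 0 by apply: contraTneq od => ->.
rewrite (greenSl _ n z) (negbTE zn0) add0r greenS.
have : \sum_(d <- dirs) (green n 0 - 1 - 2 * sqn (z - d)) <=
       \sum_(d <- dirs) green n (z - d).
  rewrite big_seq [leRHS]big_seq; apply: ler_sum => d dd.
  have := @green_sub_even n (z - d); rewrite odd_sub_dirs// od => /(_ isT); lra.
rewrite sumrB -mulr_sumr sum_sqn_dirs.
have -> : \sum_(d <- dirs) (green n 0 - 1) = 4 * (green n 0 - 1).
  by rewrite /dirs !big_cons big_nil; ring.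
have := pk_le1 n.+1 0; lra.
Qed.

(** For an even site the comparison is term by term. For an odd site only odd times count, and the
    term at time $2m+1$ is dominated by the return probability at time $2m$. *)
Lemma green_le0 n z : green n z <= green n 0.
Proof.
have [od|ev] := boolP (odd (absz (z.1 + z.2))); last first.
  apply: ler_sum => k _; have [ok|ek] := boolP (odd k).
    by rewrite !pk_parity ?ok// (negbTE ev).
  have {2}-> : val k = k./2.*2 by rewrite -[LHS]odd_double_half (negbTE ek).
  by rewrite pk_even0 pk_le.
rewrite green0_wallis.
apply: (@le_trans _ _ (\sum_(m < uphalf n) wallis R m ^+ 2)).
  elim: n => [|n IHn].
    by rewrite green0 big_ord0; case: eqP od => [->|].
  rewrite greenS; have [on|en] := boolP (odd n).
    rewrite pk_parity ?addr0//=; last by rewrite on od.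
    by move: IHn; rewrite uphalf_half on.
  move: IHn; rewrite uphalf_half (negbTE en) add0n => IHn.
  have -> : uphalf n.+1 = n./2.+1 by rewrite /=.
  rewrite big_ord_recr /= lerD//; apply: le_trans (pk_le _ _ _) _.
  by rewrite /= uphalf_half (negbTE en).
have : (uphalf n <= n./2.+1)%N by rewrite uphalf_half; case: odd => //; rewrite add0n ltnW.
move: (n./2.+1) => m; elim: m => [|m IHm]; first by rewrite leqn0 => /eqP ->.
rewrite leq_eqVlt => /orP [/eqP ->//|/IHm h].
by rewrite [leRHS]big_ord_recr /= ler_wpDr// sqr_ge0.
Qed.

Lemma green0_ge1 n : 1 <= green n 0.
Proof.
rewrite /green big_ord_recl pk0 eqxx ler_wpDr// sumr_ge0// => k _; exact: pk_ge0.
Qed.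

(** The terms with $m\ge1$ are at most $1/(\pi m)$, and a harmonic sum is at most 1 plus the
    logarithm; $1+1/\pi$ fits into the constant 2. *)
Lemma green0_le n : (0 < n)%N -> green n 0 <= ln n%:R / pi + 2.
Proof.
move=> n0; have p2 := pi_ge2 R; have p0 := pi_gt0 R.
rewrite green0_wallis.
have H M : \sum_(m < M.+2) wallis R m ^+ 2 <= 1 + (1 + ln M.+1%:R) / pi.
  elim: M => [|M IHM].
    rewrite !big_ord_recl big_ord0 addr0 /= wallis0 expr1n lerD2l.
    by have := @wallis_sqr_le R 1 isT; rewrite mulr1 ln1 addr0 mul1r.
  rewrite big_ord_recr /=; apply: le_trans (lerD IHM (wallis_sqr_le R (ltn0Sn _))) _.
  rewrite -addrA lerD2l invfM [pi^-1 * _]mulrC -mulrDl ler_pM2r ?invr_gt0//.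
  rewrite -addrA lerD2l -lerBrDl.
  have -> : M.+2%:R = M.+1%:R + 1 :> R by rewrite -[M.+2]addn1 natrD.
  by apply: ln_succ_sub_ge; rewrite ltr0n.
have ln0 : 0 <= ln n%:R :> R by rewrite ln_ge0// ler1n.
have lp : 0 <= ln n%:R / pi :> R by rewrite divr_ge0// ltW.
have ip : pi^-1 <= 1 :> R by rewrite invf_le1//; lra.
case e : n./2 => [|M].
  by rewrite big_ord_recl big_ord0 addr0 wallis0 expr1n; lra.
apply: le_trans (H M) _; rewrite mulrDl mul1r.
have : ln M.+1%:R / pi <= ln n%:R / pi :> R; last by lra.
rewrite ler_pM2r ?invr_gt0// ler_ln ?posrE ?ltr0n// ler_nat; lia.
Qed.

(** The terms are at least $1/(\pi(m+1))$. The sum stops near $n/2$, which costs $\log 2/\pi<1$. *)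
Lemma green0_ge n : (0 < n)%N -> ln n%:R / pi - 1 <= green n 0.
Proof.
move=> n0; have p2 := pi_ge2 R; have p0 := pi_gt0 R.
rewrite green0_wallis.
have H M : ln M.+1%:R / pi <= \sum_(m < M) wallis R m ^+ 2.
  elim: M => [|M IHM]; first by rewrite ln1 mul0r big_ord0.
  rewrite big_ord_recr /=; apply: le_trans (lerD IHM (wallis_sqr_ge _ _)).
  rewrite invfM [pi^-1 * _]mulrC -mulrDl ler_pM2r ?invr_gt0// -lerBlDl.
  have -> : M.+2%:R = M.+1%:R + 1 :> R by rewrite -[M.+2]addn1 natrD.
  apply: le_trans (ln_succ_sub _) _; rewrite ?ltr0n//.
  have M2 : 0 < M%:R + 2^-1 :> R by rewrite ltr_wpDl.
  rewrite lef_pV2 ?posrE ?ltr0n ?M2//.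
  have -> : M.+1%:R = M%:R + 1 :> R by rewrite -addn1 natrD.
  by rewrite lerD2l invf_le1// ler1n.
apply: le_trans (H _); rewrite lerBlDr.
have -> : ln n%:R = ln (n%:R / 2) + ln 2 :> R.
  by rewrite ln_div ?posrE ?ltr0n// subrK.
rewrite mulrDl lerD//.
  rewrite ler_pM2r ?invr_gt0// ler_ln ?posrE ?ltr0n ?divr_gt0 ?ltr0n//.
  by rewrite ler_pdivrMr// -natrM ler_nat; lia.
rewrite ler_pdivrMr// mul1r.
have : ln 2 < 2 :> R by apply: ln_sublinear.
lra.
Qed.

(** Chapman-Kolmogorov at the origin, using the symmetry of the steps; an inequality because [Z] may
    miss sites. *)
Lemma pk_conv j k (Z : seq Z2) : uniq Z ->
  \sum_(x <- Z) pk j x * pk k x <= pk (j + k) 0.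
Proof.
move=> uZ.
have -> : pk (j + k) 0 = walkE j (fun s => walkE k (fun t => (endpoint s == endpoint t)%:R)).
  rewrite {1}/pk walkE_cat; apply: eq_walkE => s _.
  rewrite -[RHS](walkE_opp k); apply: eq_walkE => t _; congr ((nat_of_bool _)%:R).
  rewrite endpoint_cat addr_eq0; congr (_ == _).
  by rewrite /endpoint big_map sumrN.
have -> : \sum_(x <- Z) pk j x * pk k x =
    walkE j (fun s => walkE k (fun t =>
      \sum_(x <- Z) (endpoint s == x)%:R * (endpoint t == x)%:R)).
  under [RHS]eq_walkE => s _.
    rewrite walkE_sum; under eq_bigr do rewrite walkEZ; over.
  by rewrite walkE_sum; apply: eq_bigr => x _; rewrite walkEZr.
apply: ler_walkE => s _; apply: ler_walkE => t _.
have [|nZ] := boolP (endpoint s \in Z); last first.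
  rewrite big_seq big1// => x xZ; case: eqP => [e|_]; last by rewrite mul0r.
  by move: nZ; rewrite e xZ.
move=> eZ; rewrite (bigD1_seq (endpoint s))//= eqxx mul1r eq_sym big1 ?addr0// => x xn.
by rewrite eq_sym (negbTE xn) mul0r.
Qed.

(** Expanding the square and summing over sites gives $\sum_{j,k\le N}p_{j+k}(0)$. Raising [N] by
    one adds a row and a column of terms of order $1/N$, hence at most 4. *)
Lemma sum_green_sqr N (Z : seq Z2) : uniq Z ->
  \sum_(x <- Z) green N x ^+ 2 <= 4 * N.+1%:R.
Proof.
move=> uZ.
have -> : \sum_(x <- Z) green N x ^+ 2 =
    \sum_(j < N.+1) \sum_(k < N.+1) \sum_(x <- Z) pk j x * pk k x.
  under [RHS]eq_bigr do rewrite exchange_big /=.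
  rewrite exchange_big /=; apply: eq_bigr => x _.
  rewrite expr2 /green mulr_suml; apply: eq_bigr => j _.
  by rewrite mulr_sumr.
apply: (@le_trans _ _ (\sum_(j < N.+1) \sum_(k < N.+1) pk (j + k) 0)).
  by apply: ler_sum => j _; apply: ler_sum => k _; apply: pk_conv.
elim: N => [|N IHN].
  by rewrite !big_ord_recl !big_ord0 !addr0 pk0 eqxx mulr1 ler1n.
rewrite big_ord_recr /=.
under eq_bigr do rewrite big_ord_recr /=.
rewrite big_split /=.
have n0 : 0 < N.+2%:R :> R by rewrite ltr0n.
have B (f : nat -> nat) M : (forall i, N.+1 <= f i)%N ->
    \sum_(i < M) pk (f i) 0 <= M%:R * (2 / N.+2%:R).
  move=> fN; have -> : M%:R * (2 / N.+2%:R) = \sum_(i < M) (2 / N.+2%:R : R).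
    by rewrite sumr_const card_ord mulr_natl.
  apply: ler_sum => i _; apply: le_trans (pk_le_inv _ _ _) _.
  by rewrite ler_pM2l// lef_pV2 ?posrE ?ltr0n// ler_nat ltnS.
have B1 := @B (fun j => j + N.+1)%N N.+1 (fun i => leq_addl _ _).
have B2 := @B (fun j => N.+1 + j)%N N.+2 (fun i => leq_addr _ _).
have -> : 4 * N.+2%:R = 4 * N.+1%:R + 4 :> R by rewrite -[N.+2]addn1 natrD; ring.
rewrite -addrA lerD// (le_trans (lerD B1 B2))//.
rewrite -mulrDl mulrA ler_pdivrMr// -!natrD -!natrM ler_nat; lia.
Qed.

End GreenBounds.

(** * Visits and range *)

Section Visits.
Variable R : realType.
Local Notation green := (@green R).
Local Notation pk := (@pk R).

(** Shape of a last-visit decomposition: [x] is the site visited and the tail is the future of the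
    path, where no further visit may occur. *)
Fixpoint sum_suffixes (psi : Z2 -> seq Z2 -> R) (l : seq Z2) : R :=
  if l is x :: l' then psi x l' + sum_suffixes psi l' else 0.

Lemma sum_suffixes_shift psi c l : sum_suffixes psi (shift c l) =
  sum_suffixes (fun x m => psi (c + x) (shift c m)) l.
Proof. by elim: l => //= x l ->. Qed.

(** At each time [k] the future is a fresh walk moved to the current endpoint; [behead] removes its
    starting point, which is the present site. *)
Lemma walkE_suffixes n psi : walkE n (fun s => sum_suffixes psi (trace s)) =
  \sum_(k < n.+1) walkE k (fun s => walkE (n - k) (fun t =>
     psi (endpoint s) (shift (endpoint s) (behead (trace t))))).
Proof.
elim: n psi => [|n IHn] psi.
  by rewrite big_ord_recl big_ord0 !walkE0 /= endpoint_nil.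
rewrite big_ord_recl walkE0 endpoint_nil subn0.
under [in RHS]eq_walkE do rewrite shift0.
rewrite [in RHS](eq_bigr (fun k : 'I_n.+1 => 4^-1 * \sum_(d <- dirs)
    walkE k (fun s => walkE (n - k) (fun t =>
     psi (d + endpoint s) (shift d (shift (endpoint s) (behead (trace t)))))))); last first.
  move=> k _; rewrite walkES; congr (_ * _); apply: eq_bigr => d _.
  apply: eq_walkE => s _; apply: eq_walkE => t _.
  by rewrite endpoint_cons shift_shift.
rewrite -mulr_sumr exchange_big /= !walkES -mulrDr -big_split /=.
congr (_ * _); apply: eq_bigr => d _.
rewrite walkED; congr (_ + _).
by under eq_walkE do rewrite sum_suffixes_shift; rewrite IHn.
Qed.

Definition escape (n : nat) : R :=
  walkE n (fun s => (0 \notin behead (trace s))%:R).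

Lemma escape_ge0 n : 0 <= escape n.
Proof. by apply: walkE_ge0 => s _; rewrite ler0n. Qed.

Lemma behead_trace_cat s t : {subset behead (trace s) <= behead (trace (s ++ t))}.
Proof.
by move=> x; rewrite trace_cat (trace_head s) /= mem_cat => ->.
Qed.

Lemma escape_le m n : (m <= n)%N -> escape n <= escape m.
Proof.
move=> mn; rewrite -(subnKC mn) /escape walkE_cat; apply: ler_walkE => s _.
rewrite -[leRHS](walkE_cst (n - m)); apply: ler_walkE => t _.
rewrite ler_nat; have [h|h] := boolP (0 \in behead (trace s)).
  by rewrite (behead_trace_cat t h).
exact: leq_b1.
Qed.

(* Decomposition of the walk at its last visit to the origin. *)
Lemma escape_green n : escape n * green n 0 <= 1.
Proof.
pose psi (x : Z2) (l : seq Z2) : R := (x == 0)%:R * (0 \notin l)%:R.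
have psiE l : sum_suffixes psi l = (0 \in l)%:R.
  elim: l => //= x l ->; rewrite /psi inE eq_sym.
  by case: eqP; case: (0 \in l) => /= _; rewrite ?mulr0 ?mul0r ?mul1r ?addr0 ?add0r.
have /esym := walkE_suffixes n psi.
rewrite (eq_walkE (g := fun=> 1)); last by move=> s _; rewrite psiE trace0.
rewrite walkE_cst => <-; rewrite /green mulr_sumr; apply: ler_sum => k _.
rewrite mulrC -walkEZr; apply: ler_walkE => s _; rewrite walkEZ.
case: eqP => [->|_]; last by rewrite !mul0r.
rewrite !mul1r; under [leRHS]eq_walkE do rewrite shift0.
by apply: escape_le; rewrite leq_subr.
Qed.

Lemma escape_le_inv n : escape n <= (green n 0)^-1.
Proof.
have g1 := green0_ge1 R n; have g0 : 0 < green n 0 by apply: lt_le_trans g1.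
by rewrite -[leRHS]div1r ler_pdivlMr// escape_green.
Qed.

Definition range_size (s : seq Z2) : nat := size (undup (trace s)).

Definition last_visit (i : nat) (s : seq Z2) : bool :=
  0 \notin behead (trace (drop i s)).

(** Every visited site is counted once, at its last visit. *)
Lemma range_size_sum s : range_size s = (\sum_(i < (size s).+1) last_visit i s)%N.
Proof.
rewrite /range_size; elim: s => [|d s IHs]; first by rewrite big_ord1.
rewrite big_ord_recl /last_visit drop0 /=.
under eq_bigr => i _. rewrite /=. over.
rewrite -[X in (_ + X)%N]IHs /shift.
case: ifP => h /=; rewrite ?add0n ?add1n ?undup_map_inj ?size_map//; exact: addrI.
Qed.

Lemma range_size_ge k s : (k <= size s)%N ->
  (\sum_(i < k.+1) last_visit i s <= range_size (take k s))%N.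
Proof.
move=> ks; rewrite range_size_sum size_takel//; apply: leq_sum => i _.
rewrite /last_visit; have -> : drop i s = drop i (take k s) ++ drop k s.
  rewrite -[in LHS](cat_take_drop k s) drop_cat size_takel//.
  have := ltn_ord i; rewrite ltnS leq_eqVlt => /orP [/eqP ->|->//].
  by rewrite ltnn subnn drop0 [drop k (take k s)]drop_oversize// size_takel.
have [h|h] := boolP (0 \in behead (trace (drop i (take k s)))).
  by rewrite (behead_trace_cat _ h).
exact: leq_b1.
Qed.

Lemma expn_succ_le b j : (b.+1 ^ j.+1 <= b ^ j.+1 + j.+1 * b.+1 ^ j)%N.
Proof.
elim: j => [|j IHj]; first by rewrite !expn1 expn0; lia.
rewrite expnS; apply: leq_trans (leq_mul (leqnn _) IHj) _.
have : (b ^ j.+1 <= b.+1 ^ j.+1)%N by rewrite leq_exp2r.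
by rewrite mulnDr mulnCA -!expnS [(b.+1 * _)%N]mulSn -expnS; lia.
Qed.

(** Discrete form of $S^{j+1}=(j+1)\int S^j\,dS$: each nonzero term raises the power of the partial
    sum by at most $j+1$ times the next lower power. *)
Lemma expn_sum_bool (X : nat -> bool) j n :
  ((\sum_(i < n) X i) ^ j.+1 <= j.+1 * \sum_(k < n) X k * (\sum_(i < k.+1) X i) ^ j)%N.
Proof.
elim: n => [|n IHn]; first by rewrite !big_ord0 exp0n.
rewrite !big_ord_recr /= mulnDr.
apply: leq_trans (leq_add IHn (leqnn _)).
case: (X n); rewrite ?addn0 ?mul0n ?muln0 ?addn0// mul1n addn1.
exact: expn_succ_le.
Qed.

(** Induction on [j]: [expn_sum_bool] singles out the latest of the last visits, at time [k]. The
    remaining power is bounded by that of [range_size (take k s)], which involves only the first [k]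
    steps, while the independent walk after [k] must escape. The factors [j.+1] multiply to the
    factorial. *)
Lemma range_moment j n :
  walkE n (fun s => (range_size s)%:R ^+ j : R) <=
  j`!%:R * (\sum_(k < n.+1) escape k) ^+ j.
Proof.
elim: j n => [|j IHj] n; first by rewrite fact0 mulr1 (eq_walkE (g := fun=> 1)) ?walkE_cst.
pose S n := \sum_(k < n.+1) escape k.
have S_ge0 m : 0 <= S m by apply: sumr_ge0 => i _; exact: escape_ge0.
have S_le m p : (m <= p)%N -> S m <= S p.
  move=> mp; rewrite /S -(subnKC mp) -addSn big_split_ord /= lerDl.
  by apply: sumr_ge0 => i _; exact: escape_ge0.
apply: (@le_trans _ _ (j.+1%:R * \sum_(k < n.+1)
    walkE n (fun s => (last_visit k s)%:R * (range_size (take k s))%:R ^+ j))).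
  rewrite -walkE_sum -walkEZ; apply: ler_walkE => s /size_words sn.
  under eq_bigr do rewrite -natrX -natrM.
  rewrite -natr_sum -natrX -natrM ler_nat range_size_sum sn.
  apply: leq_trans (expn_sum_bool (fun i => last_visit i s) j n.+1) _.
  rewrite leq_mul2l; apply/orP; right; apply: leq_sum => k _.
  rewrite leq_mul2l; apply/orP; right.
  have : (\sum_(i < k.+1) last_visit i s <= range_size (take k s))%N.
    by apply: range_size_ge; rewrite sn -ltnS.
  by case: (j) => [|j'] h; rewrite ?expn0// leq_exp2r.
rewrite factS natrM -mulrA ler_pM2l ?ltr0n//.
apply: (@le_trans _ _ (\sum_(k < n.+1) (j`!%:R * S n ^+ j) * escape (n - k))); last first.
  rewrite -mulr_sumr exprSr mulrA le_eqVlt; apply/orP; left; apply/eqP.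
  congr (_ * _); rewrite (reindex_inj rev_ord_inj) /=; apply: eq_bigr => k _.
  by rewrite subSS subKn// -ltnS.
apply: ler_sum => k _; have kn : (k <= n)%N by rewrite -ltnS.
rewrite -{1}(subnKC kn) walkE_cat.
rewrite (eq_walkE (g := fun s => (range_size s)%:R ^+ j * escape (n - k))).
  rewrite walkEZr ler_wpM2r ?escape_ge0// (le_trans (IHj _))//.
  rewrite ler_pM2l ?ltr0n ?fact_gt0//.
  by rewrite lerXn2r ?nnegrE ?S_ge0// S_le.
move=> s /size_words sk; rewrite mulrC -walkEZr; apply: eq_walkE => t _.
by rewrite /last_visit drop_size_cat// take_size_cat.
Qed.

Definition hit (n : nat) (x : Z2) : R := walkE n (fun s => (x \in trace s)%:R).

Lemma hit_ge0 n x : 0 <= hit n x.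
Proof. by apply: walkE_ge0 => s _; rewrite ler0n. Qed.

Lemma hit0 n : hit n 0 = 1.
Proof. by rewrite /hit (eq_walkE (g := fun=> 1)) ?walkE_cst// => s _; rewrite trace0. Qed.

Lemma hitS n x : x != 0 -> hit n.+1 x = 4^-1 * \sum_(d <- dirs) hit n (x - d).
Proof.
move=> x0; rewrite /hit walkES; congr (_ * _); apply: eq_bigr => d _.
by apply: eq_walkE => s _; rewrite inE (negbTE x0) shiftP.
Qed.

Lemma hit_leS n x : hit n x <= hit n.+1 x.
Proof.
rewrite /hit -addn1 walkE_cat; apply: ler_walkE => s _.
rewrite -[leLHS](walkE_cst 1); apply: ler_walkE => t _.
rewrite ler_nat trace_cat mem_cat.
by case: (x \in trace s).
Qed.

(** Once at [x], the walk makes [green m 0] visits there on average within the next [m] steps, all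
    counted in [green (n + m) x]. The induction conditions on the first step, which spares a
    decomposition at the hitting time. *)
Lemma hit_green n m x : hit n x * green m 0 <= green (n + m) x.
Proof.
elim: n x => [|n IHn] x.
  rewrite /hit walkE0 /= inE add0n; case: eqP => [->|_]; first by rewrite mul1r.
  by rewrite mul0r green_ge0.
have [->|x0] := eqVneq x 0.
  by rewrite hit0 mul1r green_le// leq_addl.
rewrite hitS// -mulrA mulr_suml addSn greenSl (negbTE x0) add0r.
by rewrite ler_pM2l ?invr_gt0//; apply: ler_sum => d _.
Qed.

Definition hit2 (n : nat) (x y : Z2) : R :=
  walkE n (fun s => ((x \in trace s) && (y \in trace s))%:R).

Lemma hit2_ge0 n x y : 0 <= hit2 n x y.
Proof. by apply: walkE_ge0 => s _; rewrite ler0n. Qed.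

(** The two terms correspond to which of [x] and [y] is visited first; the proof again conditions on
    the first step. *)
Lemma hit2_le n x y :
  hit2 n x y <= hit n x * hit n (y - x) + hit n y * hit n (x - y).
Proof.
have case0 m z : hit2 m 0 z <= hit m 0 * hit m (z - 0) + hit m z * hit m (0 - z).
  rewrite hit0 mul1r subr0 ler_wpDr//; first by apply: mulr_ge0; apply: hit_ge0.
  by rewrite /hit2 le_eqVlt; apply/orP; left; apply/eqP; apply: eq_walkE => s _; rewrite trace0.
have case0' m z : hit2 m z 0 <= hit m z * hit m (0 - z) + hit m 0 * hit m (z - 0).
  rewrite addrC; apply: le_trans (case0 m z).
  rewrite le_eqVlt; apply/orP; left; apply/eqP; apply: eq_walkE => s _.
  by rewrite andbC.
elim: n x y => [|n IHn] x y.
  have [->|x0] := eqVneq x 0; first exact: case0.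
  rewrite {1}/hit2 walkE0 /= !inE (negbTE x0) /=.
  by rewrite addr_ge0// mulr_ge0// hit_ge0.
have [->|x0] := eqVneq x 0; first exact: case0.
have [->|y0] := eqVneq y 0; first exact: case0'.
have -> : hit2 n.+1 x y = 4^-1 * \sum_(d <- dirs) hit2 n (x - d) (y - d).
  rewrite /hit2 walkES; congr (_ * _); apply: eq_bigr => d _.
  by apply: eq_walkE => s _; rewrite !inE (negbTE x0) (negbTE y0) !shiftP.
apply: (@le_trans _ _ (hit n.+1 x * hit n (y - x) + hit n.+1 y * hit n (x - y))).
  rewrite !hitS// -!mulrA -mulrDr ler_pM2l ?invr_gt0//.
  rewrite !mulr_suml -big_split /=; apply: ler_sum => d _.
  apply: le_trans (IHn _ _) _.
  by rewrite !opprB !addrA !subrK.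
by rewrite lerD// ler_wpM2l ?hit_ge0// hit_leS.
Qed.

(** Order $n/\log^2 n$, whereas the range is of order $n/\log n$: squaring the hitting probabilities
    gains the logarithm needed for (b). *)
Lemma sum_hit_sqr n (Z : seq Z2) : uniq Z ->
  \sum_(x <- Z) hit n x ^+ 2 <= 8 * n.+1%:R / green n 0 ^+ 2.
Proof.
move=> uZ; have g0 : 0 < green n 0 by apply: lt_le_trans (green0_ge1 R n).
rewrite ler_pdivlMr ?exprn_gt0// mulr_suml.
apply: (@le_trans _ _ (\sum_(x <- Z) green (n + n) x ^+ 2)).
  apply: ler_sum => x _; rewrite -exprMn lerXn2r ?nnegrE ?green_ge0//.
    by rewrite mulr_ge0 ?hit_ge0 ?green_ge0.
  exact: hit_green.
apply: le_trans (sum_green_sqr _ _ uZ) _.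
by rewrite -!natrM ler_nat; lia.
Qed.

(** After $(a+b)^2\le2a^2+2b^2$ the double sum factorises, the increment $y-x$ running over a
    translate of [Z]. *)
Lemma sum_hit2_sqr n (Z : seq Z2) : uniq Z ->
  \sum_(x <- Z) \sum_(y <- Z) hit2 n x y ^+ 2 <=
  4 * (8 * n.+1%:R / green n 0 ^+ 2) ^+ 2.
Proof.
move=> uZ; set B := 8 * _ / _.
have B0 : 0 <= B by rewrite divr_ge0// ?exprn_ge0 ?green_ge0.
have H : \sum_(x <- Z) \sum_(y <- Z) hit n x ^+ 2 * hit n (y - x) ^+ 2 <= B ^+ 2.
  apply: (@le_trans _ _ (\sum_(x <- Z) hit n x ^+ 2 * B)); last first.
    by rewrite -mulr_suml expr2 ler_wpM2r// sum_hit_sqr.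
  apply: ler_sum => x _; rewrite -mulr_sumr ler_wpM2l ?sqr_ge0//.
  have := @sum_hit_sqr n [seq y - x | y <- Z]; rewrite big_map; apply.
  by rewrite map_inj_uniq//; apply: addIr.
apply: (@le_trans _ _ (2 * (\sum_(x <- Z) \sum_(y <- Z) hit n x ^+ 2 * hit n (y - x) ^+ 2)
   + 2 * (\sum_(y <- Z) \sum_(x <- Z) hit n y ^+ 2 * hit n (x - y) ^+ 2))); last by lra.
rewrite [X in _ + 2 * X]exchange_big /= -mulrDr -big_split mulr_sumr /=.
apply: ler_sum => x _; rewrite -big_split mulr_sumr /=; apply: ler_sum => y _.
set u := hit n x; set v := hit n (y - x); set w := hit n y; set z := hit n (x - y).
have : hit2 n x y ^+ 2 <= (u * v + w * z) ^+ 2.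
  rewrite lerXn2r ?nnegrE ?hit2_ge0 ?hit2_le//.
  by rewrite addr_ge0// mulr_ge0// hit_ge0.
move=> /le_trans; apply; rewrite -!exprMn.
have := sqr_ge0 (u * v - w * z); lra.
Qed.

End Visits.

(** * Logarithmic sums *)

Section LogSums.
Variable R : realType.
Local Notation green := (@green R).
Local Notation L n := (ln (n%:R : R)).

Lemma ln_large (B : R) : exists N : nat, forall n : nat, (N <= n)%N -> B <= L n.
Proof.
exists (Num.bound (expR B)) => n Nn.
have h : expR B <= n%:R.
  apply: le_trans (ltW (archi_boundP (expR_ge0 B))) _.
  by rewrite ler_nat.
by rewrite -[leLHS]expRK ler_ln ?posrE ?expR_gt0// (lt_le_trans (expR_gt0 B)).
Qed.

Lemma ln2_ge : 2^-1 <= ln 2 :> R.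
Proof.
have := @ln_succ_sub_ge R 1 ltr01; rewrite ln1 subr0.
by have -> : 1 + 1 = 2 :> R by ring.
Qed.

Lemma ln_nat_ge n : (2 <= n)%N -> 2^-1 <= L n.
Proof.
by move=> n2; apply: le_trans ln2_ge _; rewrite ler_ln ?posrE ?ltr0n ?ler_nat//; lia.
Qed.

Lemma ln_nat_gt0 n : (2 <= n)%N -> 0 < L n.
Proof. by move=> /ln_nat_ge; apply: lt_le_trans; rewrite invr_gt0. Qed.

Lemma ln_sqr_le n : (2 <= n)%N -> L n ^+ 2 <= 4 * n%:R.
Proof.
move=> n2; have n0 : 0 < n%:R :> R by rewrite ltr0n; lia.
set s := Num.sqrt (n%:R : R).
have s0 : 0 < s by rewrite sqrtr_gt0.
have sE : n%:R = s ^+ 2 by rewrite sqr_sqrtr// ltW.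
have l0 := ln_nat_gt0 n2.
rewrite [X in _ <= _ * X]sE.
have : L n <= 2 * s.
  by rewrite sE lnXn// -[_ *+ 2]mulr_natl ler_pM2l// ltW// ln_sublinear.
nra.
Qed.

Lemma nat_div_ln2_ge n : (2 <= n)%N -> 1 <= 4 * (n%:R / L n ^+ 2).
Proof.
move=> n2; rewrite mulrA ler_pdivlMr ?mul1r ?ln_sqr_le//.
by rewrite exprn_gt0// ln_nat_gt0.
Qed.

Let S1 n : R := \sum_(2 <= k < n.+1) (L k)^-1.
Let S2 n : R := \sum_(2 <= k < n.+1) (L k ^+ 2)^-1.

Let S2_ge0 n : 0 <= S2 n.
Proof. by apply: sumr_ge0 => k _; rewrite invr_ge0 sqr_ge0. Qed.

Let S2S n : (1 <= n)%N -> S2 n.+1 = S2 n + (L n.+1 ^+ 2)^-1.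
Proof. by move=> n1; rewrite /S2 big_nat_recr. Qed.

Let S1S n : (1 <= n)%N -> S1 n.+1 = S1 n + (L n.+1)^-1.
Proof. by move=> n1; rewrite /S1 big_nat_recr. Qed.

Let S2_le m n : (1 <= m)%N -> (m <= n)%N -> S2 m <= S2 n.
Proof.
move=> m1; elim: n => [|n IHn] mn; first by move: mn; rewrite leqn0 => /eqP ->.
move: mn; rewrite leq_eqVlt => /orP [/eqP ->//|mn].
by rewrite S2S ?ler_wpDr ?invr_ge0 ?sqr_ge0 ?IHn//; lia.
Qed.

(** Once $\log n\ge8$, the increments of $2n/\log^2 n$ dominate $1/\log^2(n+1)$. The initial terms
    go into the constant, because $n/\log^2 n$ is bounded below. *)
Lemma sum_inv_ln2 : exists C : R, 0 <= C /\
  forall n, (2 <= n)%N -> \sum_(2 <= k < n.+1) (L k ^+ 2)^-1 <= C * (n%:R / L n ^+ 2).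
Proof.
have [N HN] := ln_large 8.
pose M := maxn N 2.
exists (4 * S2 M + 2); split; first by rewrite addr_ge0// mulr_ge0.
move=> n n2; rewrite -/(S2 n).
suff H : S2 n <= S2 M + 2 * (n%:R / L n ^+ 2).
  rewrite mulrDl; apply: le_trans H _; rewrite lerD2r.
  by rewrite -mulrA mulrCA ler_peMr// nat_div_ln2_ge.
have [nM|Mn] := leqP n M.
  apply: le_trans (S2_le _ nM) _; first lia.
  by rewrite lerDl mulr_ge0// divr_ge0// sqr_ge0.
have {n2} := ltnW Mn; elim: n Mn => [//|n IHn] _.
rewrite leq_eqVlt => /orP [/eqP <-|]; first by rewrite lerDl mulr_ge0// divr_ge0// sqr_ge0.
rewrite ltnS => Mn.
have {}IHn : S2 n <= S2 M + 2 * (n%:R / L n ^+ 2).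
  case: (ltngtP M n) Mn => // [Mn' _|<- _]; first exact: IHn (ltnW Mn').
  by rewrite lerDl mulr_ge0// divr_ge0// sqr_ge0.
have n2 : (2 <= n)%N by apply: leq_trans Mn; rewrite leq_maxr.
have n0 : 0 < n%:R :> R by rewrite ltr0n; lia.
have L8 : 8 <= L n by apply: HN; apply: leq_trans Mn; rewrite leq_maxl.
rewrite S2S; last lia.
apply: le_trans (lerD IHn (lexx _)) _.
rewrite -addrA lerD2l.
have nS : n.+1%:R = n%:R + 1 :> R by rewrite -addn1 natrD.
have d1 := ln_succ_sub n0; rewrite -nS in d1.
have d0 : L n <= L n.+1 by rewrite ler_ln ?posrE ?ltr0n// ?ler_nat//; lia.
move: d1 d0 L8; set l := L n; set l' := L n.+1 => d1 d0 L8; rewrite nS.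
have l0 : 0 < l by lra.
have l'0 : 0 < l' by lra.
set n' := n%:R in n0 d1 *.
have h1 : n' * (l' - l) <= 1 by rewrite mulrC -ler_pdivlMr// mul1r.
have n1 : 1 <= n' by rewrite ler1n; lia.
have h2 : l' - l <= 1 by apply: le_trans d1 _; rewrite invf_le1.
have h3 : n' * (l' - l) * (l' + l) <= 1 * (l' + l) by rewrite ler_wpM2r// addr_ge0// ltW.
have h4 : 8 * l <= l * l by rewrite ler_pM2r.
have key : 0 <= ((2 * n' + 1) * l ^+ 2 - 2 * n' * l' ^+ 2) / (l ^+ 2 * l' ^+ 2).
  by apply: divr_ge0; [lra|rewrite mulr_ge0// sqr_ge0].
rewrite -subr_ge0; apply: le_trans key _; rewrite le_eqVlt; apply/orP; left.
by apply/eqP; field; rewrite !gt_eqF.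
Qed.

(** The error changes at each step by $n/\log n-n/\log(n+1)$, which lies between 0 and
    $2/\log^2(n+1)$; these changes are summed by [sum_inv_ln2]. *)
Lemma sum_inv_ln : exists C : R, 0 <= C /\
  forall n, (2 <= n)%N ->
    `|\sum_(2 <= k < n.+1) (L k)^-1 - n%:R / L n| <= C * (n%:R / L n ^+ 2).
Proof.
have [C [C0 HC]] := sum_inv_ln2.
exists (2 * C + 4 * (L 2)^-1); split.
  by rewrite addr_ge0 ?mulr_ge0// invr_ge0 ltW// ln_nat_gt0.
move=> n n2; rewrite -/(S1 n).
suff H : `|S1 n - n%:R / L n| <= (L 2)^-1 + 2 * S2 n.
  apply: le_trans H _; rewrite [X in _ <= X]mulrDl [X in _ <= X]addrC; apply: lerD; last by rewrite -mulrA ler_pM2l// HC.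
  rewrite -mulrA mulrCA ler_peMr ?nat_div_ln2_ge//.
  by rewrite invr_ge0 ltW// ln_nat_gt0.
elim: n n2 => [//|n IHn]; rewrite ltnS leq_eqVlt => /orP [/eqP <-|n2].
  rewrite /S1 big_nat1; have l0 := ln_nat_gt0 (leqnn 2).
  have -> : (L 2)^-1 - 2 / L 2 = - (L 2)^-1 by field; rewrite gt_eqF.
  rewrite normrN ger0_norm; last by rewrite invr_ge0 ltW.
  by rewrite lerDl mulr_ge0.
rewrite S1S ?S2S; [|lia|lia].
have {IHn} := IHn n2.
have n0 : 0 < n%:R :> R by rewrite ltr0n; lia.
have nS : n.+1%:R = n%:R + 1 :> R by rewrite -addn1 natrD.
have d1 := ln_succ_sub n0; rewrite -nS in d1.
have d0 : L n <= L n.+1 by rewrite ler_ln ?posrE ?ltr0n// ?ler_nat//; lia.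
have l5 := ln_nat_ge n2.
move: d1 d0 l5; set l := L n; set l' := L n.+1; rewrite nS; set n' := n%:R in n0 * => d1 d0 l5 IH.
have l0 : 0 < l by lra.
have l'0 : 0 < l' by lra.
have n1 : 1 <= n' by rewrite ler1n; lia.
have n2' : 2 <= n' by rewrite (ler_nat R 2).
have h1 : n' * (l' - l) <= 1 by rewrite mulrC -ler_pdivlMr// mul1r.
have h2 : l' <= 2 * l.
  have : n'^-1 <= 2^-1 by rewrite lef_pV2 ?posrE.
  lra.
have key : 0 <= n' / l - n' / l' <= 2 * (l' ^+ 2)^-1.
  have -> : n' / l - n' / l' = n' * (l' - l) / (l * l') by field; rewrite !gt_eqF.
  rewrite divr_ge0 ?mulr_ge0 ?subr_ge0 ?(ltW n0) ?(ltW l0) ?(ltW l'0)//=.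
  rewrite ler_pdivrMr ?mulr_gt0//; apply: le_trans h1 _.
  have -> : 2 / l' ^+ 2 * (l * l') = (2 * l) / l' by field; rewrite !gt_eqF.
  by rewrite ler_pdivlMr// mul1r.
have -> : S1 n + l'^-1 - (n' + 1) / l' = (S1 n - n' / l) + (n' / l - n' / l') by field; rewrite !gt_eqF.
have /andP [k0 k1] := key.
apply: le_trans (ler_normD _ _) _; rewrite (ger0_norm k0).
lra.
Qed.

Lemma cesaro_ln (d : nat -> R) (a c : R) : 0 <= c ->
  (forall k, (2 <= k)%N -> `|d k - a / L k| <= c / L k ^+ 2) ->
  exists C : R, 0 <= C /\ forall n, (2 <= n)%N ->
    `|\sum_(2 <= k < n.+1) d k - a * (n%:R / L n)| <= C * (n%:R / L n ^+ 2).
Proof.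
move=> c0 dk; have [C1 [C10 H1]] := sum_inv_ln; have [C2 [C20 H2]] := sum_inv_ln2.
exists (c * C2 + `|a| * C1); split; first by rewrite addr_ge0 ?mulr_ge0.
move=> n n2.
have -> : \sum_(2 <= k < n.+1) d k - a * (n%:R / L n) =
    \sum_(2 <= k < n.+1) (d k - a / L k) + a * (\sum_(2 <= k < n.+1) (L k)^-1 - n%:R / L n).
  by rewrite sumrB -mulr_sumr; ring.
rewrite mulrDl; apply: le_trans (ler_normD _ _) _; apply: lerD; last first.
  by rewrite normrM -mulrA ler_wpM2l// H1.
apply: le_trans (ler_norm_sum _ _ _) _.
rewrite -mulrA; apply: le_trans (ler_wpM2l c0 (H2 n n2)).
rewrite mulr_sumr big_nat_cond [leRHS]big_nat_cond; apply: ler_sum => k.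
by rewrite andbT => /andP [k2 _]; exact: dk.
Qed.

Lemma green0_ln n : (2 <= n)%N -> L n / (2 * pi) <= green n 0.
Proof.
move=> n2; have g1 := green0_ge1 R n; have n1 : (0 < n)%N by lia.
have g2 := green0_ge R n1; have p0 := pi_gt0 R.
rewrite invfM mulrCA mulrA.
have -> : 2^-1 * L n / pi = 2^-1 * (L n / pi) by rewrite mulrA.
lra.
Qed.

Lemma green0_inv_le n : (2 <= n)%N -> (green n 0)^-1 <= 2 * pi / L n.
Proof.
move=> n2; have l0 := ln_nat_gt0 n2; have p0 := pi_gt0 R.
rewrite -[2 * pi / _]invrK invfM invrK mulrC lef_pV2 ?green0_ln// posrE.
  exact: lt_le_trans (green0_ge1 R n).
by rewrite divr_gt0// mulr_gt0.
Qed.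

Lemma green0_inv_asymp n : (2 <= n)%N ->
  `|(green n 0)^-1 - pi / L n| <= 4 * pi ^+ 2 / L n ^+ 2.
Proof.
move=> n2; have l0 := ln_nat_gt0 n2; have p0 := pi_gt0 R.
have n1 : (0 < n)%N by lia.
have g0 : 0 < green n 0 by exact: lt_le_trans (green0_ge1 R n).
have gi := green0_inv_le n2; have gl := green0_le R n1; have gg := green0_ge R n1.
have E (P x g : R) : 0 < P -> 0 < x -> 0 < g ->
    g^-1 - P / x = (x / P - g) * (g^-1 * (P / x)).
  by move=> *; field; rewrite !gt_eqF.
rewrite E//.
rewrite normrM [X in _ * X]ger0_norm; last first.
  by rewrite mulr_ge0 ?invr_ge0 ?divr_ge0 ?ltW.
have -> : 4 * pi ^+ 2 / L n ^+ 2 = 2 * (2 * pi / L n * (pi / L n)).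
  by field; rewrite gt_eqF.
apply: ler_pM => //.
- by rewrite mulr_ge0 ?invr_ge0 ?divr_ge0 ?ltW.
- by rewrite ler_norml; lra.
- by rewrite ler_pM2r// divr_gt0.
Qed.

Lemma sum_escape : exists C : R, 0 <= C /\ forall n, (2 <= n)%N ->
  \sum_(k < n.+1) escape R k <= C * (n%:R / L n).
Proof.
have [C [C0 H]] := sum_inv_ln; have p0 := pi_gt0 R.
exists (2 * pi * (1 + 2 * C) + 16); split.
  apply: addr_ge0 => //; apply: mulr_ge0; first by rewrite mulr_ge0// ltW.
  by apply: addr_ge0 => //; apply: mulr_ge0.
move=> n n2; have l0 := ln_nat_gt0 n2; have l2 := ln_nat_ge n2.
have n0 : 0 < n%:R :> R by rewrite ltr0n; lia.
rewrite -(big_mkord xpredT (escape R)) (big_cat_nat (n := 2))//=; last lia.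
rewrite mulrDl addrC; apply: lerD.
  apply: (@le_trans _ _ (\sum_(2 <= k < n.+1) 2 * pi / L k)).
    rewrite big_nat_cond [leRHS]big_nat_cond; apply: ler_sum => k.
    rewrite andbT => /andP [k2 _]; apply: le_trans (escape_le_inv _ _) _.
    exact: green0_inv_le.
  have -> : \sum_(2 <= k < n.+1) 2 * pi / L k = 2 * pi * \sum_(2 <= k < n.+1) (L k)^-1.
    by rewrite mulr_sumr.
  rewrite -[X in _ <= X]mulrA ler_pM2l ?mulr_gt0//.
  have := ler_normlW (H n n2); rewrite lerBlDr => /le_trans; apply.
  rewrite mulrDl mul1r addrC lerD2l -[2 * C]mulrC -mulrA ler_wpM2l//.
  have -> : 2 * (n%:R / L n) = (n%:R / L n ^+ 2) * (2 * L n) by field; rewrite gt_eqF.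
  by rewrite ler_peMr ?divr_ge0 ?sqr_ge0//; lra.
rewrite big_mkord !big_ord_recl big_ord0 addr0 /=.
have e0 : escape R 0 <= 1 by have := escape_le_inv R 0; rewrite green0 eqxx invr1.
have e1 : escape R 1 <= 1 by apply: le_trans e0; apply: escape_le.
have := nat_div_ln2_ge n2.
have -> : n%:R / L n ^+ 2 = (n%:R / L n) / L n by field; rewrite gt_eqF.
move=> h; have : n%:R / L n / L n <= 2 * (n%:R / L n).
  rewrite [leRHS]mulrC ler_wpM2l ?divr_ge0 ?(ltW l0)//.
  by rewrite -[2]invrK lef_pV2 ?posrE// invr_gt0.
lra.
Qed.

(* Two halves of equal length have total variance (1/2) psi(n); the factor 5/4 keeps
   the recursion contracting, so the constant K survives the induction. *)
Lemma halving_recursion (V : nat -> R) (C : R) : 0 <= C -> (forall n, 0 <= V n) ->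
  (forall n, (4 <= n)%N ->
     V n <= 5 / 4 * (V n./2 + V (n - n./2)%N) + C * (n%:R ^+ 2 / L n ^+ 4)) ->
  exists K : R, 0 <= K /\
    forall n, (2 <= n)%N -> V n <= K * (n%:R ^+ 2 / L n ^+ 4).
Proof.
move=> C0 V0 HV.
(* With $\log(n/2)\ge100$, replacing the logarithms of the halves by $\log n$ costs at most
   $(51/50)^4\le11/10$. The recursion then has ratio
   $\frac54\cdot\frac{11}{10}\cdot\frac{101}{200}<\frac7{10}$, where $101/100$ pays for odd [n], and
   [10 * C <= K] covers the source term. *)
have [N HN] := ln_large 100.
pose M := (2 * (maxn N 100))%N.
have psi_gt0 n : (2 <= n)%N -> 0 < n%:R ^+ 2 / L n ^+ 4.
  move=> n2; rewrite divr_gt0 ?exprn_gt0 ?ln_nat_gt0// ltr0n; lia.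
(* Covers all [n] below the threshold [M]. At indices 0 and 1 the denominator is 0, and so is the
   quotient. *)
pose K0 := \sum_(i < M) V i / (i%:R ^+ 2 / L i ^+ 4).
have K0_ge0 : 0 <= K0.
  by apply: sumr_ge0 => i _; rewrite divr_ge0 ?divr_ge0 ?exprn_even_ge0 ?sqr_ge0.
exists (10 * C + K0); split; first by rewrite addr_ge0 ?mulr_ge0.
set K := 10 * C + K0.
have KC : 10 * C <= K by rewrite lerDl.
have K_ge0 : 0 <= K by rewrite addr_ge0 ?mulr_ge0.
elim/ltn_ind => n IHn n2.
have [nM|Mn] := ltnP n M.
  rewrite -ler_pdivrMr ?psi_gt0// /K /K0 (bigD1 (Ordinal nM)) //=.
  rewrite addrCA lerDl addr_ge0 ?mulr_ge0// sumr_ge0// => i _.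
  by rewrite divr_ge0 ?divr_ge0 ?exprn_even_ge0 ?sqr_ge0.
have mx : (maxn N 100 <= n./2)%N by rewrite /M in Mn; lia.
have mN : (N <= n./2)%N by apply: leq_trans mx; rewrite leq_maxl.
have m100 : (100 <= n./2)%N by apply: leq_trans mx; rewrite leq_maxr.
have {mx Mn} nm : (n./2 <= n - n./2)%N by lia.
have n3 : (n <= n./2 * 3)%N by lia.
have n4 : (100 <= n)%N by lia.
have m2 : (2 <= n./2)%N by lia.
have mlt : (n./2 < n)%N by lia.
have mlt' : (n - n./2 < n)%N by lia.
have m2' : (2 <= n - n./2)%N by lia.
have m0 : (0 < n./2)%N by lia.
have m0' : (0 < n - n./2)%N by lia.
have n0 : (0 < n)%N by lia.
have sqN : (2 * (n./2 ^ 2 + (n - n./2) ^ 2) <= n ^ 2 + 1)%N.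
  by have := odd_double_half n; case: (odd n) => /= e; rewrite !expnS !expn0; nia.
apply: le_trans (HV n (leq_trans _ n4)) _; first by [].
have hm := IHn _ mlt m2; have hm' := IHn _ mlt' m2'.
have lm : 100 <= L n./2 by apply: HN.
have lmn : L n <= L n./2 + 2.
  have e : L 3 <= 2.
    rewrite (_ : 3%:R = 1 + 2 :> R); last by ring.
    by apply: le_ln1Dx; rewrite (lt_trans (ltrN10 _)).
  apply: (@le_trans _ _ (L n./2 + L 3)); last by rewrite lerD2l.
  rewrite -lnM ?posrE ?ltr0n//.
  by rewrite -natrM ler_ln ?posrE ?ltr0n ?ler_nat ?muln_gt0 ?m0.
have lm' : L n./2 <= L (n - n./2)%N by rewrite ler_ln ?posrE ?ltr0n ?ler_nat.
set l := L n in lmn *; set a := L n./2 in lm lmn lm' hm; set b := L (n - n./2)%N in lm' hm'.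
have n100 : 100 <= n%:R :> R by rewrite (ler_nat R 100).
have sq : (n./2)%:R ^+ 2 + (n - n./2)%N%:R ^+ 2 <= (n%:R ^+ 2 + 1) / 2 :> R.
  move: sqN; rewrite -(ler_nat R) natrM !natrD !natrX ler_pdivlMr//; lra.
have l0 : 0 < l by apply: ln_nat_gt0.
have a0 : 0 < a by lra.
have b0 : 0 < b by lra.
have al : (a ^+ 4)^-1 <= 11 / 10 / l ^+ 4.
  rewrite ler_pdivlMr ?exprn_gt0// mulrC ler_pdivrMr ?exprn_gt0//.
  have h : l <= 51 / 50 * a by lra.
  apply: (@le_trans _ _ ((51 / 50 * a) ^+ 4)); first by rewrite lerXn2r ?nnegrE ?(ltW l0)// mulr_ge0// ltW.
  by rewrite exprMn ler_wpM2r ?exprn_ge0 ?ltW//; lra.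
have bl : (b ^+ 4)^-1 <= 11 / 10 / l ^+ 4.
  apply: le_trans al; rewrite lef_pV2 ?posrE ?exprn_gt0//.
  by rewrite lerXn2r ?nnegrE ?(ltW a0) ?(ltW b0).
set x := (n./2)%:R ^+ 2 in hm sq; set y := (n - n./2)%:R ^+ 2 in hm' sq.
have x0 : 0 <= x by rewrite sqr_ge0.
have y0 : 0 <= y by rewrite sqr_ge0.
have hm1 : V n./2 <= K * (x * (11 / 10 / l ^+ 4)).
  by apply: le_trans hm _; rewrite ler_wpM2l// ler_wpM2l.
have hm2 : V (n - n./2)%N <= K * (y * (11 / 10 / l ^+ 4)).
  by apply: le_trans hm' _; rewrite ler_wpM2l// ler_wpM2l.
have i0 : 0 <= (l ^+ 4)^-1 by rewrite invr_ge0 exprn_ge0// ltW.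
have h1 : V n./2 + V (n - n./2)%N <= K * (11 / 10) * (l ^+ 4)^-1 * ((n%:R ^+ 2 + 1) / 2).
  apply: le_trans (lerD hm1 hm2) _.
  have -> : K * (x * (11 / 10 / l ^+ 4)) + K * (y * (11 / 10 / l ^+ 4)) =
    K * (11 / 10) * (l ^+ 4)^-1 * (x + y) by ring.
  by rewrite ler_wpM2l// mulr_ge0// mulr_ge0.
have n1 : n%:R ^+ 2 + 1 <= 101 / 100 * n%:R ^+ 2 :> R by nra.
have Ki0 : 0 <= K * (l ^+ 4)^-1 by rewrite mulr_ge0.
have h2 := ler_wpM2l Ki0 n1.
have h3 : 10 * C * (n%:R ^+ 2 * (l ^+ 4)^-1) <= K * (n%:R ^+ 2 * (l ^+ 4)^-1).
  by rewrite ler_wpM2r// mulr_ge0// sqr_ge0.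
have h4 : 0 <= K * (n%:R ^+ 2 * (l ^+ 4)^-1) by rewrite mulr_ge0// mulr_ge0// sqr_ge0.
move: h1 h2 h3 h4; set p := n%:R ^+ 2; set q := (l ^+ 4)^-1; lra.
Qed.

End LogSums.

(** * Mean and variance of capacity-like functionals *)

Section EndpointLaw.
Variable R : realType.

Lemma walkE_endpoint_ge k (phi : Z2 -> R) (Z : seq Z2) : uniq Z ->
  (forall z, 0 <= phi z) ->
  \sum_(z <- Z) pk R k z * phi z <= walkE k (fun s => phi (endpoint s)).
Proof.
move=> uZ phi0; rewrite /pk.
under eq_bigr do rewrite -walkEZr.
rewrite -walkE_sum; apply: ler_walkE => s _.
have [eZ|neZ] := boolP (endpoint s \in Z).
  rewrite (bigD1_seq (endpoint s))//= eqxx mul1r big1 ?addr0// => z zs.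
  by rewrite eq_sym (negbTE zs) mul0r.
rewrite big_seq big1 ?phi0// => z zZ; case: eqP => [e|_]; last by rewrite mul0r.
by move: neZ; rewrite e zZ.
Qed.

Lemma walkE_endpoint k (phi : Z2 -> R) (Z : seq Z2) : uniq Z ->
  (forall s, s \in words k -> endpoint s \in Z) ->
  walkE k (fun s => phi (endpoint s)) = \sum_(z <- Z) pk R k z * phi z.
Proof.
move=> uZ eZ; rewrite /pk; under [RHS]eq_bigr do rewrite -walkEZr.
rewrite -walkE_sum; apply: eq_walkE => s /eZ sZ.
rewrite (bigD1_seq (endpoint s))//= eqxx mul1r big1 ?addr0// => z zs.
by rewrite eq_sym (negbTE zs) mul0r.
Qed.

End EndpointLaw.

Section CapacityMean.
Variable R : realType.
Local Notation green := (@green R).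
Local Notation sqn := (@sqn R).
Local Notation L n := (ln (n%:R : R)).
(* F A stands for the mean size of the union of the clusters meeting A, and D z B
   for the probability that the cluster of 0 contains z and avoids B. *)
Variables (F : seq Z2 -> R) (D : Z2 -> seq Z2 -> R) (tau : Z2 -> R) (K : R).
Hypothesis F_shift : forall x A, F (shift x A) = F A.
Hypothesis D_ge0 : forall z B, 0 <= D z B.
Hypothesis D_le : forall z B, D z B <= tau z * (0 \notin B)%:R.
Hypothesis D_anti : forall z (B B' : seq Z2), {subset B <= B'} -> D z B' <= D z B.
Hypothesis tau_sum : forall Z, uniq Z -> \sum_(z <- Z) (4 + 2 * sqn z) * tau z <= K.
Hypothesis FD_ge : forall Z B, uniq Z -> \sum_(z <- Z) D z B <= F (0 :: B) - F B.
Hypothesis FD_le : forall e : R, 0 < e -> exists2 Z, uniq Z &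
  forall B, F (0 :: B) - F B <= \sum_(z <- Z) D z B + e.
Hypothesis D_last_exit : forall l : seq Z2, 0 \in l ->
  sum_suffixes (fun x m => D (- x) (shift (- x) m)) l = 1.

Let Dn n z : R := walkE n (fun s => D z (behead (trace s))).

(** The increment $d_n$: mean gain in [F] when the starting point joins the sites visited at times 1
    to [n]. *)
Definition capacity (n : nat) : R :=
  walkE n (fun s => F (trace s) - F (behead (trace s))).

Let tau_ge0 z : 0 <= tau z.
Proof. by have := le_trans (D_ge0 z [::]) (D_le z [::]); rewrite mulr1. Qed.

Let Dn_ge0 n z : 0 <= Dn n z.
Proof. by apply: walkE_ge0. Qed.

Let K_ge0 : 0 <= K.
Proof. by have := @tau_sum [::] isT; rewrite big_nil. Qed.

Let Dn_le n z : Dn n z <= tau z * escape R n.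
Proof. by rewrite /escape -walkEZ; apply: ler_walkE. Qed.

Let Dn_anti m n z : (m <= n)%N -> Dn n z <= Dn m z.
Proof.
move=> mn; rewrite -(subnKC mn) /Dn walkE_cat; apply: ler_walkE => s _.
rewrite -[leRHS](walkE_cst (n - m)); apply: ler_walkE => t _.
by apply: D_anti; exact: behead_trace_cat.
Qed.

Let Dn_sum n Z : uniq Z -> \sum_(z <- Z) Dn n z <= capacity n.
Proof.
move=> uZ; rewrite -walkE_sum; apply: ler_walkE => s _.
by rewrite [in leRHS]trace_head FD_ge.
Qed.

(* Average over the walk of the decomposition at the last visit to the cluster of
   the origin, which the walk started at 0 visits at time 0. *)
Let renewal n :
  \sum_(k < n.+1) walkE k (fun s => Dn (n - k) (- endpoint s)) = 1.
Proof.
pose psi x m := D (- x) (shift (- x) m).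
rewrite -(walkE_cst n 1) -[RHS](eq_walkE (f := fun s => sum_suffixes psi (trace s))).
  rewrite walkE_suffixes; apply: eq_bigr => k _; apply: eq_walkE => s _.
  by apply: eq_walkE => t _; rewrite /psi shift_shift addNr shift0.
by move=> s _; rewrite D_last_exit ?trace0.
Qed.

(** In the product of [green n 0] with the sum of [Dn n z], replacing [green n 0] by [green n z]
    costs [4 + 2 * sqn z]. The main part is at most the renewal sum, since a shorter future only
    raises [Dn]; the cost is at most [K * escape R n]. *)
Let capacity_upper n : capacity n <= (green n 0)^-1 + K / green n 0 ^+ 2.
Proof.
have g1 := green0_ge1 R n; have g0 : 0 < green n 0 by apply: lt_le_trans g1.
apply/ler_addgt0Pr => e e0; have [Z uZ HZ] := FD_le e0.
have h1 : capacity n <= \sum_(z <- Z) Dn n z + e.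
  rewrite -[e in leRHS](walkE_cst n) -walkE_sum -walkED; apply: ler_walkE => s _.
  by rewrite [in leLHS]trace_head HZ.
apply: le_trans h1 _; rewrite lerD2r.
have h2 : \sum_(z <- Z) green n z * Dn n z <= 1.
  rewrite -(renewal n) /green.
  under eq_bigr do rewrite mulr_suml.
  rewrite exchange_big /=; apply: ler_sum => k _.
  apply: (@le_trans _ _ (\sum_(z <- Z) pk R k z * Dn (n - k) z)).
    by apply: ler_sum => z _; rewrite ler_wpM2l ?pk_ge0// Dn_anti// leq_subr.
  under eq_bigr do rewrite -pkN -[X in Dn _ X]opprK.
  have := @walkE_endpoint_ge R k (fun z => Dn (n - k) (- z)) (map -%R Z).
  rewrite big_map; apply => //; rewrite map_inj_uniq//; exact: oppr_inj.
have h3 : green n 0 * \sum_(z <- Z) Dn n z <= 1 + K * (green n 0)^-1.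
  apply: (@le_trans _ _ (\sum_(z <- Z) green n z * Dn n z +
     \sum_(z <- Z) (4 + 2 * sqn z) * Dn n z)).
    rewrite mulr_sumr -big_split /=; apply: ler_sum => z _.
    by rewrite -mulrDl ler_wpM2r// -lerBlDl green_sub.
  apply: lerD => //; apply: le_trans (_ : K * escape R n <= _); last first.
    by rewrite ler_wpM2l// escape_le_inv.
  apply: (@le_trans _ _ (\sum_(z <- Z) (4 + 2 * sqn z) * (tau z * escape R n))).
    by apply: ler_sum => z _; rewrite ler_wpM2l// addr_ge0// mulr_ge0// sqn_ge0.
  under eq_bigr do rewrite mulrA.
  by rewrite -mulr_suml ler_wpM2r ?escape_ge0// tau_sum.
rewrite -(ler_pM2l g0); apply: le_trans h3 _; rewrite le_eqVlt; apply/orP; left.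
by apply/eqP; field; rewrite gt_eqF.
Qed.

(** The renewal identity over $2m$ steps is cut at time [m]. Up to [m] at least [m] steps remain, so
    the future is bounded by [Dn m z] and the transition probabilities add up to [green m z], at
    most [green m 0]. After [m] each transition probability is at most [2 / m.+1], and the future
    contributes [tau] times an escape probability. *)
Let capacity_lower m : 1 - 2 * K / m.+1%:R * \sum_(k < m.+1) escape R k <=
  green m 0 * capacity m.
Proof.
rewrite lerBlDr -{1}(renewal (m + m)).
rewrite -addSn big_split_ord /=; apply: lerD.
  pose Z := undup (flatten [seq [seq - endpoint s | s <- words k] | k <- iota 0 m.+1]).
  apply: (@le_trans _ _ (green m 0 * \sum_(z <- Z) Dn m z)); last first.
    by rewrite ler_wpM2l ?green_ge0// Dn_sum// undup_uniq.
  apply: (@le_trans _ _ (\sum_(z <- Z) green m z * Dn m z)); last first.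
    by rewrite mulr_sumr; apply: ler_sum => z _; rewrite ler_wpM2r// green_le0.
  rewrite /green; under [leRHS]eq_bigr do rewrite mulr_suml.
  rewrite exchange_big /=; apply: ler_sum => k _.
  apply: (@le_trans _ _ (walkE k (fun s => Dn m (- endpoint s)))).
    apply: ler_walkE => s _; apply: Dn_anti.
    by rewrite -addnBA ?leq_addr// -ltnS.
  rewrite (@walkE_endpoint R k (fun z => Dn m (- z)) (map -%R Z)).
  - rewrite big_map; apply: ler_sum => z _.
    by rewrite pkN opprK.
  - by rewrite map_inj_uniq ?undup_uniq//; exact: oppr_inj.
  - move=> s sk; rewrite -[endpoint s]opprK map_f// mem_undup; apply/allpairsPdep.
    by exists (val k), s; split; rewrite // mem_iota add0n ltn_ord.
apply: (@le_trans _ _ (\sum_(i < m) 2 * K / m.+1%:R * escape R (m - i.+1))); last first.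
  rewrite -mulr_sumr ler_wpM2l ?divr_ge0 ?mulr_ge0//.
  rewrite [leRHS]big_ord_recr /= ler_wpDr ?escape_ge0//.
  by rewrite [leRHS](reindex_inj rev_ord_inj).
apply: ler_sum => i _; rewrite addSn.
have -> : (m + m - (m + i).+1 = m - i.+1)%N by lia.
apply: (@le_trans _ _ (walkE (m + i).+1 (fun s => tau (- endpoint s) * escape R (m - i.+1)))).
  by apply: ler_walkE => s _; exact: Dn_le.
rewrite walkEZr ler_wpM2r ?escape_ge0//.
pose Z := undup [seq - endpoint s | s <- words (m + i).+1].
rewrite (@walkE_endpoint R _ (fun z => tau (- z)) (map -%R Z)); last 2 first.
- by rewrite map_inj_uniq ?undup_uniq//; exact: oppr_inj.
- by move=> s sk; rewrite -[endpoint s]opprK map_f// mem_undup (map_f (fun s => - endpoint s)).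
rewrite big_map; apply: (@le_trans _ _ (\sum_(z <- Z) (2 / m.+1%:R) * ((4 + 2 * sqn z) * tau z))).
  apply: ler_sum => z _; rewrite pkN opprK; apply: ler_pM => //; rewrite ?pk_ge0//.
    apply: le_trans (pk_le_inv _ _ _) _.
    by rewrite ler_pM2l// lef_pV2 ?posrE ?ltr0n// ler_nat ltnS; lia.
  by rewrite ler_peMl//; have := sqn_ge0 R z; lra.
rewrite -mulr_sumr; apply: (@le_trans _ _ (2 / m.+1%:R * K)).
  by rewrite ler_wpM2l ?divr_ge0// tau_sum// undup_uniq.
by rewrite mulrAC.
Qed.

Lemma capacity_asymp : exists C : R, 0 <= C /\
  forall n, (2 <= n)%N -> `|capacity n - pi / L n| <= C / L n ^+ 2.
Proof.
have [C [C0 HC]] := sum_escape R; have p0 := pi_gt0 R.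
exists (4 * pi ^+ 2 + K * (2 * pi) ^+ 2 + 2 * K * C * (2 * pi)); split.
  have := ltW p0; move: (pi : R) => P P0.
  by do ?[apply: addr_ge0|apply: mulr_ge0|apply: exprn_ge0].
move=> n n2; have l0 := ln_nat_gt0 R n2.
have g0 : 0 < green n 0 by apply: lt_le_trans (green0_ge1 R n).
have gi := green0_inv_le R n2; have := green0_inv_asymp R n2.
have n0 : 0 < n%:R :> R by rewrite ltr0n; lia.
have up : capacity n <= (green n 0)^-1 + K * (2 * pi) ^+ 2 / L n ^+ 2.
  apply: le_trans (capacity_upper n) _; rewrite lerD2l -mulrA ler_wpM2l//.
  rewrite -exprVn -expr_div_n lerXn2r// nnegrE ?invr_ge0 ?(ltW g0)//.
  by rewrite divr_ge0 ?mulr_ge0// ltW.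
have lo : (green n 0)^-1 - 2 * K * C * (2 * pi) / L n ^+ 2 <= capacity n.
  have h1 : 2 * K / n.+1%:R * \sum_(k < n.+1) escape R k <= 2 * K * C / L n.
    apply: (@le_trans _ _ (2 * K / n.+1%:R * (C * (n%:R / L n)))).
      by rewrite ler_wpM2l ?divr_ge0 ?mulr_ge0// HC.
    have -> : 2 * K * C / L n = 2 * K / n.+1%:R * (C * (n.+1%:R / L n)).
      move: (L n) l0 => l l0; have q0 : n.+1%:R != 0 :> R by rewrite pnatr_eq0.
      by move: (n.+1%:R) q0 => q q0; field; rewrite q0 (gt_eqF l0).
    rewrite ler_wpM2l ?divr_ge0 ?mulr_ge0// ler_wpM2l// ler_pM2r ?invr_gt0//.
    by rewrite ler_nat.
  have h2 : 1 - 2 * K * C / L n <= green n 0 * capacity n.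
    by apply: le_trans (capacity_lower n); rewrite lerD2l lerN2.
  rewrite -(ler_pM2l g0); apply: le_trans h2.
  rewrite mulrBr divff ?gt_eqF// lerD2l lerN2.
  rewrite -(ler_pM2l (_ : 0 < (green n 0)^-1)) ?invr_gt0//.
  rewrite [X in _ <= X]mulKf ?gt_eqF// [X in X <= _]mulrC.
  have -> : 2 * K * C * (2 * pi) / L n ^+ 2 = 2 * K * C / L n * (2 * pi / L n).
    by field; rewrite gt_eqF.
  by rewrite ler_wpM2l// divr_ge0 ?mulr_ge0// ltW.
have E (x y z w : R) : (x + y + z) / w = x / w + y / w + z / w by ring.
rewrite E; set a := _ / _ ^+ 2 in up *; set b := _ / _ ^+ 2 in lo *; set c := 4 * pi ^+ 2 / L n ^+ 2.
have a0 : 0 <= a by rewrite divr_ge0 ?mulr_ge0 ?exprn_ge0 ?mulr_ge0// ltW.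
have b0 : 0 <= b by rewrite divr_ge0 ?mulr_ge0 ?exprn_ge0 ?mulr_ge0// ltW.
rewrite !ler_norml; lra.
Qed.

Lemma walkE_trace_asymp : exists C : R, 0 <= C /\
  forall n, (2 <= n)%N ->
    `|walkE n (fun s => F (trace s)) - pi * (n%:R / L n)| <= C * (n%:R / L n ^+ 2).
Proof.
have [c [c0 Hc]] := capacity_asymp.
have [C [C0 HC]] := cesaro_ln c0 Hc.
pose h n : R := walkE n (fun s => F (trace s)).
(* The sites visited at times 1 to $n+1$ form a translate of an [n]-step trace, so the subtracted
   mean is the previous value. *)
have hS n : h n.+1 = h n + capacity n.+1.
  rewrite /h /capacity walkEB addrCA [walkE _ (fun s => F (behead (trace s)))]walkES.
  rewrite -[LHS]addr0; congr (_ + _); apply/esym/eqP; rewrite subr_eq0; apply/eqP.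
  rewrite (eq_bigr (fun=> walkE n (fun s => F (trace s)))).
    by rewrite /dirs !big_cons big_nil; field.
  by move=> d _; apply: eq_walkE => s _; rewrite /= F_shift.
have hE n : (2 <= n)%N -> h n = h 1%N + \sum_(2 <= k < n.+1) capacity k.
  elim: n => [//|n IHn]; rewrite ltnS leq_eqVlt => /orP [/eqP <-|n2].
    by rewrite big_nat1 hS.
  by rewrite hS IHn// -addrA [in RHS]big_nat_recr ?(leqW n2).
exists (C + 4 * `|h 1%N|); split; first by rewrite addr_ge0 ?mulr_ge0.
move=> n n2; rewrite -/(h n) hE//.
have -> : h 1%N + \sum_(2 <= k < n.+1) capacity k - pi * (n%:R / L n) =
    \sum_(2 <= k < n.+1) capacity k - pi * (n%:R / L n) + h 1%N by rewrite -addrA addrC.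
rewrite [X in _ <= X]mulrDl.
apply: le_trans (ler_normD _ _) _; apply: lerD; first exact: HC.
by rewrite -mulrA mulrCA ler_peMr// nat_div_ln2_ge.
Qed.

End CapacityMean.

(** * Variance over the walk, by halving *)

Section CapacityVariance.
Variable R : realType.
Local Notation green := (@green R).
Local Notation L n := (ln (n%:R : R)).
(* kappa (b - a) stands for the mean size of the intersection of the clusters of a and b. *)
Variables (F : seq Z2 -> R) (kappa : Z2 -> R) (K : R).
Hypothesis F_ext : forall A B : seq Z2, A =i B -> F A = F B.
Hypothesis F_shift : forall x A, F (shift x A) = F A.
Hypothesis kappa_ge0 : forall z, 0 <= kappa z.
Hypothesis kappa_sum : forall Z, uniq Z -> \sum_(z <- Z) kappa z <= K.
Hypothesis F_inter_ge0 : forall A B, 0 <= F A + F B - F (A ++ B).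
Hypothesis F_inter : forall A B, F A + F B - F (A ++ B) <=
  \sum_(a <- undup A) \sum_(b <- undup B) kappa (b - a).

Lemma hit2_le_mono m n (x y : Z2) : (m <= n)%N -> hit2 R m x y <= hit2 R n x y.
Proof.
move=> mn; rewrite -(subnKC mn) /hit2 walkE_cat; apply: ler_walkE => s _.
rewrite -[leLHS](walkE_cst (n - m)); apply: ler_walkE => t _.
rewrite ler_nat trace_cat !mem_cat.
by case: (x \in trace s); case: (y \in trace s).
Qed.

Let K_ge0 : 0 <= K.
Proof. by have := @kappa_sum [::] isT; rewrite big_nil. Qed.

(** The square is a sum over two pairs $(a,b)$ and $(a',b')$, whose mean factors into two-site
    hitting probabilities of the two walks. Their product is at most half the sum of the squares,
    after which [kappa] is summed over the sites absent from the remaining factor, giving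
    [K ^+ 2]. *)
Let inter_moment m n N : (m <= N)%N -> (n <= N)%N ->
  walkE m (fun s => walkE n (fun t =>
    (F (trace s) + F (trace t) - F (trace s ++ trace t)) ^+ 2)) <=
  K ^+ 2 * (4 * (8 * N.+1%:R / green N 0 ^+ 2) ^+ 2).
Proof.
move=> mN nN; set B := 4 * _.
pose Z := undup (flatten (map trace (words m)) ++ flatten (map trace (words n))).
have uZ : uniq Z by apply: undup_uniq.
have expand A (f : Z2 -> R) : {subset A <= Z} ->
    \sum_(a <- undup A) f a = \sum_(a <- Z) (a \in A)%:R * f a.
  move=> AZ; under [RHS]eq_bigr => a _ do rewrite mulr_natl mulrb.
  rewrite -big_mkcond -[RHS]big_filter; apply: perm_big; apply: uniq_perm.
  - exact: undup_uniq.
  - exact: filter_uniq.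
  - move=> a; rewrite mem_undup mem_filter; case: (boolP (a \in A)) => //= /AZ.
    by move=> ->.
pose J s t := \sum_(a <- Z) \sum_(b <- Z)
  (a \in trace s)%:R * (b \in trace t)%:R * kappa (b - a).
have J_ge0 s t : 0 <= J s t.
  by apply: sumr_ge0 => a _; apply: sumr_ge0 => b _; rewrite !mulr_ge0.
apply: (@le_trans _ _ (walkE m (fun s => walkE n (fun t => J s t ^+ 2)))).
  apply: ler_walkE => s sm; apply: ler_walkE => t tn.
  rewrite lerXn2r ?nnegrE// (le_trans (F_inter _ _))//.
  rewrite expand; last first.
    move=> a at'; rewrite mem_undup mem_cat; apply/orP; left; apply/flattenP.
    by exists (trace s) => //; exact: map_f.
  apply: ler_sum => a _; rewrite expand; last first.
    move=> b bt; rewrite mem_undup mem_cat; apply/orP; right; apply/flattenP.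
    by exists (trace t) => //; exact: map_f.
  by rewrite mulr_sumr le_eqVlt; apply/orP; left; apply/eqP; apply: eq_bigr => b _; rewrite mulrA.
have sq2 s t : J s t ^+ 2 = \sum_(a <- Z) \sum_(b <- Z) \sum_(a' <- Z) \sum_(b' <- Z)
   (kappa (b - a) * kappa (b' - a')) *
     (((a \in trace s) && (a' \in trace s))%:R * ((b \in trace t) && (b' \in trace t))%:R).
  rewrite expr2 {1}/J mulr_suml; apply: eq_bigr => a _.
  rewrite mulr_suml; apply: eq_bigr => b _.
  rewrite /J mulr_sumr; apply: eq_bigr => a' _.
  rewrite mulr_sumr; apply: eq_bigr => b' _.
  by rewrite -!mulnb !natrM; ring.
have -> : walkE m (fun s => walkE n (fun t => J s t ^+ 2)) =
   \sum_(a <- Z) \sum_(b <- Z) \sum_(a' <- Z) \sum_(b' <- Z)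
     (kappa (b - a) * kappa (b' - a')) * (hit2 R m a a' * hit2 R n b b').
  under eq_walkE => s _.
    under eq_walkE => t _ do rewrite sq2.
    rewrite walkE_sum; under eq_bigr => a _.
      rewrite walkE_sum; under eq_bigr => b _.
        rewrite walkE_sum; under eq_bigr => a' _.
          rewrite walkE_sum; under eq_bigr => b' _ do rewrite walkEZ walkEZ.
          over.
        over.
      over.
    over.
  rewrite walkE_sum; apply: eq_bigr => a _.
  rewrite walkE_sum; apply: eq_bigr => b _.
  rewrite walkE_sum; apply: eq_bigr => a' _.
  rewrite walkE_sum; apply: eq_bigr => b' _.
  by rewrite walkEZ walkEZr.
pose Q a a' := hit2 R N a a' ^+ 2.
have Qsum : \sum_(a <- Z) \sum_(a' <- Z) Q a a' <= B by exact: sum_hit2_sqr.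
have Q0 a a' : 0 <= Q a a' by exact: sqr_ge0.
apply: (@le_trans _ _ (\sum_(a <- Z) \sum_(b <- Z) \sum_(a' <- Z) \sum_(b' <- Z)
     (kappa (b - a) * kappa (b' - a')) * ((Q a a' + Q b b') / 2))).
  apply: ler_sum => a _; apply: ler_sum => b _; apply: ler_sum => a' _; apply: ler_sum => b' _.
  rewrite ler_wpM2l ?mulr_ge0//.
  apply: (@le_trans _ _ (hit2 R N a a' * hit2 R N b b')).
    by rewrite ler_pM ?hit2_ge0 ?hit2_le_mono.
  rewrite ler_pdivlMr// /Q; have := sqr_ge0 (hit2 R N a a' - hit2 R N b b'); lra.
have ks a : \sum_(b <- Z) kappa (b - a) <= K.
  have := @kappa_sum [seq b - a | b <- Z]; rewrite big_map; apply.
  by rewrite map_inj_uniq//; exact: addIr.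
have ks' b : \sum_(a <- Z) kappa (b - a) <= K.
  have := @kappa_sum [seq b - a | a <- Z]; rewrite big_map; apply.
  by rewrite map_inj_uniq// => u v /addrI /oppr_inj.
have S1 : \sum_(a <- Z) \sum_(b <- Z) \sum_(a' <- Z) \sum_(b' <- Z)
     (kappa (b - a) * kappa (b' - a')) * Q a a' <= K ^+ 2 * B.
  apply: (@le_trans _ _ (\sum_(a <- Z) \sum_(a' <- Z) K ^+ 2 * Q a a')); last first.
    under eq_bigr do rewrite -mulr_sumr.
    by rewrite -mulr_sumr ler_wpM2l// sqr_ge0.
  apply: ler_sum => a _; rewrite exchange_big /=; apply: ler_sum => a' _.
  under eq_bigr do rewrite -mulr_suml -mulr_sumr.
  rewrite -!mulr_suml expr2 ler_wpM2r// ler_pM ?sumr_ge0//.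
have S2 : \sum_(a <- Z) \sum_(b <- Z) \sum_(a' <- Z) \sum_(b' <- Z)
     (kappa (b - a) * kappa (b' - a')) * Q b b' <= K ^+ 2 * B.
  apply: (@le_trans _ _ (\sum_(b <- Z) \sum_(b' <- Z) K ^+ 2 * Q b b')); last first.
    under eq_bigr do rewrite -mulr_sumr.
    by rewrite -mulr_sumr ler_wpM2l// sqr_ge0.
  rewrite exchange_big /=; apply: ler_sum => b _.
  under eq_bigr do rewrite exchange_big /=.
  rewrite exchange_big /=; apply: ler_sum => b' _.
  under eq_bigr do rewrite -mulr_suml -mulr_sumr.
  by rewrite -!mulr_suml expr2 ler_wpM2r// ler_pM ?sumr_ge0.
have -> : \sum_(a <- Z) \sum_(b <- Z) \sum_(a' <- Z) \sum_(b' <- Z)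
     (kappa (b - a) * kappa (b' - a')) * ((Q a a' + Q b b') / 2) =
  (\sum_(a <- Z) \sum_(b <- Z) \sum_(a' <- Z) \sum_(b' <- Z)
     (kappa (b - a) * kappa (b' - a')) * Q a a' +
   \sum_(a <- Z) \sum_(b <- Z) \sum_(a' <- Z) \sum_(b' <- Z)
     (kappa (b - a) * kappa (b' - a')) * Q b b') / 2.
  rewrite -big_split mulr_suml /=; apply: eq_bigr => a _.
  rewrite -big_split mulr_suml /=; apply: eq_bigr => b _.
  rewrite -big_split mulr_suml /=; apply: eq_bigr => a' _.
  rewrite -big_split mulr_suml /=; apply: eq_bigr => b' _.
  by rewrite -mulrDr mulrA.
lra.
Qed.

Let H n := walkE n (fun s => F (trace s)).
Let V n := walkE n (fun s => (F (trace s) - H n) ^+ 2).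

(** The mean minimises the quadratic deviation, so a more convenient centre may replace it. *)
Let V_le n c : V n <= walkE n (fun s => (F (trace s) - c) ^+ 2).
Proof.
have -> : walkE n (fun s => (F (trace s) - c) ^+ 2) = V n + (H n - c) ^+ 2.
  rewrite -[X in V n + X](walkE_cst n) -[RHS]addr0.
  have <- : 2 * (H n - c) * walkE n (fun s => F (trace s) - H n) = 0.
    by rewrite walkEB walkE_cst subrr mulr0.
  rewrite -walkEZ -!walkED; apply: eq_walkE => s _; ring.
by rewrite lerDl sqr_ge0.
Qed.

(** Seen from the midpoint, the reversed first half and the second half are independent walks, and
    [F] of the whole trace differs from the sum over the halves by their interaction [J]. *)
Let V_split n : (4 <= n)%N -> V n <= 5 / 4 * (V n./2 + V (n - n./2)%N) +
  5 * (K ^+ 2 * (4 * (8 * n.+1%:R / green n 0 ^+ 2) ^+ 2)).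
Proof.
move=> n4; set m := n./2; set m' := (n - m)%N.
have mn : (m <= n)%N by rewrite /m; lia.
apply: le_trans (V_le n (H m + H m')) _.
rewrite -[X in walkE X](subnKC mn) -/m' walkE_cat.
pose J s t := F (trace s) + F (trace t) - F (trace s ++ trace t).
apply: (@le_trans _ _ (walkE m (fun s => walkE m' (fun t =>
  5 / 4 * (F (trace s) - H m + (F (trace t) - H m')) ^+ 2 + 5 * J (rev (map -%R s)) t ^+ 2)))).
  apply: ler_walkE => s _; apply: ler_walkE => t _.
  have -> : F (trace (s ++ t)) = F (trace s) + F (trace t) - J (rev (map -%R s)) t.
    rewrite /J (F_ext (trace_rev s)) F_shift opprB addrCA subrr addr0.
    rewrite (F_ext (mem_trace_cat s t)) -(F_shift (- endpoint s)) shift_cat.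
    rewrite shift_shift addNr shift0; apply: F_ext => x.
    by rewrite !mem_cat trace_rev.
  set x := F (trace s); set y := F (trace t); set j := J _ _.
  (* $(u-j)^2\le\frac54u^2+5j^2$, the defect being the square of $u/2+2j$. *)
  have := sqr_ge0 ((x - H m + (y - H m')) / 2 + 2 * j); lra.
under eq_walkE => s _ do rewrite walkED walkEZ walkEZ.
rewrite walkED walkEZ walkEZ; apply: lerD.
  rewrite ler_pM2l//.
  have X0 k : walkE k (fun s => F (trace s) - H k) = 0 by rewrite walkEB walkE_cst subrr.
  rewrite (eq_walkE (g := fun s => (F (trace s) - H m) ^+ 2 + V m')).
    by rewrite walkED walkE_cst.
  move=> s _; set x := F (trace s) - H m.
  rewrite (eq_walkE (g := fun t => (F (trace t) - H m') ^+ 2 + (2 * x * (F (trace t) - H m') + x ^+ 2))).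
    by rewrite !walkED walkE_cst walkEZ X0 -/(V m'); ring.
  by move=> t _; ring.
rewrite ler_pM2l//.
have -> : walkE m (fun s => walkE m' (fun t => J (rev (map -%R s)) t ^+ 2)) =
   walkE m (fun s => walkE m' (fun t => J s t ^+ 2)).
  rewrite (walkE_opp m (fun s => walkE m' (fun t => J (rev s) t ^+ 2))).
  by rewrite (walkE_rev m (fun s => walkE m' (fun t => J s t ^+ 2))).
by apply: inter_moment => //; rewrite leq_subr.
Qed.

Lemma walkE_variance : exists C : R, 0 <= C /\ forall n, (2 <= n)%N ->
  walkE n (fun s => (F (trace s) - walkE n (fun s => F (trace s))) ^+ 2) <=
  C * (n%:R ^+ 2 / L n ^+ 4).
Proof.
have p0 := pi_gt0 R.
pose C := 5 * (K ^+ 2 * (4 * (16 * (2 * pi) ^+ 2) ^+ 2)) : R.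
apply: (@halving_recursion R V C).
- by rewrite /C mulr_ge0// mulr_ge0 ?sqr_ge0// mulr_ge0 ?sqr_ge0.
- by move=> n; apply: walkE_ge0 => s _; exact: sqr_ge0.
move=> n n4; apply: le_trans (V_split n4) _; rewrite lerD2l.
have n2 : (2 <= n)%N by lia.
have l0 := ln_nat_gt0 R n2; have gi := green0_inv_le R n2.
have g0 : 0 < green n 0 by apply: lt_le_trans (green0_ge1 R n).
have -> : C * (n%:R ^+ 2 / L n ^+ 4) =
    5 * (K ^+ 2 * (4 * ((16 * (2 * pi) ^+ 2) ^+ 2 * (n%:R ^+ 2 / L n ^+ 4)))).
  by rewrite /C; ring.
rewrite ler_wpM2l// ler_wpM2l ?sqr_ge0// ler_wpM2l//.
have -> : (16 * ((2 * pi) ^+ 2)) ^+ 2 * (n%:R ^+ 2 / L n ^+ 4) =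
    ((16 * n%:R) * (2 * pi / L n) ^+ 2) ^+ 2.
  by field; rewrite gt_eqF.
rewrite lerXn2r ?nnegrE//.
- by rewrite !mulr_ge0 ?invr_ge0 ?sqr_ge0.
- by rewrite mulr_ge0 ?sqr_ge0.
- apply: ler_pM => //; rewrite ?mulr_ge0 ?invr_ge0 ?sqr_ge0//.
    by rewrite -!natrM ler_nat; lia.
  rewrite -exprVn lerXn2r// nnegrE ?invr_ge0 ?(ltW g0)//.
  by rewrite divr_ge0 ?mulr_ge0// ltW.
Qed.

End CapacityVariance.

(** * Countable sums *)

Section CountableSum.
Local Open Scope ereal_scope.
Variables (R : realType) (T : countType).
Implicit Types f g : T -> \bar R.

(** Sum along the [pickle] enumeration, numbers that encode no element contributing 0. For
    nonnegative [f], [csum_le] and [csum_ge] make it the supremum of finite sums, so the enumeration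
    is immaterial. *)
Definition csum f : \bar R := \sum_(k <oo) oapp f 0 (pickle_inv k).

Let oapp_ge0 f : (forall x, 0 <= f x) -> forall k : nat, 0 <= oapp f 0 (pickle_inv k).
Proof. by move=> f0 k; case: pickle_inv => /=. Qed.

Lemma csum_ge0 f : (forall x, 0 <= f x) -> 0 <= csum f.
Proof. by move=> f0; apply: nneseries_ge0 => k _ _; exact: oapp_ge0. Qed.

Lemma le_csum f g : (forall x, 0 <= f x) -> (forall x, f x <= g x) ->
  csum f <= csum g.
Proof.
move=> f0 fg; apply: lee_nneseries => [k _ _|k _]; first exact: oapp_ge0.
by case: pickle_inv => /=.
Qed.

Lemma eq_csum f g : f =1 g -> csum f = csum g.
Proof. by move=> fg; rewrite (_ : f = g)//; apply/funext. Qed.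

Lemma csumD f g : (forall x, 0 <= f x) -> (forall x, 0 <= g x) ->
  csum (fun x => f x + g x) = csum f + csum g.
Proof.
move=> f0 g0; rewrite /csum -nneseriesD; [|by move=> *; exact: oapp_ge0..].
by apply: eq_eseriesr => k _; case: pickle_inv => //=; rewrite adde0.
Qed.

Lemma csum_sum (I : Type) (r : seq I) (h : I -> T -> \bar R) :
  (forall i x, 0 <= h i x) ->
  csum (fun x => \sum_(i <- r) h i x) = \sum_(i <- r) csum (h i).
Proof.
move=> h0; elim: r => [|i r IHr].
  rewrite big_nil /csum eseries0// => k _ _.
  by case: pickle_inv => //= x; rewrite big_nil.
rewrite big_cons -IHr -csumD//; last by move=> x; apply: sume_ge0.
by apply: eq_csum => x; rewrite big_cons.
Qed.

Lemma csumZl (c : R) f : (0 <= c)%R -> (forall x, 0 <= f x) ->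
  csum (fun x => c%:E * f x) = c%:E * csum f.
Proof.
move=> c0 f0; rewrite /csum -nneseriesZl; last by move=> *; exact: oapp_ge0.
by apply: eq_eseriesr => k _; case: pickle_inv => //=; rewrite mule0.
Qed.

Let block n : seq T := pmap pickle_inv (iota 0 n).

Let block_uniq n : uniq (block n).
Proof. by apply: (pmap_uniq (@pickle_invK T)); exact: iota_uniq. Qed.

Let block_sum f n : \sum_(0 <= k < n) oapp f 0 (pickle_inv k) = \sum_(x <- block n) f x.
Proof.
rewrite /block /index_iota subn0; elim: (iota 0 n) => [|k l IHl]; first by rewrite !big_nil.
by rewrite big_cons IHl /=; case: pickle_inv => [x|] /=; rewrite ?big_cons ?add0e.
Qed.

Lemma csum_le f M : (forall x, 0 <= f x) ->
  (forall Z, uniq Z -> \sum_(z <- Z) f z <= M) -> csum f <= M.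
Proof.
move=> f0 fM; apply: lime_le; first by apply: is_cvg_nneseries => *; exact: oapp_ge0.
by apply: nearW => n; rewrite block_sum fM.
Qed.

Lemma csum_ge f Z : (forall x, 0 <= f x) -> uniq Z -> \sum_(z <- Z) f z <= csum f.
Proof.
move=> f0 uZ; pose n := (\max_(z <- Z) pickle z).+1.
apply: le_trans (nneseries_lim_ge n _); last by move=> *; exact: oapp_ge0.
rewrite block_sum.
have ZB : {subset Z <= block n}.
  move=> z zZ; rewrite mem_pmap -(pickleK_inv z) map_f// mem_iota add0n /n ltnS /=.
  by rewrite (bigD1_seq z)//= leq_maxl.
have -> : \sum_(z <- Z) f z = \sum_(z <- block n | z \in Z) f z.
  rewrite -[RHS]big_filter; apply: perm_big; apply: uniq_perm => //.
    by rewrite filter_uniq.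
  by move=> z; rewrite mem_filter; case: (boolP (z \in Z)) => //= /ZB ->.
rewrite [leRHS](bigID (fun z => z \in Z)) /= leeDl// sume_ge0// => z _.
Qed.

Lemma csum_inj (S : T -> T) f : injective S -> (forall x, 0 <= f x) ->
  csum (f \o S) <= csum f.
Proof.
move=> Si f0; apply: csum_le => [x|Z uZ]; first exact: f0.
rewrite -(big_map S xpredT f); apply: csum_ge => //.
by rewrite map_inj_uniq.
Qed.

Lemma csum_bij (S S' : T -> T) f : cancel S S' -> cancel S' S ->
  (forall x, 0 <= f x) -> csum (f \o S) = csum f.
Proof.
move=> SK SK' f0; apply/eqP; rewrite eq_le csum_inj//=; last exact: can_inj SK.
rewrite [leLHS](_ : _ = csum ((f \o S) \o S')); last first.
  by apply: eq_csum => x /=; rewrite SK'.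
by apply: csum_inj; [exact: can_inj SK'|move=> x /=].
Qed.

Lemma csum_fin f (M : R) : (forall x, 0 <= f x) -> csum f <= M%:E ->
  csum f = (fine (csum f))%:E.
Proof.
move=> f0 fM; rewrite fineK// ge0_fin_numE ?csum_ge0//.
by apply: le_lt_trans fM _; rewrite ltry.
Qed.

(** If every finite sum fell short by [e], the supremum would be at most [csum f - e%:E]. *)
Lemma csum_approx f (e : R) : (forall x, 0 <= f x) -> csum f < +oo -> (0 < e)%R ->
  exists2 Z, uniq Z & csum f <= \sum_(z <- Z) f z + e%:E.
Proof.
move=> f0 foo e0; apply: contrapT => /forall2NP h.
have fin : csum f \is a fin_num by rewrite ge0_fin_numE ?csum_ge0.
suff : csum f <= csum f - e%:E.
  rewrite -(fineK fin) -EFinB lee_fin; lra.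
apply: csum_le => // Z uZ; rewrite leeBrDr//.
by case: (h Z) => // /negP; rewrite -ltNge => /ltW.
Qed.

Lemma counting_csum (X : set T) :
  counting X = csum (fun x => (`[< X x >]%:R : R)%:E).
Proof.
have f0 x : 0 <= (`[< X x >]%:R : R)%:E by rewrite lee_fin.
have sumE Z : \sum_(z <- Z) (`[< X z >]%:R : R)%:E = (count (fun z => `[< X z >]) Z)%:R%:E.
  elim: Z => [|z Z IHZ]; first by rewrite big_nil.
  by rewrite big_cons IHZ /= natrD EFinD.
apply/eqP; rewrite eq_le /counting; case: asboolP => finX; apply/andP; split.
- have := csum_ge f0 (finmap.fset_uniq (fset_set X)).
  apply: le_trans; rewrite sumE lee_fin ler_nat.
  rewrite (eq_in_count (a2 := xpredT)) ?count_predT//.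
  by move=> z; rewrite in_fset_set// inE => Xz; apply/asboolP.
- apply: csum_le => // Z uZ; rewrite sumE lee_fin ler_nat -size_filter.
  apply: uniq_leq_size; first by rewrite filter_uniq.
  by move=> z; rewrite mem_filter in_fset_set// inE => /andP [/asboolP].
- rewrite leye_eq; apply/eqP/eqyP => A A0.
  have [C CX AC] := infinite_set_fset (Num.bound A) finX.
  apply: (@le_trans _ _ (\sum_(z <- finmap.enum_fset C) (`[< X z >]%:R : R)%:E)).
    rewrite sumE lee_fin (eq_in_count (a2 := xpredT)) ?count_predT.
      apply: le_trans (ltW (archi_boundP (ltW A0))) _.
      by rewrite ler_nat.
    by move=> z zC; apply/asboolP; exact: CX.
  exact: csum_ge _ (finmap.fset_uniq C).
- exact: leey.
Qed.

End CountableSum.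

Section CountableSumIntegral.
Local Open Scope ereal_scope.

Lemma csum_csum (R : realType) (T T' : countType) (f : T -> T' -> \bar R) :
  (forall x y, 0 <= f x y) ->
  csum (fun x => csum (f x)) = csum (fun y => csum (fun x => f x y)).
Proof.
have half (S S' : countType) (g : S -> S' -> \bar R) : (forall x y, 0 <= g x y) ->
    csum (fun x => csum (g x)) <= csum (fun y => csum (fun x => g x y)).
  move=> g0; apply: csum_le => [x|Z uZ]; first exact: csum_ge0.
  rewrite -csum_sum//; apply: le_csum => [y|y]; first by apply: sume_ge0.
  exact: (@csum_ge _ _ (fun x => g x y)).
by move=> f0; apply/eqP; rewrite eq_le !half.
Qed.

Context d (Y : measurableType d) (R : realType) (T : countType).
Variable f : T -> Y -> \bar R.
Hypothesis f0 : forall x y, 0 <= f x y.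
Hypothesis mf : forall x, measurable_fun setT (f x).

Let of0 k y : 0 <= oapp (f ^~ y) 0 (pickle_inv k).
Proof. by case: pickle_inv => /=. Qed.

Let omf k : measurable_fun setT (fun y => oapp (f ^~ y) 0 (pickle_inv k)).
Proof. by case: pickle_inv => /= [x|]; [exact: mf|exact: measurable_cst]. Qed.

Lemma measurable_csum : measurable_fun setT (fun y => csum (f ^~ y)).
Proof.
exact: (@ge0_emeasurable_sum _ _ _ setT
  (fun k y => oapp (f ^~ y) 0 (pickle_inv k)) xpredT).
Qed.

Lemma integral_csum (mu : {measure set Y -> \bar R}) :
  \int[mu]_y csum (f ^~ y) = csum (fun x => \int[mu]_y f x y).
Proof.
rewrite /csum integral_nneseries//.
apply: eq_eseriesr => k _; case: pickle_inv => //=.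
by rewrite integral0.
Qed.

End CountableSumIntegral.

(** * Clusters and the percolation law *)

Section MeasurableEvents.
Context d (Y : measurableType d).
Implicit Types A B : Y -> Prop.

Lemma measurable_and A B : measurable [set y | A y] -> measurable [set y | B y] ->
  measurable [set y | A y /\ B y].
Proof. exact: measurableI. Qed.

Lemma measurable_or A B : measurable [set y | A y] -> measurable [set y | B y] ->
  measurable [set y | A y \/ B y].
Proof. exact: measurableU. Qed.

Lemma measurable_not A : measurable [set y | A y] -> measurable [set y | ~ A y].
Proof. exact: measurableC. Qed.

Lemma measurable_prop (Q : Prop) : measurable [set _ : Y | Q].
Proof.
have [q|q] := pselect Q.
  by rewrite (_ : [set _ | Q] = setT)//; apply/seteqP; split.
by rewrite (_ : [set _ | Q] = set0)//; apply/seteqP; split.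
Qed.

Lemma measurable_exists (T : countType) (A : T -> Y -> Prop) :
  (forall t, measurable [set y | A t y]) -> measurable [set y | exists t, A t y].
Proof.
move=> mA; rewrite (_ : [set y | _] =
  \bigcup_k (if pickle_inv k is Some t then [set y | A t y] else set0)).
  by apply: bigcupT_measurable => k; case: pickle_inv.
apply/seteqP; split => [y [t At]|y [k _]] /=.
  by exists (pickle t) => //; rewrite pickleK_inv.
by case: pickle_inv => // t At; exists t.
Qed.

End MeasurableEvents.

Section Clusters.
Implicit Types (w : edge -> bool) (x y z : Z2).

Definition nrm (z : Z2) : nat := (absz z.1 + absz z.2)%N.

(** Keeping the whole path inside [D] makes the event depend only on edges of [D], finitely many
    when [D] is bounded; all independence arguments rest on such local events. *)
Definition conn_in (D : set Z2) (w : edge -> bool) (x y : Z2) : Prop :=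
  exists s : seq Z2, [/\ path (open_step w) x s, last x s = y &
    forall z, z \in x :: s -> D z].

Lemma open_clusterE w x y : open_cluster w x y <-> conn_in setT w x y.
Proof. by split=> [[s ps ls]|[s [ps ls _]]]; exists s. Qed.

Lemma open_stepP w x y : reflect
  (exists2 e : edge, w e & (x, y) = endpoints e \/ (y, x) = endpoints e)
  (open_step w x y).
Proof. exact: asboolP. Qed.

Lemma open_step_sym w x y : open_step w x y = open_step w y x.
Proof.
by apply/open_stepP/open_stepP => -[e we [h|h]]; exists e => //; [right|left|right|left].
Qed.

Lemma nrmN z : nrm (- z) = nrm z.
Proof. by case: z => a b; rewrite /nrm /= !abszN. Qed.

Lemma nrm_triangle x y : (nrm (x + y)%R <= nrm x + nrm y)%N.
Proof. by case: x y => [a b] [c e]; rewrite /nrm /=; lia. Qed.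

Lemma nrm0 : nrm 0 = 0%N.
Proof. by []. Qed.

Lemma open_step_nrm w x y : open_step w x y -> nrm (y - x) = 1%N.
Proof.
move=> /open_stepP [[[a b] c] _]; rewrite /endpoints.
case: x y => [x1 x2] [y1 y2] /=.
by case: c => -[] [-> -> -> ->]; rewrite /nrm /=; lia.
Qed.

Lemma open_step_near w x y z : open_step w x y -> (nrm (y - z)%R <= (nrm (x - z)%R).+1)%N.
Proof.
move=> /open_step_nrm e.
have -> : y - z = (y - x) + (x - z) by rewrite addrA subrK.
by apply: leq_trans (nrm_triangle _ _) _; rewrite e add1n.
Qed.

Lemma conn_refl (D : set Z2) w x : D x -> conn_in D w x x.
Proof. by move=> Dx; exists [::]; split => // z; rewrite inE => /eqP ->. Qed.

Lemma conn_dom (D : set Z2) w x y : conn_in D w x y -> D x /\ D y.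
Proof.
move=> [s [_ <- sD]]; split; first by apply: sD; rewrite mem_head.
by apply: sD; exact: mem_last.
Qed.

Lemma conn_trans (D : set Z2) w x y z : conn_in D w x y -> conn_in D w y z -> conn_in D w x z.
Proof.
move=> [s [ps ls sD]] [t [pt lt tD]]; exists (s ++ t); split.
- by rewrite cat_path ps ls.
- by rewrite last_cat ls.
- move=> u; rewrite -cat_cons mem_cat => /orP [/sD//|ut].
  by apply: tD; rewrite inE ut orbT.
Qed.

Lemma conn_sub (D D' : set Z2) w x y : D `<=` D' -> conn_in D w x y -> conn_in D' w x y.
Proof. by move=> DD' [s [ps ls sD]]; exists s; split => // z /sD /DD'. Qed.

Lemma conn_step (D : set Z2) w x y : D x -> D y -> open_step w x y -> conn_in D w x y.
Proof.
move=> Dx Dy xy; exists [:: y]; split => //=; first by rewrite xy.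
by move=> z; rewrite !inE => /orP [] /eqP ->.
Qed.

Lemma conn_sym (D : set Z2) w x y : conn_in D w x y -> conn_in D w y x.
Proof.
move=> [s [ps ls sD]]; elim: s x ps ls sD => [|u s IHs] x /=.
  by move=> _ <- sD; apply: conn_refl; apply: sD; rewrite mem_head.
move=> /andP [xu ps] ls sD; apply: (@conn_trans _ _ _ u).
  by apply: IHs => // z zs; apply: sD; rewrite inE zs orbT.
apply: conn_step; [by apply: sD; rewrite !inE eqxx orbT|by apply: sD; rewrite mem_head|].
by rewrite open_step_sym.
Qed.

Definition tr (x : Z2) (w : edge -> bool) : edge -> bool := fun e => w (e.1 + x, e.2).

Lemma open_step_tr x w u v : open_step (tr x w) u v = open_step w (u + x) (v + x).
Proof.
apply/open_stepP/open_stepP => -[[e b] we h].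
  exists (e + x, b) => //; rewrite /endpoints /=.
  by rewrite /endpoints /= in h; case: h => -[-> ->]; [left|right]; rewrite addrAC.
exists (e - x, b); first by rewrite /tr /= subrK.
rewrite /endpoints /= in h *.
have E a c : a + x = c -> a = c - x by move=> <-; rewrite addrK.
case: h => h; [left|right].
  have h1 : u + x = e := congr1 fst h; have h2 : v + x = _ := congr1 snd h.
  by rewrite (E _ _ h1) (E _ _ h2) addrAC.
have h1 : v + x = e := congr1 fst h; have h2 : u + x = _ := congr1 snd h.
by rewrite (E _ _ h1) (E _ _ h2) addrAC.
Qed.

Lemma conn_tr (D : set Z2) x w u v :
  conn_in D (tr x w) u v <-> conn_in [set z | D (z - x)] w (u + x) (v + x).
Proof.
split=> [[s [ps ls sD]]|[s [ps ls sD]]].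
  exists [seq z + x | z <- s]; split.
  - rewrite (map_path (h := fun z => z + x) (e' := open_step (tr x w)) (b := xpred0))//.
    by move=> a b _; rewrite open_step_tr.
    by apply/hasPn.
  - by rewrite (last_map (fun z => z + x)) ls.
  - rewrite -(map_cons (fun z => z + x)) => z /mapP [a /sD Da ->] /=.
    by rewrite addrK.
exists [seq z - x | z <- s]; split.
- have e : u = (u + x) - x by rewrite addrK.
  rewrite [in path _ u]e (map_path (h := fun z => z - x) (e' := open_step w) (b := xpred0))//.
    by move=> a b _; rewrite open_step_tr !subrK.
  by apply/hasPn.
- by rewrite -[u in LHS](addrK x) (last_map (fun z => z - x)) ls addrK.
- rewrite -[u](addrK x) -(map_cons (fun z => z - x)) => z /mapP [a /sD Da ->].
  exact: Da.
Qed.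

Lemma open_cluster_tr x w u v :
  open_cluster (tr x w) u v <-> open_cluster w (u + x) (v + x).
Proof. by rewrite !open_clusterE conn_tr. Qed.

End Clusters.

Section ConfigMeasurable.

Lemma measurable_edge (e : edge) (b : bool) : measurable [set w : config_space | w e = b].
Proof. by apply: sub_sigma_algebra; exists e, b. Qed.

Lemma measurable_open_step x y : measurable [set w : config_space | open_step w x y].
Proof.
rewrite (_ : [set w | _] = [set w : config_space | exists e : edge, w e = true /\
   ((x, y) = endpoints e \/ (y, x) = endpoints e)]).
  apply: measurable_exists => e; apply: measurable_and; first exact: measurable_edge.
  exact: measurable_prop.
apply/seteqP; split => w /=; first by move=> /open_stepP [e we h]; exists e.
by move=> [e [we h]]; apply/open_stepP; exists e.
Qed.

Lemma measurable_conn D x y : measurable [set w : config_space | conn_in D w x y].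
Proof.
apply: measurable_exists => s.
have mp : measurable [set w : config_space | path (open_step w) x s].
  elim: s x => [|u s IHs] x /=.
    by rewrite (_ : [set w | _] = setT)//; apply/seteqP; split.
  rewrite (_ : [set w | _] = [set w : config_space | open_step w x u /\ path (open_step w) u s]).
    by apply: measurable_and; [exact: measurable_open_step|exact: IHs].
  by apply/seteqP; split => w /= /andP.
rewrite (_ : [set w | _] = [set w : config_space | path (open_step w) x s /\
  (last x s = y /\ forall z, z \in x :: s -> D z)]).
  by apply: measurable_and => //; exact: measurable_prop.
by apply/seteqP; split => w /=; [case|case=> ? [] ].
Qed.

Lemma measurable_open_cluster x y :
  measurable [set w : config_space | open_cluster w x y].
Proof.
rewrite (_ : [set w | _] = [set w : config_space | conn_in setT w x y]).
  exact: measurable_conn.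
by apply/seteqP; split => w /= /open_clusterE.
Qed.

Definition translate (x : Z2) : config_space -> config_space := tr x.

Lemma measurable_translate x : measurable_fun setT (translate x).
Proof.
apply: (@measurability _ _ config_space config_space setT _ (@coordinate_sets edge bool)) => //.
move=> _ [_ [e [b ->]] <-]; rewrite setTI.
exact: measurable_edge.
Qed.

HB.instance Definition _ x :=
  isMeasurableFun.Build _ _ _ _ (translate x) (measurable_translate x).

End ConfigMeasurable.

Section BernoulliLaw.
Variables (R : realType) (p : R).

Definition cylinder (A : seq edge) (v : edge -> bool) : set config_space :=
  [set w | forall e, e \in A -> w e = v e].

Lemma measurable_cylinder A v : measurable (cylinder A v).
Proof.
elim: A => [|e A IHA]; first by rewrite (_ : cylinder _ _ = setT)//; apply/seteqP; split.
rewrite (_ : cylinder _ _ = [set w : config_space | w e = v e] `&` cylinder A v).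
  by apply: measurableI => //; exact: measurable_edge.
apply/seteqP; split => w /=.
  by move=> h; split; [apply: h; rewrite mem_head|move=> e' e'A; apply: h; rewrite inE e'A orbT].
by move=> [we h] e'; rewrite inE => /orP [/eqP ->//|/h].
Qed.

(** Uniqueness on a generating $\pi$-system. Incompatible cylinders have empty intersection, so the
    empty set is added to close the system. *)
Lemma cylinder_unique (m1 m2 : {measure set config_space -> \bar R}) :
  (forall A v, uniq A -> m1 (cylinder A v) = m2 (cylinder A v)) ->
  (m1 setT < +oo)%E ->
  forall A, measurable A -> m1 A = m2 A.
Proof.
move=> m12 fin.
pose G : set (set config_space) :=
  [set C | C = set0 \/ exists A v, uniq A /\ C = cylinder A v].
have Gm : G `<=` measurable.
  by move=> _ [->|[A [v [_ ->]]]]; [exact: measurable0|exact: measurable_cylinder].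
have GI : setI_closed G.
  move=> C1 C2 [->|[A [v [uA ->]]]]; first by left; rewrite set0I.
  move=> [->|[B [u [uB ->]]]]; first by left; rewrite setI0.
  have [agree|/existsNP [e /not_implyP [/andP [eA eB] ne]]] :=
    pselect (forall e, (e \in A) && (e \in B) -> v e = u e); last first.
    left; apply/seteqP; split => // w /= [wA wB]; apply: ne.
    by rewrite -wA// -wB.
  right; exists (undup (A ++ B)), (fun e => if e \in A then v e else u e).
  split; first exact: undup_uniq.
  apply/seteqP; split => [w [wA wB] e|w h]; rewrite /cylinder /=.
    by rewrite mem_undup mem_cat; case: ifP => [eA _|_ /= eB]; [exact: wA|exact: wB].
  split=> e eI; have := h e; rewrite mem_undup mem_cat eI ?orbT => /(_ isT).
    by [].
  by case: ifP => // eA -> //; apply: agree; rewrite eA eI.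
have Geq A : G A -> m1 A = m2 A.
  by move=> [->|[B [v [uB ->]]]]; rewrite ?measure0// m12.
move=> A mA; apply: (@g_sigma_algebra_measure_unique _ _ _ G Gm (fun=> setT)) => //.
- by move=> _; right; exists [::], (fun=> true); split => //; apply/seteqP; split.
- by rewrite bigcup_const//; exists 0%N.
- move: A mA; apply: smallest_sub; first exact: smallest_sigma_algebra.
  move=> _ [e [b ->]]; apply: sub_sigma_algebra; right.
  exists [:: e], (fun=> b); split => //; apply/seteqP; split => w /=.
    by move=> we e'; rewrite inE => /eqP ->.
  by apply; rewrite mem_head.
Qed.

Variable Pp : probability config_space R.
Hypothesis hPp : bernoulli_percolation_law p Pp.

Lemma cylinder_translate x A v :
  translate x @^-1` cylinder A v =
  cylinder [seq (e.1 + x, e.2) | e <- A] (fun e => v (e.1 - x, e.2)).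
Proof.
apply/seteqP; split => w h e.
  move=> /mapP [e' e'A ->] /=; rewrite addrK -surjective_pairing.
  by rewrite -(h e' e'A).
move=> eA; have := h (e.1 + x, e.2); rewrite /= addrK -surjective_pairing; apply.
by apply/mapP; exists e.
Qed.

Lemma translate_invariant x (A : set config_space) :
  measurable A -> Pp (translate x @^-1` A) = Pp A.
Proof.
move=> mA; apply: (@cylinder_unique (distribution Pp (translate x)) Pp) => //.
- move=> B v uB; transitivity (Pp (translate x @^-1` cylinder B v)) => //.
  rewrite cylinder_translate; apply: etrans (hPp _ _) _; last first.
    apply/esym; apply: etrans (hPp _ uB) _; congr EFin.
    rewrite big_map; apply: eq_bigr => e _ /=.
    by rewrite addrK -surjective_pairing.
  rewrite map_inj_uniq// => -[e b] [e' b'] /= [] e1 e2 ->.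
  by congr (_, _); apply: (addIr x); rewrite [LHS]surjective_pairing [RHS]surjective_pairing /= e1 e2.
- apply: le_lt_trans (probability_le1 (distribution Pp (translate x)) measurableT) _.
  exact: ltry.
Qed.

Lemma integral_translate x (f : config_space -> \bar R) :
  (forall w, (0 <= f w)%E) -> measurable_fun setT f ->
  (\int[Pp]_w f (translate x w) = \int[Pp]_w f w)%E.
Proof.
move=> f0 mf; rewrite -(ge0_integral_distribution (translate x : {RV Pp >-> _}) mf)//.
apply: eq_measure_integral => A mA _.
exact: translate_invariant.
Qed.

End BernoulliLaw.

(** * Finitely many edges: expectation and independence *)

Section FiniteBernoulli.
Variables (R : realType) (p : R).
Hypothesis p01 : 0 <= p <= 1.
Implicit Types (f g : (edge -> bool) -> R) (w : edge -> bool).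

Definition set_edge (e : edge) (b : bool) w : edge -> bool :=
  fun e' => if e' == e then b else w e'.

(** Mean over independent states of the edges of [s], one edge at a time. Other edges are closed by
    default, which is harmless for functions determined by [s]. *)
Fixpoint bern (s : seq edge) f : R :=
  if s is e :: s' then
    p * bern s' (fun w => f (set_edge e true w)) +
    (1 - p) * bern s' (fun w => f (set_edge e false w))
  else f (fun=> false).

Definition ind (A : (edge -> bool) -> Prop) w : R := `[< A w >]%:R.

Definition dependsf (X : set edge) f :=
  forall w w', (forall e, X e -> w e = w' e) -> f w = f w'.

Definition depends (X : set edge) (A : (edge -> bool) -> Prop) :=
  forall w w', (forall e, X e -> w e = w' e) -> A w -> A w'.

Lemma depends_ind X A : depends X A -> dependsf X (ind A).
Proof.
move=> dA w w' ww'; rewrite /ind; congr ((nat_of_bool _)%:R).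
by apply: asbool_equiv_eq; split; apply: dA => // e /ww'.
Qed.

Lemma eq_bern s f g : f =1 g -> bern s f = bern s g.
Proof. by move=> fg; congr bern; apply/funext. Qed.

Lemma bern_cst s c : bern s (fun=> c) = c.
Proof. by elim: s => //= e s ->; ring. Qed.

Lemma bernD s f g : bern s (fun w => f w + g w) = bern s f + bern s g.
Proof. by elim: s f g => //= e s IHs f g; rewrite !IHs; ring. Qed.

Lemma bern_sum s (I : Type) (r : seq I) (P : pred I) (h : I -> (edge -> bool) -> R) :
  bern s (fun w => \sum_(i <- r | P i) h i w) = \sum_(i <- r | P i) bern s (h i).
Proof.
elim: r => [|i r IHr].
  by under eq_bern do rewrite big_nil; rewrite big_nil bern_cst.
rewrite big_cons -IHr; under eq_bern do rewrite big_cons.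
by case: (P i); rewrite ?bernD.
Qed.

Lemma ler_bern s f g : (forall w, f w <= g w) -> bern s f <= bern s g.
Proof.
have /andP [p0 p1] := p01.
by elim: s f g => //= e s IHs f g fg; rewrite lerD// ler_wpM2l ?subr_ge0// IHs.
Qed.

Lemma bern_ge0 s f : (forall w, 0 <= f w) -> 0 <= bern s f.
Proof. by move=> f0; rewrite -(bern_cst s 0); apply: ler_bern. Qed.

Lemma dependsf_set_edge X f e b : dependsf X f ->
  dependsf X (fun w => f (set_edge e b w)).
Proof.
by move=> df w w' ww'; apply: df => e' Xe'; rewrite /set_edge; case: eqP => // _; exact: ww'.
Qed.

Lemma dependsf_out X f e b w : dependsf X f -> ~ X e -> f (set_edge e b w) = f w.
Proof.
by move=> df nX; apply: df => e' Xe'; rewrite /set_edge; case: eqP => // ee; rewrite -ee in nX.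
Qed.

(** Each edge lies outside [X] or outside [Y], so one of the two factors ignores it and comes out of
    the average over that edge. *)
Lemma bern_indep s X Y f g : dependsf X f -> dependsf Y g -> X `&` Y = set0 ->
  bern s (fun w => f w * g w) = bern s f * bern s g.
Proof.
move=> + + XY; elim: s f g => //= e s IHs f g df dg.
rewrite !IHs; try exact: dependsf_set_edge.
have [Xe|nXe] := pselect (X e).
  have nYe : ~ Y e by move=> Ye; have : set0 e by rewrite -XY.
  have E b : bern s (fun w => g (set_edge e b w)) = bern s g.
    by apply: eq_bern => w; exact: dependsf_out dg _.
  by rewrite !E; ring.
have E b : bern s (fun w => f (set_edge e b w)) = bern s f.
  by apply: eq_bern => w; exact: dependsf_out df _.
by rewrite !E; ring.
Qed.

Variable Pp : probability config_space R.
Hypothesis hPp : bernoulli_percolation_law p Pp.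

Let over (t : seq edge) (v w : edge -> bool) : edge -> bool :=
  fun e => if e \in t then v e else w e.

Let weight (t : seq edge) (v : edge -> bool) : R :=
  \prod_(e <- t) (if v e then p else 1 - p).

(** Induction moves one edge at a time from the free list [s] to the revealed list [t], splitting
    the event by the state of that edge. With no free edge left, the event is empty or a
    cylinder. *)
Let Pp_split s t v (A : (edge -> bool) -> Prop) : uniq (s ++ t) ->
  depends [set e | e \in s ++ t] A ->
  measurable ([set w : config_space | A w] `&` cylinder t v) /\
  Pp ([set w : config_space | A w] `&` cylinder t v) =
    (weight t v * bern s (fun w => ind A (over t v w)))%:E.
Proof.
elim: s t v => [|e s IHs] t v us dA /=.
  have [At|nAt] := pselect (A (over t v (fun=> false))).
    have -> : [set w : config_space | A w] `&` cylinder t v = cylinder t v.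
      apply/seteqP; split => [w []//|w wt]; split => //=.
      by apply: dA At => e /= et; rewrite /over et wt.
    split; first exact: measurable_cylinder.
    rewrite /ind asboolT// mulr1; exact: hPp.
  have -> : [set w : config_space | A w] `&` cylinder t v = set0.
    apply/seteqP; split => // w [/= Aw wt]; apply: nAt.
    by apply: dA Aw => e /= et; rewrite /over et wt.
  by split; [exact: measurable0|rewrite measure0 /ind asboolF// mulr0].
move: us => /= /andP [est us].
have [es et] : e \notin s /\ e \notin t by move: est; rewrite mem_cat negb_or => /andP.
have us' : uniq (s ++ e :: t).
  by rewrite -cat1s uniq_catCA /= est us.
have dA' : depends [set e' | e' \in s ++ e :: t] A.
  move=> w w' ww'; apply: dA => e' /=; rewrite inE mem_cat => h; apply: ww' => /=.
  by rewrite mem_cat inE orbCA.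
have part b : measurable ([set w : config_space | A w] `&` cylinder (e :: t) (set_edge e b v)) /\
  Pp ([set w : config_space | A w] `&` cylinder (e :: t) (set_edge e b v)) =
  ((if b then p else 1 - p) * (weight t v * bern s (fun w => ind A (over t v (set_edge e b w)))))%:E.
  have [m ->] := IHs (e :: t) (set_edge e b v) us' dA'; split => //; congr EFin.
  rewrite /weight big_cons /set_edge eqxx mulrA; congr (_ * _).
    congr (_ * _); rewrite big_seq [RHS]big_seq; apply: eq_bigr => e' e't.
    by case: eqP => // ee; rewrite -ee e't in et.
  apply: eq_bern => w; congr ind; apply/funext => e'; rewrite /over inE.
  by case: (eqVneq e' e) => [->|_] //=; rewrite (negbTE et).
have split2 : [set w : config_space | A w] `&` cylinder t v =
    ([set w : config_space | A w] `&` cylinder (e :: t) (set_edge e true v)) `|`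
    ([set w : config_space | A w] `&` cylinder (e :: t) (set_edge e false v)).
  have sub b : cylinder (e :: t) (set_edge e b v) `<=` cylinder t v.
    move=> w h e' e't; rewrite h ?inE ?e't ?orbT// /set_edge.
    by case: eqP => // ee; rewrite -ee e't in et.
  apply/seteqP; split => w; last by case=> -[Aw /sub].
  move=> [Aw wt].
  have h : cylinder (e :: t) (set_edge e (w e) v) w.
    move=> e'; rewrite inE /set_edge; case: eqP => [->//|_ /= e't]; exact: wt.
  by case: (w e) h => h; [left|right].
have [m1 e1] := part true; have [m0 e0] := part false.
rewrite split2; split; first exact: measurableU.
apply: etrans (measureU _ m1 m0 _) _; last first.
  apply: etrans (f_equal2 (fun a b => a + b)%E e1 e0) _.
  by rewrite -EFinD; congr EFin; ring.
apply/seteqP; split => // w [[_ h1] [_ h0]].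
have := h1 e (mem_head _ _); rewrite (h0 e (mem_head _ _)) /set_edge eqxx.
by [].
Qed.

Lemma Pp_bern s (A : (edge -> bool) -> Prop) : uniq s ->
  depends [set e | e \in s] A ->
  measurable [set w : config_space | A w] /\
  Pp [set w : config_space | A w] = (bern s (ind A))%:E.
Proof.
move=> us dA; have := @Pp_split s [::] (fun=> true) A; rewrite cats0 => /(_ us dA).
have -> : cylinder [::] (fun=> true) = setT by apply/seteqP; split.
by rewrite setIT /weight big_nil mul1r => -[].
Qed.

Lemma Pp_indep (s : seq edge) (X Y : set edge) (A B : (edge -> bool) -> Prop) :
  uniq s -> X `<=` [set e | e \in s] -> Y `<=` [set e | e \in s] ->
  depends X A -> depends Y B -> X `&` Y = set0 ->
  Pp [set w : config_space | A w /\ B w] =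
  (Pp [set w : config_space | A w] * Pp [set w : config_space | B w])%E.
Proof.
move=> us Xs Ys dA dB XY.
have dA' : depends [set e | e \in s] A by move=> w w' h; apply: dA => e /Xs /h.
have dB' : depends [set e | e \in s] B by move=> w w' h; apply: dB => e /Ys /h.
have dAB : depends [set e | e \in s] (fun w => A w /\ B w).
  by move=> w w' h [/dA' ? /dB' ?]; split; auto.
have [_ ->] := Pp_bern us dAB; have [_ ->] := Pp_bern us dA'; have [_ ->] := Pp_bern us dB'.
rewrite -EFinM; congr EFin; rewrite -(bern_indep s (depends_ind dA) (depends_ind dB) XY).
by apply: eq_bern => w; rewrite /ind asbool_and -mulnb natrM.
Qed.

End FiniteBernoulli.

(** * Balls for the graph distance and events local to them *)

Section Balls.

Definition box (r : nat) : seq Z2 :=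
  [seq z <- [seq (i%:Z - r%:Z, j%:Z - r%:Z) | i <- iota 0 (2 * r + 1), j <- iota 0 (2 * r + 1)]
   | (nrm z <= r)%N].

Lemma mem_box r z : (z \in box r) = (nrm z <= r)%N.
Proof.
rewrite mem_filter andb_idr// => zr; case: z zr => a b; rewrite /nrm /= => zr.
apply/allpairsP; exists (absz (a + r%:Z), absz (b + r%:Z)); split => /=.
- by rewrite mem_iota; lia.
- by rewrite mem_iota; lia.
- by congr pair; lia.
Qed.

Lemma box_uniq r : uniq (box r).
Proof.
apply: filter_uniq; apply: allpairs_uniq; rewrite ?iota_uniq//.
by move=> [a b] [c e] _ _ /= [h1 h2]; congr pair; lia.
Qed.

Lemma size_box r : (size (box r) <= (2 * r + 1) ^ 2)%N.
Proof.
rewrite size_filter; apply: leq_trans (count_size _ _) _.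
by rewrite size_allpairs !size_iota.
Qed.

Definition ball2 (x : Z2) (r : nat) : set Z2 := [set z | nrm (z - x)%R <= r]%N.

Definition edges_in (D : set Z2) : set edge :=
  [set e | D (endpoints e).1 /\ D (endpoints e).2].

Definition box_edges (r : nat) : seq edge := [seq (x, b) | x <- box r, b <- [:: true; false]].

Lemma box_edges_uniq r : uniq (box_edges r).
Proof. by apply: allpairs_uniq; rewrite ?box_uniq// => -[a b] [c e]. Qed.

Lemma edges_in_box (D : set Z2) r : D `<=` ball2 0 r ->
  edges_in D `<=` [set e | e \in box_edges r].
Proof.
move=> Dr [x b] [/= /Dr]; rewrite /ball2 /= subr0 => xr _.
by apply/allpairsP; exists (x, b); split; rewrite ?mem_box// !inE; case: b.
Qed.

Lemma open_step_agree (X : set edge) (w w' : edge -> bool) x y :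
  (forall e, endpoints e = (x, y) \/ endpoints e = (y, x) -> X e) ->
  (forall e, X e -> w e = w' e) -> open_step w x y -> open_step w' x y.
Proof.
move=> hX ww' /open_stepP [e we h]; apply/open_stepP; exists e => //.
by rewrite -ww'//; apply: hX; case: h => ->; [left|right].
Qed.

Lemma depends_conn D x y : depends (edges_in D) (fun w => conn_in D w x y).
Proof.
move=> w w' ww' [s [ps ls sD]]; exists s; split => //.
elim: s x ps {ls} sD => //= u s IHs x /andP [xu ps] sD.
have Dx : D x by apply: sD; rewrite mem_head.
have Du : D u by apply: sD; rewrite !inE eqxx orbT.
rewrite (open_step_agree _ ww' xu) ?IHs//.
  by move=> z zs; apply: sD; rewrite inE zs orbT.
by move=> e [he|he]; split; rewrite he.
Qed.

Definition reach (D : set Z2) (w : edge -> bool) (y : Z2) (k : nat) : Prop :=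
  exists z, (k <= nrm (z - y)%R)%N /\ conn_in D w y z.

(** Each open step changes the distance to [y] by at most 1, so a path that gets far can be stopped
    at its first vertex at distance exactly [k]. The event is thereby determined by the edges in a
    ball. *)
Lemma reach_local D w y k : reach D w y k <->
  exists z, nrm (z - y) = k /\ conn_in (D `&` ball2 y k) w y z.
Proof.
split=> [[z [kz [s [ps ls sD]]]]|[z [zk c]]]; last first.
  by exists z; rewrite zk; split => //; apply: conn_sub c; exact: subIsetl.
suff [//|[_]] : (exists z, nrm (z - y) = k /\ conn_in (D `&` ball2 y k) w y z) \/
    (conn_in (D `&` ball2 y k) w y (last y s) /\ (nrm (last y s - y)%R < k)%N).
  by rewrite ls ltnNge kz.
elim/last_ind: s ps sD {z kz ls} => [|s u IHs] ps sD /=.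
  have Dy : (D `&` ball2 y k) y.
    by split; [apply: sD; rewrite mem_head|rewrite /ball2 /= subrr].
  have [k0|k0] := posnP k; last by right; rewrite subrr; split => //; exact: conn_refl.
  by left; exists y; rewrite subrr k0; split => //; apply: conn_refl; rewrite -k0.
move: ps; rewrite rcons_path => /andP [ps su].
have [|h|[c lk]] := IHs ps; [|by left|].
  by move=> z zs; apply: sD; rewrite -rcons_cons mem_rcons inE zs orbT.
have uk : (nrm (u - y)%R <= k)%N by apply: leq_trans (open_step_near _ su) _.
have Du : (D `&` ball2 y k) u.
  by split => //; apply: sD; rewrite -rcons_cons mem_rcons mem_head.
have [_ Dl] := conn_dom c.
have cu : conn_in (D `&` ball2 y k) w y u.
  by apply: conn_trans c _; apply: conn_step.
rewrite last_rcons; move: uk; rewrite leq_eqVlt => /orP [/eqP uk|uk].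
  by left; exists u.
by right.
Qed.

Lemma depends_reach D y k : depends (edges_in (D `&` ball2 y k)) (fun w => reach D w y k).
Proof.
move=> w w' ww' /reach_local [z [zk c]]; apply/reach_local; exists z; split => //.
exact: depends_conn c.
Qed.

Lemma measurable_reach D y k : measurable [set w : config_space | reach D w y k].
Proof.
by apply: measurable_exists => z; apply: measurable_and;
  [exact: measurable_prop|exact: measurable_conn].
Qed.

(* A path from 0 to a far point leaves the cluster of 0 inside the ball for the last
   time through an edge (x, y) crossing the sphere; after it the path avoids that
   cluster, hence uses edges that do not influence it. *)
Lemma reach_crossing w m k : reach setT w 0 (m.+1 + k) ->
  let C : set Z2 := [set x | conn_in (ball2 0 m) w 0 x] in
  exists x y, [/\ C x, nrm (y - x) = 1%N, nrm y = m.+1 & reach (~` C) w y k].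
Proof.
move=> [z [zk [s [ps ls _]]]] C.
have key a : path (open_step w) a s -> 
  [\/ forall v, v \in a :: s -> ~ C v, C (last a s) |
   exists x y s2, [/\ C x, open_step w x y, path (open_step w) y s2,
     last y s2 = last a s & forall v, v \in y :: s2 -> ~ C v]].
  elim: s a {ps ls} => [|u s IHs] a /=.
    move=> _; have [Ca|nCa] := pselect (C a); first by apply: Or32.
    by apply: Or31 => v; rewrite inE => /eqP ->.
  move=> /andP [au ps]; case: (IHs u ps) => [nC|Cl|h]; [|by apply: Or32|by apply: Or33].
  have [Ca|nCa] := pselect (C a).
    by apply: Or33; exists a, u, s.
  by apply: Or31 => v; rewrite inE => /orP [/eqP ->|/nC].
have C0 : C 0 by apply: conn_refl; rewrite /ball2 /= subrr.
have Cm x : C x -> (nrm x <= m)%N by move=> Cx; have [_] := conn_dom (Cx : conn_in _ _ _ _); rewrite /ball2 /= subr0.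
have := key 0 ps; rewrite ls => -[h|h|[x [y [s2 [Cx xy ps2 ls2 h2]]]]].
- by case: (h 0); rewrite ?mem_head.
- by have := Cm _ h; move: zk; rewrite subr0; lia.
exists x, y; have xy1 := open_step_nrm xy; have xm := Cm _ Cx.
have ym : (nrm y <= m.+1)%N.
  by have := open_step_near 0 xy; rewrite !subr0 => /leq_trans; apply; rewrite ltnS.
have ym' : nrm y = m.+1.
  apply/eqP; rewrite eqn_leq ym /= ltnNge; apply/negP => ym2.
  apply: (h2 y); rewrite ?mem_head//; apply: conn_trans Cx _.
  apply: conn_step => //; first by rewrite /ball2 /= subr0.
  by rewrite /ball2 /= subr0.
split => //; exists z; split; last by exists s2.
have := nrm_triangle (z - y) y; rewrite subrK ym'.
by move: zk; rewrite subr0; lia.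
Qed.

End Balls.

(** * Exponential decay and moments of the cluster size *)

Section FiniteSums.
Variable R : realType.

Lemma ler_sum_mem (T : eqType) (r : seq T) (f : T -> R) (x : T) :
  (forall y, 0 <= f y) -> x \in r -> f x <= \sum_(y <- r) f y.
Proof.
move=> f0; elim: r => [//|y r IHr]; rewrite inE big_cons => /orP [/eqP <-|/IHr h].
  by rewrite lerDl sumr_ge0.
by rewrite ler_wpDl.
Qed.

Lemma sum_supp (T : eqType) (r r' : seq T) (f : T -> R) :
  uniq r -> uniq r' -> {subset r <= r'} -> (forall x, x \notin r -> f x = 0) ->
  \sum_(x <- r) f x = \sum_(x <- r') f x.
Proof.
move=> ur ur' rr' f0; rewrite [RHS](bigID (fun x => x \in r)) /=.
rewrite [X in _ + X]big1 ?addr0; last by move=> x /f0.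
rewrite -[RHS]big_filter; apply: perm_big; apply: uniq_perm => //.
  exact: filter_uniq.
by move=> x; rewrite mem_filter; case: (boolP (x \in r)) => //= /rr' ->.
Qed.

(** Enumerates the possible values of the cluster explored in a ball. *)
Fixpoint sublists (T : Type) (l : seq T) : seq (seq T) :=
  if l is x :: l' then sublists l' ++ [seq x :: m | m <- sublists l'] else [:: [::]].

Lemma filter_sublists (T : eqType) (a : pred T) (l : seq T) :
  seq.filter a l \in sublists l.
Proof.
elim: l => //= x l IHl; rewrite mem_cat; case: (a x); last by rewrite IHl.
by rewrite map_f ?orbT.
Qed.

End FiniteSums.

Section Decay.
Variables (R : realType) (p : R) (Pp : probability config_space R).
Hypothesis hPp : bernoulli_percolation_law p Pp.

Definition pr (A : (edge -> bool) -> Prop) : R := fine (Pp [set w : config_space | A w]).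

Lemma prE A : measurable [set w : config_space | A w] ->
  Pp [set w : config_space | A w] = (pr A)%:E.
Proof. by move=> mA; rewrite /pr fineK// fin_num_measure. Qed.

Lemma pr_ge0 A : 0 <= pr A.
Proof. by rewrite /pr fine_ge0. Qed.

Lemma pr_le1 A : measurable [set w : config_space | A w] -> pr A <= 1.
Proof. by move=> mA; rewrite -lee_fin -prE// probability_le1. Qed.

Lemma pr_le A B : measurable [set w : config_space | A w] ->
  measurable [set w : config_space | B w] -> (forall w, A w -> B w) -> pr A <= pr B.
Proof.
by move=> mA mB AB; rewrite -lee_fin -!prE//; apply: le_measure; rewrite ?inE.
Qed.

Lemma eq_pr A B : (forall w, A w <-> B w) -> pr A = pr B.
Proof.
move=> AB; rewrite /pr; congr (fine (Pp _)).
by apply/seteqP; split => w /=; apply AB.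
Qed.

Lemma pr_true A : (forall w, A w) -> pr A = 1.
Proof.
move=> hA; rewrite /pr (_ : [set w | _] = setT) ?probability_setT//.
by apply/seteqP; split => // w _; exact: hA.
Qed.

Lemma pr_false A : (forall w, ~ A w) -> pr A = 0.
Proof.
move=> nA; rewrite /pr (_ : [set w | _] = set0) ?measure0//.
by apply/seteqP; split => // w /nA.
Qed.

Lemma prD A B : measurable [set w : config_space | A w] ->
  measurable [set w : config_space | B w] ->
  pr A + pr B = pr (fun w => A w \/ B w) + pr (fun w => A w /\ B w).
Proof.
move=> mA mB; apply: EFin_inj; rewrite !EFinD -!prE; try by [|exact: measurable_or|exact: measurable_and].
have -> : [set w : config_space | A w \/ B w] = [set w | A w] `|` [set w | B w] by [].
have -> : [set w : config_space | A w /\ B w] = [set w | A w] `&` [set w | B w] by [].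
set X := [set w | A w] in mA *; set Y := [set w | B w] in mB *.
have mYX : measurable (Y `\` X) by exact: measurableD.
have -> : X `|` Y = X `|` (Y `\` X) by rewrite setDE setUIr setUCr setIT.
rewrite measureU//; last by rewrite setDE setICA setICr setI0.
by rewrite -addeA [X in (_ + X)%E](measureDI Pp mB mA) setIC.
Qed.

Lemma pr_translate x A : measurable [set w : config_space | A w] ->
  pr (fun w => A (tr x w)) = pr A.
Proof.
move=> mA; rewrite /pr; congr fine.
exact: (translate_invariant hPp x mA).
Qed.

Lemma bernoulli_p01 : 0 <= p <= 1.
Proof.
pose e0 : edge := (0, true).
have h v : Pp (cylinder [:: e0] v) = (if v e0 then p else 1 - p)%:E.
  by apply: etrans (hPp v _) _; rewrite // big_seq1.
apply/andP; split.
  by rewrite -lee_fin -(h (fun=> true)).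
by rewrite -subr_ge0 -lee_fin -(h (fun=> false)).
Qed.

Definition tau (x : Z2) : R := pr (fun w => open_cluster w 0 x).

Definition theta (k : nat) : R := pr (fun w => reach setT w 0 k).

Lemma theta_translate y k : pr (fun w => reach setT w y k) = theta k.
Proof.
rewrite /theta -(pr_translate y (measurable_reach setT 0 k)); apply: eq_pr => w.
split=> -[z [kz c]].
  exists (z - y); split; first by rewrite subr0.
  by apply/conn_tr; rewrite add0r subrK; apply: conn_sub c.
exists (z + y); split; first by rewrite addrK -[z]subr0.
by move/conn_tr : c; rewrite add0r; apply: conn_sub.
Qed.

Lemma nrm1_dirs d : nrm d = 1%N -> d \in dirs.
Proof.
case: d => a b; rewrite /nrm !inE /= => h.
have [[-> ->]|[[-> ->]|[[-> ->]|[-> ->]]]] : (a = 1 /\ b = 0) \/ (a = -1 /\ b = 0) \/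
  (a = 0 /\ b = 1) \/ (a = 0 /\ b = -1) by lia.
all: by rewrite !xpair_eqE !eqxx ?orbT.
Qed.

Let local_cluster m (w : edge -> bool) : seq Z2 :=
  [seq x <- box m | `[< conn_in (ball2 0 m) w 0 x >]].

Let mem_local m w x : (x \in local_cluster m w) = `[< conn_in (ball2 0 m) w 0 x >].
Proof.
rewrite mem_filter andbC andb_idl// => /asboolP c.
by have [_] := conn_dom c; rewrite mem_box /ball2 /= subr0.
Qed.

Let touching m (D : seq Z2) : set edge := [set e | edges_in (ball2 0 m) e /\
  ((endpoints e).1 \in D \/ (endpoints e).2 \in D)].

(** Along a path from the origin in either configuration, each edge starts in [D], hence has the
    same state in both, and so ends in [D] again. Exploring the cluster thus reveals only edges
    touching [D], and the others remain independent of it. *)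
Let depends_local m D : depends (touching m D) (fun w => local_cluster m w = D).
Proof.
move=> w w' ww' wD.
have Cw a : conn_in (ball2 0 m) w 0 a <-> a \in D.
  by rewrite -wD mem_local; split => [c|/asboolP//]; apply/asboolP.
have B0 : ball2 0 m 0 by rewrite /ball2 /= subrr.
have agree a u : a \in D -> ball2 0 m a -> ball2 0 m u ->
    open_step w a u = open_step w' a u.
  move=> aD Ba Bu.
  have te e : endpoints e = (a, u) \/ endpoints e = (u, a) -> touching m D e.
    by case=> he; (split; [split|]); rewrite ?he//; [left|right].
  by apply/idP/idP; apply: (@open_step_agree (touching m D)) => // e /ww'.
have inD w1 s a : (w1 = w \/ w1 = w') -> a \in D -> path (open_step w1) a s ->
    (forall z, z \in a :: s -> ball2 0 m z) ->
    path (open_step w) a s /\ path (open_step w') a s.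
  move=> w1E; elim: s a => //= u s IHs a aD /andP [au ps] sB.
  have Ba : ball2 0 m a by apply: sB; rewrite mem_head.
  have Bu : ball2 0 m u by apply: sB; rewrite !inE eqxx orbT.
  have auw : open_step w a u by case: w1E au => ->; rewrite ?agree.
  have uD : u \in D.
    by apply/Cw; apply: conn_trans (_ : conn_in _ _ 0 a) _; [apply/Cw|apply: conn_step].
  rewrite auw -agree// auw /=; apply: IHs => // z zs.
  by apply: sB; rewrite inE zs orbT.
have D0 : 0 \in D by apply/Cw; exact: conn_refl.
rewrite -wD /local_cluster; apply: eq_filter => x; apply: asbool_equiv_eq.
split=> -[s [ps ls sB]]; exists s; split => //.
  by have [] := inD w' s 0 (or_intror erefl) D0 ps sB.
by have [] := inD w s 0 (or_introl erefl) D0 ps sB.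
Qed.

(** The event is split by the value [D] of the cluster of 0 in the ball, by the crossing site [x]
    and by the step [d] out of the ball. The rest of the path avoids [D], so it uses none of the
    edges that reveal [D] and the probabilities multiply. Summing over [D] gives at most [tau x];
    the factor 4 counts the directions. *)
Lemma theta_step m k : theta (m.+1 + k) <=
  4 * (\sum_(x <- box m) (nrm x == m)%:R * tau x) * theta k.
Proof.
have p01 := bernoulli_p01.
pose N := (m.+1 + k)%N; pose s := box_edges N; pose Ds := undup (sublists (box m)).
have us : uniq s by exact: box_edges_uniq.
have bernE X A : X `<=` [set e | e \in s] -> depends X A -> bern p s (ind R A) = pr A.
  move=> Xs dA; have dA' : depends [set e | e \in s] A by move=> w w' h; apply: dA => e /Xs /h.
  by have [_ e] := Pp_bern hPp us dA'; rewrite /pr e.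
have ballN y r : (nrm y + r <= N)%N -> ball2 y r `<=` ball2 0 N.
  move=> yr z; rewrite /ball2 /= subr0 => zy.
  have := nrm_triangle (z - y) y; rewrite subrK => /leq_trans; apply.
  by apply: leq_trans yr; rewrite addnC leq_add2l.
have edgeN D y r : (nrm y + r <= N)%N -> edges_in (D `&` ball2 y r) `<=` [set e | e \in s].
  by move=> yr; apply: edges_in_box; apply: subset_trans (ballN _ _ yr); exact: subIsetr.
have mN : (nrm (0 : Z2)%R + m <= N)%N by rewrite nrm0 /N; lia.
have edgem : edges_in (ball2 0 m) `<=` [set e | e \in s].
  by rewrite -[ball2 0 m]setTI; exact: edgeN.
pose A D x (w : edge -> bool) := local_cluster m w = D /\ x \in D.
pose B (D : seq Z2) y w := reach (~` [set z | z \in D]) w y k.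
have dA D x : depends (touching m D) (A D x).
  by move=> w w' ww' [h xD]; split => //; exact: depends_local ww' h.
have touchN D : touching m D `<=` [set e | e \in s] by move=> e [/edgem].
have dB D y : depends (edges_in (~` [set z | z \in D] `&` ball2 y k)) (B D y).
  exact: depends_reach.
have disj D y : touching m D `&` edges_in (~` [set z | z \in D] `&` ball2 y k) = set0.
  by apply/seteqP; split => // e [[_ [h|h]] [[h1 _] [h2 _]]]; [apply: h1|apply: h2].
pose T D x d w := ind R (A D x) w * ind R (B D (x + d)) w *
  ((nrm x == m) && (nrm (x + d) == m.+1))%:R.
have T0 D x d w : 0 <= T D x d w by rewrite !mulr_ge0.
have -> : theta N = bern p s (ind R (fun w => reach setT w 0 N)).
  rewrite (bernE (edges_in (setT `&` ball2 0 N)))//; last exact: depends_reach.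
  by apply: edgeN; rewrite nrm0.
apply: (@le_trans _ _ (bern p s (fun w => \sum_(D <- Ds) \sum_(x <- box m) \sum_(d <- dirs) T D x d w))).
  apply: ler_bern => // w; rewrite {1}/ind; case: asboolP => [h|_]; last first.
    by do 3 (apply: sumr_ge0 => ? _).
  have [x [y [Cx xy ym ry]]] := reach_crossing h.
  pose D := local_cluster m w.
  have DE : [set z | z \in D] = [set x | conn_in (ball2 0 m) w 0 x].
    by apply/seteqP; split => z /=; rewrite mem_local => /asboolP.
  have xb : (nrm x <= m)%N by have [_] := conn_dom (Cx : conn_in _ _ _ _); rewrite /ball2 /= subr0.
  have xm : nrm x = m.
    by have := nrm_triangle (y - x) x; rewrite subrK xy ym; lia.
  apply: (@le_trans _ _ (T D x (y - x) w)).
    rewrite /T /ind addrC subrK xm ym !eqxx !asboolT ?mulr1//.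
      by rewrite /B DE.
    by split => //; rewrite /D mem_local; apply/asboolP.
  apply: le_trans (_ : \sum_(x <- box m) \sum_(d <- dirs) T D x d w <= _); last first.
    apply: (@ler_sum_mem _ _ Ds (fun D => \sum_(x <- box m) \sum_(d <- dirs) T D x d w)).
      by move=> D'; do 2 (apply: sumr_ge0 => ? _).
    by rewrite mem_undup filter_sublists.
  apply: le_trans (_ : \sum_(d <- dirs) T D x d w <= _); last first.
    apply: (@ler_sum_mem _ _ (box m) (fun x => \sum_(d <- dirs) T D x d w)).
      by move=> D'; apply: sumr_ge0 => ? _.
    by rewrite mem_box.
  apply: (@ler_sum_mem _ _ dirs (fun d => T D x d w)) => //.
  exact: nrm1_dirs.
rewrite bern_sum; under eq_bigr do rewrite bern_sum.
rewrite exchange_big /= mulr_sumr mulr_suml; apply: ler_sum => x _.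
under eq_bigr do rewrite bern_sum.
apply: (@le_trans _ _ (\sum_(D <- Ds) \sum_(d <- dirs) bern p s (ind R (A D x)) * ((nrm x == m)%:R * theta k))).
  apply: ler_sum => D _; apply: ler_sum => d _.
  have -> : bern p s (T D x d) = bern p s (ind R (A D x)) * bern p s (ind R (B D (x + d))) *
      ((nrm x == m) && (nrm (x + d) == m.+1))%:R.
    rewrite -(bern_indep p s (depends_ind R (dA D x)) (depends_ind R (dB D _)) (disj D _)).
    set c := _%:R; rewrite -[c in RHS](bern_cst p s).
    rewrite -(@bern_indep _ p s setT set0) ?setI0//.
    by move=> w w' ww'; have -> : w = w' by apply/funext => e; exact: ww'.
  rewrite -mulrA ler_wpM2l ?bern_ge0//.
  case: eqP => [xm|_] /=; last by rewrite mulr0 mul0r.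
  case: eqP => [xdm|_] /=; last by rewrite mulr0 mul1r pr_ge0.
  rewrite mulr1 mul1r (bernE _ _ _ (dB D (x + d))); last first.
    by apply: edgeN; rewrite xdm.
  rewrite -(theta_translate (x + d)); apply: pr_le; [exact: measurable_reach|exact: measurable_reach|].
  by move=> w [z [kz c]]; exists z; split => //; apply: conn_sub c.
have -> : \sum_(D <- Ds) \sum_(d <- dirs) bern p s (ind R (A D x)) * ((nrm x == m)%:R * theta k) =
    (\sum_(D <- Ds) bern p s (ind R (A D x))) * (4 * (nrm x == m)%:R * theta k).
  rewrite mulr_suml; apply: eq_bigr => D _.
  by rewrite /dirs !big_cons big_nil; ring.
have -> : 4 * ((nrm x == m)%:R * tau x) * theta k = tau x * (4 * (nrm x == m)%:R * theta k).
  by ring.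
rewrite ler_wpM2r// ?mulr_ge0 ?pr_ge0//.
have dc : depends (edges_in (ball2 0 m)) (fun w => conn_in (ball2 0 m) w 0 x) by exact: depends_conn.
apply: (@le_trans _ _ (pr (fun w => conn_in (ball2 0 m) w 0 x))); last first.
  apply: pr_le; [exact: measurable_conn|exact: measurable_open_cluster|].
  by move=> w c; apply/open_clusterE; apply: conn_sub c.
rewrite -(bernE _ _ edgem dc) -bern_sum; apply: ler_bern => // w.
rewrite (bigD1_seq (local_cluster m w)) ?undup_uniq//=; last first.
  by rewrite mem_undup filter_sublists.
rewrite big1 => [|D DC].
  rewrite addr0 /ind ler_nat /A; case: asboolP => // -[_ xC].
  by rewrite asboolT//; move: xC; rewrite mem_local => /asboolP.
by rewrite /ind asboolF// => -[DE _]; rewrite DE eqxx in DC.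
Qed.

Hypothesis finite_mean : exists chi : R,
  forall Z : seq Z2, uniq Z -> \sum_(z <- Z) tau z <= chi.

Lemma tau_ge0 x : 0 <= tau x.
Proof. exact: pr_ge0. Qed.

(** The spheres are disjoint: if each carried more than [e], then [M] of them with $M>\chi/e$ would
    exceed the total mass $\chi$. *)
Lemma sphere_small (e : R) : 0 < e ->
  exists m, \sum_(x <- box m) (nrm x == m)%:R * tau x <= e.
Proof.
move=> e0; have [chi Hchi] := finite_mean.
apply: contrapT => /forallNP h.
have chi0 : 0 <= chi by have := Hchi [::] isT; rewrite big_nil.
pose M := Num.bound (chi / e).
have : chi / e < M%:R by apply: archi_boundP; rewrite divr_ge0// ltW.
rewrite ltr_pdivrMr// ltNge => /negP; apply.
apply: le_trans (Hchi _ (box_uniq M)).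
apply: (@le_trans _ _ (\sum_(m < M) \sum_(x <- box M) (nrm x == m)%:R * tau x)).
  have -> : M%:R * e = \sum_(m < M) e by rewrite sumr_const card_ord mulr_natl.
  apply: ler_sum => m _; have /negP := h m; rewrite -ltNge => /ltW /le_trans; apply.
  rewrite le_eqVlt; apply/orP; left; apply/eqP; apply: sum_supp; rewrite ?box_uniq//.
    by move=> x; rewrite !mem_box => /leq_trans; apply; rewrite ltnW.
  by move=> x; rewrite mem_box -ltnNge; case: eqP => [->|_ _]; rewrite ?ltnn ?mul0r.
rewrite exchange_big /=; apply: ler_sum => x _; rewrite -mulr_suml.
rewrite ler_piMl ?tau_ge0//.
have [xM|Mx] := ltnP (nrm x) M.
  rewrite (bigD1 (Ordinal xM)) //= eqxx big1 ?addr0// => i ix.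
  by case: eqP => // xi; move: ix; rewrite -val_eqE /= xi eqxx.
rewrite big1 // => i _; case: eqP => // xi.
by move: Mx; rewrite xi leqNgt ltn_ord.
Qed.

(** With a sphere of mass at most [e / 4], each further distance [m.+1] costs a factor [e] by
    [theta_step]. *)
Lemma theta_decay (e : R) : 0 < e ->
  exists M : nat, (0 < M)%N /\ forall j, theta (M * j) <= e ^+ j.
Proof.
move=> e0; have e4 : 0 < e / 4 by rewrite divr_gt0.
have [m Hm] := sphere_small e4.
exists m.+1; split => //; elim=> [|j IHj].
  by rewrite muln0 expr0 pr_le1//; exact: measurable_reach.
rewrite mulnS; apply: le_trans (theta_step _ _) _.
rewrite exprS ler_pM ?pr_ge0 ?mulr_ge0 ?sumr_ge0// => [x _|].
  by rewrite mulr_ge0 ?tau_ge0.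
by move: Hm; rewrite ler_pdivlMr// mulrC.
Qed.

End Decay.

Section EnnPowers.
Local Open Scope ereal_scope.

Lemma lee_expe (R : realType) (x y : \bar R) n : 0 <= x -> x <= y -> x ^+ n <= y ^+ n.
Proof.
move=> x0 xy; elim: n => [|n IHn]; first by rewrite !expe0.
by rewrite !expeS lee_pmul// expe_ge0.
Qed.

Lemma expe_pinfty (R : realType) n : (+oo : \bar R) ^+ n.+1 = +oo.
Proof.
elim: n => [|n IHn]; first by rewrite expeS expe0 mule1.
by rewrite expeS IHn mulyy.
Qed.

Lemma measurable_expe d (T : measurableType d) (R : realType) (f : T -> \bar R) n :
  measurable_fun setT f -> measurable_fun setT (fun x => f x ^+ n).
Proof.
move=> mf; elim: n => [|n IHn].
  by under eq_fun do rewrite expe0; exact: measurable_cst.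
by under eq_fun do rewrite expeS; exact: emeasurable_funM.
Qed.

(** The factor may be infinite, as it is for powers of the size of an infinite cluster. *)
Lemma csumZl_ge0 (R : realType) (T : countType) (c : \bar R) (f : T -> \bar R) :
  0 <= c -> (forall x, 0 <= f x) -> csum (fun x => c * f x) = c * csum f.
Proof.
move=> c0 f0; case: c c0 => [c||] // c0; first by rewrite csumZl.
have [f_eq0|/existsNP [x fx]] := pselect (forall x, f x = 0).
  have -> : f = (fun=> 0) by apply/funext.
  have z0 : csum (fun _ : T => 0 : \bar R) = 0.
    by rewrite /csum eseries0// => k _ _; case: pickle_inv.
  by rewrite (eq_csum (g := fun=> 0)) ?z0 ?mule0// => y; rewrite mule0.
have fx0 : 0 < f x by rewrite lt0e f0 andbT; apply/eqP.
have cf0 : 0 < csum f.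
  by apply: lt_le_trans fx0 _; have := csum_ge f0 (_ : uniq [:: x]); rewrite big_seq1; apply.
rewrite (gt0_mulye cf0); apply/eqP; rewrite eq_le leey /=.
have := @csum_ge R T (fun y => +oo * f y) [:: x] _ isT.
by rewrite big_seq1 gt0_mulye//; apply => y; rewrite mule_ge0.
Qed.

Lemma csum_mul (R : realType) (T : countType) (f g : T -> \bar R) :
  (forall x, 0 <= f x) -> (forall x, 0 <= g x) ->
  csum f * csum g = csum (fun x => csum (fun y => f x * g y)).
Proof.
move=> f0 g0; rewrite muleC -csumZl_ge0 ?csum_ge0//.
by apply: eq_csum => x; rewrite csumZl_ge0// muleC.
Qed.

End EnnPowers.

Section RealPowers.

(** Chebyshev's sum inequality, $\sum_{x,y}(a_x-a_y)(a_x^{k+1}-a_y^{k+1})\ge0$, drives the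
    induction. *)
Lemma power_mean (R : realDomainType) (T : Type) (l : seq T) (a : T -> R) k :
  (forall x, 0 <= a x) ->
  (\sum_(x <- l) a x) ^+ k.+1 <= (size l)%:R ^+ k * \sum_(x <- l) a x ^+ k.+1.
Proof.
move=> a0; elim: k => [|k IHk]; first by rewrite expr0 mul1r expr1; under [leRHS]eq_bigr do rewrite expr1.
have S0 : 0 <= \sum_(x <- l) a x by apply: sumr_ge0.
rewrite exprS; apply: le_trans (ler_wpM2l S0 IHk) _.
rewrite mulrCA exprSr -mulrA ler_wpM2l ?exprn_ge0//.
have Cheb : 0 <= \sum_(x <- l) \sum_(y <- l) (a x - a y) * (a x ^+ k.+1 - a y ^+ k.+1).
  apply: sumr_ge0 => x _; apply: sumr_ge0 => y _.
  have [xy|yx] := leP (a x) (a y).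
    by rewrite mulr_le0// subr_le0// lerXn2r// nnegrE.
  apply: mulr_ge0; rewrite subr_ge0; first exact: ltW.
  by rewrite lerXn2r ?nnegrE// ltW.
have E : \sum_(x <- l) \sum_(y <- l) (a x - a y) * (a x ^+ k.+1 - a y ^+ k.+1) =
   2 * ((size l)%:R * \sum_(x <- l) a x ^+ k.+2) -
   2 * ((\sum_(x <- l) a x) * (\sum_(x <- l) a x ^+ k.+1)).
  have e1 x y : (a x - a y) * (a x ^+ k.+1 - a y ^+ k.+1) =
     (a x ^+ k.+2 + a y ^+ k.+2) - (a x * a y ^+ k.+1 + a y * a x ^+ k.+1).
    by rewrite [a x ^+ k.+2]exprS [a y ^+ k.+2]exprS; ring.
  under eq_bigr do under eq_bigr do rewrite e1.
  under eq_bigr do rewrite sumrB !big_split /=.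
  rewrite sumrB !big_split /=; congr (_ - _).
    have -> : \sum_(i <- l) \sum_(j <- l) a i ^+ k.+2 = (size l)%:R * \sum_(x <- l) a x ^+ k.+2.
      rewrite mulr_sumr; apply: eq_bigr => x _.
      by rewrite big_const_seq count_predT iter_addr_0 mulr_natl.
    have -> : \sum_(i <- l) \sum_(j <- l) a j ^+ k.+2 = (size l)%:R * \sum_(x <- l) a x ^+ k.+2.
      by rewrite big_const_seq count_predT iter_addr_0 mulr_natl.
    ring.
  have -> : \sum_(i <- l) \sum_(j <- l) a i * a j ^+ k.+1 =
      (\sum_(x <- l) a x) * \sum_(x <- l) a x ^+ k.+1.
    by rewrite mulr_suml; apply: eq_bigr => x _; rewrite mulr_sumr.
  have -> : \sum_(i <- l) \sum_(j <- l) a j * a i ^+ k.+1 =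
      (\sum_(x <- l) a x) * \sum_(x <- l) a x ^+ k.+1.
    by rewrite exchange_big mulr_suml; apply: eq_bigr => x _; rewrite mulr_sumr.
  ring.
by move: Cheb; rewrite E; lra.
Qed.

End RealPowers.

Section ClusterSize.
Variable R : realType.
Local Open Scope ereal_scope.
Implicit Types w : edge -> bool.

Definition cluster_size w (x : Z2) : \bar R := counting (open_cluster w x).

Lemma cluster_sizeE w x : cluster_size w x = csum (fun y => (ind R (fun w => open_cluster w x y) w)%:E).
Proof. exact: counting_csum. Qed.

Lemma cluster_size_ge0 w x : 0 <= cluster_size w x.
Proof. by rewrite cluster_sizeE csum_ge0// => y; rewrite lee_fin. Qed.

Lemma cluster_size_cases w x : cluster_size w x = +oo \/
  exists l : seq Z2, [/\ uniq l, forall y, (y \in l) <-> open_cluster w x y &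
    cluster_size w x = (size l)%:R%:E].
Proof.
rewrite /cluster_size /counting; case: asboolP => finX; last by left.
right; exists (finmap.enum_fset (fset_set (open_cluster w x))); split => //.
  exact: finmap.fset_uniq.
by move=> y; rewrite in_fset_set// inE.
Qed.

Lemma open_cluster_sym w x y : open_cluster w x y -> open_cluster w y x.
Proof. by move=> /open_clusterE c; apply/open_clusterE; exact: conn_sym. Qed.

Lemma open_cluster_trans w x y z : open_cluster w x y -> open_cluster w y z -> open_cluster w x z.
Proof. by move=> /open_clusterE c /open_clusterE c'; apply/open_clusterE; exact: conn_trans c c'. Qed.

Lemma open_cluster_refl w x : open_cluster w x x.
Proof. by apply/open_clusterE; exact: conn_refl. Qed.

Lemma cluster_size_eq w x y : open_cluster w x y -> cluster_size w x = cluster_size w y.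
Proof.
move=> xy; rewrite /cluster_size; congr counting; apply/seteqP; split => z.
  exact: open_cluster_trans (open_cluster_sym xy).
exact: open_cluster_trans xy.
Qed.

Lemma cluster_size_tr x w y : cluster_size (tr x w) y = cluster_size w (y + x)%R.
Proof.
rewrite !cluster_sizeE -[RHS](@csum_bij _ _ (fun z : Z2 => z + x)%R (fun z : Z2 => z - x)%R).
- apply: eq_csum => z /=; rewrite /ind; congr (_%:R%:E); congr nat_of_bool.
  by apply: asbool_equiv_eq; exact: open_cluster_tr.
- by move=> z; rewrite addrK.
- by move=> z; rewrite subrK.
- by move=> z; rewrite lee_fin.
Qed.

Lemma measurable_indE (A : (edge -> bool) -> Prop) : measurable [set w : config_space | A w] ->
  measurable_fun setT (fun w : config_space => (ind R A w)%:E).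
Proof.
move=> mA; apply/measurable_EFinP.
have -> : ind R A = \1_[set w : config_space | A w].
  apply/funext => w; rewrite /ind indicE; congr (nat_of_bool _)%:R%R.
  by apply/asboolP/idP; rewrite inE.
Qed.

Lemma measurable_cluster_size x : measurable_fun setT (fun w : config_space => cluster_size w x).
Proof.
rewrite (_ : (fun w => _) = (fun w : config_space =>
  csum (fun y => (ind R (fun w => open_cluster w x y) w)%:E))); last first.
  by apply/funext => w; exact: cluster_sizeE.
apply: (@measurable_csum _ _ _ _ (fun y (w : config_space) => (ind R (fun w => open_cluster w x y) w)%:E)).
  by move=> y w; rewrite lee_fin.
by move=> y; apply: measurable_indE; exact: measurable_open_cluster.
Qed.

(* A path from x to z visits every distance 0, ..., nrm (z - x). *)
Lemma cluster_size_ge w x z : open_cluster w x z -> (nrm (z - x)%R).+1%:R%:E <= cluster_size w x.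
Proof.
case: (cluster_size_cases w x) => [->|[l [ul lP ->]]]; first by rewrite leey.
move=> xz; rewrite lee_fin ler_nat; set k := nrm _.
have H j : (j <= k)%N -> exists2 u, u \in l & nrm (u - x)%R = j.
  move=> jk; have : reach setT w x j by exists z; split => //; exact/open_clusterE.
  move=> /reach_local [u [uj c]]; exists u => //; apply/lP/open_clusterE.
  exact: conn_sub c.
have -> : k.+1 = size (iota 0 k.+1) by rewrite size_iota.
rewrite -(size_map (fun u => nrm (u - x)%R) l); apply: uniq_leq_size; first exact: iota_uniq.
move=> j; rewrite mem_iota add0n ltnS => /H [u ul' <-].
by apply/mapP; exists u.
Qed.

End ClusterSize.

Section Moments.
Variables (R : realType) (p : R) (Pp : probability config_space R).
Hypothesis hPp : bernoulli_percolation_law p Pp.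
Local Notation pr := (@pr R Pp).
Local Notation tau := (@tau R Pp).
Local Notation N0 := (fun w : config_space => cluster_size R w 0%R).

Lemma integral_ind (A : (edge -> bool) -> Prop) : measurable [set w : config_space | A w] ->
  (\int[Pp]_w (ind R A w)%:E = (pr A)%:E)%E.
Proof.
move=> mA; have -> : ind R A = \1_[set w : config_space | A w].
  apply/funext => w; rewrite /ind indicE; congr ((nat_of_bool _)%:R).
by rewrite integral_indic// setIT; exact: prE.
Qed.

Lemma ind_ge0 (A : (edge -> bool) -> Prop) w : (0 <= (ind R A w)%:E)%E.
Proof. by rewrite lee_fin. Qed.

Lemma integral_csum_ind (A : Z2 -> (edge -> bool) -> Prop) :
  (forall x, measurable [set w : config_space | A x w]) ->
  (\int[Pp]_w csum (fun x => (ind R (A x) w)%:E) = csum (fun x => (pr (A x))%:E))%E.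
Proof.
move=> mA; rewrite (@integral_csum _ _ _ _ (fun x (w : config_space) => (ind R (A x) w)%:E)).
- by apply: eq_csum => x; exact: integral_ind.
- by move=> x w; exact: ind_ge0.
- by move=> x; exact: measurable_indE.
Qed.

(** An infinite mean would put [p] in the set whose infimum is [p_T]; that [p] lies in $[0,1]$ is
    read off the law of one edge. *)
Lemma subcritical_mean : p < p_T R -> exists chi : R,
  forall Z : seq Z2, uniq Z -> \sum_(z <- Z) tau z <= chi.
Proof.
move=> ppT; have p01 := bernoulli_p01 hPp.
have e : (\int[Pp]_w cluster_size R w 0%R = csum (fun x => (tau x)%:E))%E.
  rewrite -(integral_csum_ind (A := fun x w => open_cluster w 0 x)).
    by apply: eq_integral => w _; exact: cluster_sizeE.
  by move=> x; exact: measurable_open_cluster.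
have t0 x : (0 <= (tau x)%:E)%E by rewrite lee_fin pr_ge0.
have fin : (csum (fun x => (tau x)%:E) < +oo)%E.
  rewrite ltey -e; apply/eqP => oo.
  move: ppT; rewrite ltNge => /negP; apply; apply: ge_inf.
    by exists 0 => x [/andP [x0 _] _].
  by split => //; exists Pp.
exists (fine (csum (fun x => (tau x)%:E))) => Z uZ.
rewrite -lee_fin fineK ?ge0_fin_numE ?csum_ge0// -sumEFin.
exact: csum_ge.
Qed.

Hypothesis finite_mean : exists chi : R,
  forall Z : seq Z2, uniq Z -> \sum_(z <- Z) tau z <= chi.

(** A cluster that reaches distance $Mj$ but stays within $M(j+1)$ has at most $(2M(j+1)+1)^2$
    sites, so the power of its size is at most the [j]-th term of a series weighted by reach
    events. *)
Lemma cluster_moment k : exists C : R, 0 <= C /\ (\int[Pp]_w N0 w ^+ k <= C%:E)%E.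
Proof.
(* Decay $2^{-(2k+1)}$ per block: by $j+1\le2^j$ the coefficients [c j] grow at most like $4^{kj}$,
   which leaves a geometric series of ratio $1/2$. *)
have e0 : 0 < (2^-1) ^+ (2 * k).+1 :> R by rewrite exprn_gt0.
have [M [M0 HM]] := theta_decay hPp finite_mean e0.
pose c (j : nat) : R := (((2 * (M * j.+1) + 1) ^ 2) ^ k)%N%:R.
pose g (j : nat) (w : config_space) : \bar R :=
  ((c j)%:E * (ind R (fun w => reach setT w 0%R (M * j)) w)%:E)%E.
have c1 j : 1 <= c j by rewrite /c ler1n !expn_gt0 addn1.
have g0 j w : (0 <= g j w)%E by rewrite mule_ge0 ?ind_ge0// lee_fin (le_trans ler01).
have mg j : measurable_fun setT (g j).
  apply: emeasurable_funM; first exact: measurable_cst.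
  by apply: measurable_indE; exact: measurable_reach.
exists (2 * (3 * M%:R) ^+ (2 * k)); split; first by rewrite mulr_ge0// exprn_ge0// mulr_ge0.
have pw w : (N0 w ^+ k <= \sum_(j <oo) g j w)%E.
  have [[J HJ]|/forallNP noJ] := pselect (exists J, forall y, open_cluster w 0 y -> (nrm y <= M * J)%N).
    have exJ : exists J, `[< forall y, open_cluster w 0 y -> (nrm y <= M * J)%N >].
      by exists J; apply/asboolP.
    case: (ex_minnP exJ) => {HJ}J /asboolP HJ minJ.
    have [l [ul lP lE]] : exists l : seq Z2, [/\ uniq l, forall y, (y \in l) <-> open_cluster w 0 y &
       cluster_size R w 0 = (size l)%:R%:E].
      case: (cluster_size_cases R w 0) => // oo; exfalso.
      have : (cluster_size R w 0%R <= (size (box (M * J)))%:R%:E)%E.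
        rewrite cluster_sizeE; apply: csum_le => [y|Z uZ]; first exact: ind_ge0.
        have -> : (\sum_(z <- Z) (ind R (fun w => open_cluster w 0 z) w)%:E)%E =
            (count (fun z => `[< open_cluster w 0 z >]) Z)%:R%:E.
          elim: Z {uZ} => [|z Z IHZ]; first by rewrite big_nil.
          by rewrite big_cons IHZ /= natrD EFinD.
        rewrite lee_fin ler_nat -size_filter; apply: uniq_leq_size.
          exact: filter_uniq.
        by move=> z; rewrite mem_filter mem_box => /andP [/asboolP /HJ].
      by rewrite oo.
    have lb r : (forall y, open_cluster w 0 y -> (nrm y <= r)%N) -> (size l <= (2 * r + 1) ^ 2)%N.
      move=> hr; apply: leq_trans (size_box r); apply: uniq_leq_size => // y /lP /hr.
      by rewrite mem_box.
    rewrite lE -EFin_expe -natrX.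
    have term j : reach setT w 0 (M * j) -> (size l <= (2 * (M * j.+1) + 1) ^ 2)%N ->
        (((size l) ^ k)%N%:R%:E <= \sum_(j <oo) g j w)%E.
      move=> rj lj; apply: (@le_trans _ _ (g j w)).
        rewrite /g /ind asboolT// mule1 lee_fin ler_nat.
        by case: (k) => [|k']; rewrite ?expn0// leq_exp2r.
      apply: le_trans (nneseries_lim_ge j.+1 _) => //.
      by rewrite big_nat_recr//= leeDr// sume_ge0.
    case: J HJ minJ => [|J] HJ minJ.
      apply: (term 0%N).
        by exists 0; rewrite muln0; split => //; exact: conn_refl.
      apply: lb => y /HJ; rewrite muln0 leqn0 => /eqP ->; exact: leq0n.
    apply: (term J); last exact: lb.
    apply: contrapT => nr; have := minJ J; rewrite ltnn => h.
    suff : false by []. 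
    apply: h; apply/asboolP => y y0; rewrite leqNgt; apply/negP => yJ; apply: nr.
    by exists y; rewrite subr0 ltnW//; split => //; exact/open_clusterE.
  have rj j : reach setT w 0 (M * j).
    have /existsNP [y /not_implyP [y0 /negP]] := noJ j; rewrite -ltnNge => yj.
    by exists y; rewrite subr0 ltnW//; split => //; exact/open_clusterE.
  (* An unbounded cluster reaches every distance, so all terms are at least 1 and the series is
     infinite. *)
  apply: le_trans (leey _) _; rewrite leye_eq; apply/eqP/eqyP => A A0.
  apply: le_trans (nneseries_lim_ge (Num.bound A) _) => //.
  apply: (@le_trans _ _ (\sum_(0 <= j < Num.bound A) 1%:E)%E).
    rewrite sumEFin lee_fin big_const_nat subn0 iter_addr_0.
    by rewrite ltW// archi_boundP// ltW.
  apply: lee_sum => j _; rewrite /g /ind asboolT// mule1 lee_fin; exact: c1.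
apply: (@le_trans _ _ (\int[Pp]_w \sum_(j <oo) g j w)%E).
  apply: ge0_le_integral => //.
  - by move=> w _; rewrite expe_ge0// cluster_size_ge0.
  - by apply: measurable_expe; exact: measurable_cluster_size.
  - exact: (@ge0_emeasurable_sum _ _ _ setT g xpredT).
rewrite integral_nneseries//.
apply: lime_le; first by apply: is_cvg_nneseries => j _ _; exact: integral_ge0.
apply: nearW => n.
have int_g j : (\int[Pp]_w g j w = (c j * theta Pp (M * j))%:E)%E.
  rewrite /g ge0_integralZl_EFin//.
  - by rewrite integral_ind ?EFinM//; exact: measurable_reach.
  - by move=> w _; exact: ind_ge0.
  - by apply: measurable_indE; exact: measurable_reach.
under eq_bigr do rewrite int_g.
rewrite sumEFin lee_fin.
pose B : R := (3 * M%:R) ^+ (2 * k).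
have B0 : 0 <= B by rewrite exprn_ge0// mulr_ge0.
apply: (@le_trans _ _ (\sum_(0 <= j < n) B * (2^-1) ^+ j)).
  apply: ler_sum => j _.
  have cj : c j <= B * (2 ^+ (2 * k)) ^+ j.
    rewrite /c /B -expnM natrX -[X in _ <= _ * X]exprM mulnC [X in _ <= _ * 2 ^+ X]mulnC.
    rewrite mulnC [X in _ <= _ * X](_ : _ = (2 ^+ j) ^+ (2 * k)); last first.
      by rewrite -!exprM mulnC.
    rewrite -exprMn lerXn2r ?nnegrE ?mulr_ge0 ?exprn_ge0//.
    rewrite -natrX -!natrM ler_nat.
    have : (j.+1 <= 2 ^ j)%N by exact: ltn_expl.
    by move: (2 ^ j)%N => t; nia.
  apply: (le_trans (ler_pM _ _ cj (HM j))).
  - exact: le_trans ler01 (c1 j).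
  - exact: pr_ge0.
  rewrite -mulrA ler_wpM2l// exprS exprMn mulrCA.
  rewrite -[X in _ * X](_ : 1 = _) ?mulr1//.
  by rewrite -exprMn -exprMn divff ?expr1n.
rewrite -mulr_sumr [leRHS]mulrC ler_wpM2l//.
have -> : \sum_(0 <= j < n) (2^-1 : R) ^+ j = 2 - 2 * 2^-1 ^+ n.
  elim: n => [|n IHn]; first by rewrite big_geq// expr0; ring.
  by rewrite big_nat_recr//= IHn exprS; field.
by rewrite gerBl mulr_ge0// exprn_ge0.
Qed.

End Moments.

(** * Unions of clusters *)

Section Interface.
Variables (R : realType) (p : R) (Pp : probability config_space R).
Hypothesis hPp : bernoulli_percolation_law p Pp.
Hypothesis finite_mean : exists chi : R,
  forall Z : seq Z2, uniq Z -> \sum_(z <- Z) @tau R Pp z <= chi.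
Local Notation pr := (@pr R Pp).
Local Notation tau := (@tau R Pp).
Local Notation N := (@cluster_size R).

Definition in_hull (w : edge -> bool) (A : seq Z2) (x : Z2) : Prop :=
  exists a, a \in A /\ open_cluster w a x.

Definition hull_size (w : edge -> bool) (A : seq Z2) : \bar R :=
  csum (fun x => (ind R (fun w => in_hull w A x) w)%:E).

Definition hull_pr (A : seq Z2) (x : Z2) : R := pr (fun w => in_hull w A x).

Definition mean_hull (A : seq Z2) : R := fine (csum (fun x => (hull_pr A x)%:E)).

Definition avoid_pr (z : Z2) (B : seq Z2) : R :=
  pr (fun w => open_cluster w 0 z /\ ~ in_hull w B 0).

Definition kappa (z : Z2) : R :=
  fine (csum (fun x => (pr (fun w => open_cluster w 0 x /\ open_cluster w z x))%:E)).

Local Notation K := hull_size.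
Local Notation h := hull_pr.
Local Notation F := mean_hull.
Local Notation D := avoid_pr.

Lemma measurable_in_hull A x : measurable [set w : config_space | in_hull w A x].
Proof.
apply: measurable_exists => a; apply: measurable_and; first exact: measurable_prop.
exact: measurable_open_cluster.
Qed.
Local Hint Resolve measurable_in_hull measurable_open_cluster : core.

Lemma measurable_avoid z B :
  measurable [set w : config_space | open_cluster w 0 z /\ ~ in_hull w B 0].
Proof. by apply: measurable_and => //; apply: measurable_not. Qed.

Lemma prU_avoid (A B : (edge -> bool) -> Prop) : measurable [set w : config_space | A w] ->
  measurable [set w : config_space | B w] ->
  pr (fun w => A w \/ B w) = pr B + pr (fun w => A w /\ ~ B w).
Proof.
move=> mA mB; have mAB : measurable [set w : config_space | A w /\ ~ B w].
  by apply: measurable_and => //; apply: measurable_not.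
rewrite (prD Pp mB mAB) [X in _ + X]pr_false ?addr0; last by tauto.
by apply: eq_pr => w; have [Bw|nBw] := pselect (B w); tauto.
Qed.

Lemma in_hull_cons w x B y : in_hull w (x :: B) y <-> open_cluster w x y \/ in_hull w B y.
Proof.
split=> [[a []]|[xy|[a [aB ay]]]].
- by rewrite inE => /orP [/eqP ->|aB] ay; [left|right; exists a].
- by exists x; rewrite mem_head.
- by exists a; rewrite inE aB orbT.
Qed.

Lemma in_hull_cat w A B y : in_hull w (A ++ B) y <-> in_hull w A y \/ in_hull w B y.
Proof.
split=> [[a []]|[[a [aA ay]]|[a [aB ay]]]].
- by rewrite mem_cat => /orP [] aA ay; [left|right]; exists a.
- by exists a; rewrite mem_cat aA.
- by exists a; rewrite mem_cat aB orbT.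
Qed.

Lemma in_hull_ext w A B y : A =i B -> in_hull w A y <-> in_hull w B y.
Proof. by move=> AB; split=> -[a [aA ay]]; exists a; rewrite ?AB// -AB. Qed.

Lemma in_hull_tr x w A y : in_hull (tr x w) A y <-> in_hull w (shift x A) (y + x).
Proof.
split=> [[a [aA /open_cluster_tr ay]]|[a []]].
  by exists (a + x); split => //; rewrite shiftP addrK.
rewrite shiftP => aA ay; exists (a - x); split => //; apply/open_cluster_tr.
by rewrite subrK.
Qed.

Lemma hull_pr_shift x A y : h (shift x A) (y + x) = h A y.
Proof.
rewrite /h -(pr_translate hPp x (measurable_in_hull A y)); apply: eq_pr => w.
by rewrite in_hull_tr.
Qed.

Lemma pr_cluster_translate a x : pr (fun w => open_cluster w a x) = tau (x - a).
Proof.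
rewrite /tau -(pr_translate hPp a (measurable_open_cluster 0 (x - a))).
by apply: eq_pr => w; rewrite open_cluster_tr add0r subrK.
Qed.

Lemma pr_sum (A : (edge -> bool) -> Prop) (T : Type) (r : seq T) (B : T -> (edge -> bool) -> Prop) :
  measurable [set w : config_space | A w] ->
  (forall t, measurable [set w : config_space | B t w]) ->
  (forall w, ind R A w <= \sum_(t <- r) ind R (B t) w) -> pr A <= \sum_(t <- r) pr (B t).
Proof.
move=> mA mB AB; rewrite -lee_fin -sumEFin -(integral_ind Pp mA).
under eq_bigr do rewrite -(integral_ind Pp (mB _)).
rewrite -ge0_integral_sum//; last 2 first.
- by move=> t; apply: measurable_indE.
- by move=> t w _; apply: ind_ge0.
apply: ge0_le_integral => //.
- by move=> w _; exact: ind_ge0.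
- exact: measurable_indE.
- by apply: emeasurable_sum => t; exact: measurable_indE.
- by move=> w _; rewrite sumEFin lee_fin.
Qed.

Lemma ind_le_sum (w : edge -> bool) (Q : Prop) (T : eqType) (r : seq T) (B : T -> (edge -> bool) -> Prop) :
  (Q -> exists2 t, t \in r & B t w) -> (`[< Q >]%:R : R) <= \sum_(t <- r) ind R (B t) w.
Proof.
move=> QB; case: asboolP => [/QB [t tr Bt]|_]; last by apply: sumr_ge0 => t _; rewrite ler0n.
apply: le_trans (_ : ind R (B t) w <= _); first by rewrite /ind asboolT.
by apply: (@ler_sum_mem _ _ _ (fun t => ind R (B t) w)) => // t'; rewrite ler0n.
Qed.

Let h0 A x : (0 <= (h A x)%:E)%E. Proof. by rewrite lee_fin pr_ge0. Qed.
Let tau0 x : (0 <= (tau x)%:E)%E. Proof. by rewrite lee_fin pr_ge0. Qed.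

Lemma csum_tau_fin : exists chi : R, 0 <= chi /\ csum (fun x => (tau x)%:E) = chi%:E.
Proof.
have [chi H] := finite_mean.
have e : (csum (fun x => (tau x)%:E) <= chi%:E)%E.
  by apply: csum_le => // Z uZ; rewrite sumEFin lee_fin H.
exists (fine (csum (fun x => (tau x)%:E))); split; first by rewrite fine_ge0// csum_ge0.
exact: csum_fin e.
Qed.

Lemma csum_cluster_pr a : csum (fun x => (pr (fun w => open_cluster w a x))%:E) = csum (fun x => (tau x)%:E).
Proof.
rewrite -[RHS](@csum_bij _ _ (fun z : Z2 => z - a) (fun z : Z2 => z + a))//.
- by apply: eq_csum => x; rewrite pr_cluster_translate.
- by move=> z; rewrite subrK.
- by move=> z; rewrite addrK.
Qed.

Lemma hull_pr_le A x : h A x <= \sum_(a <- undup A) pr (fun w => open_cluster w a x).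
Proof.
apply: pr_sum => // w; apply: ind_le_sum => -[a [aA ax]].
by exists a => //; rewrite mem_undup.
Qed.

Lemma mean_hullE A : csum (fun x => (h A x)%:E) = (F A)%:E.
Proof.
have [chi [chi0 e]] := csum_tau_fin.
apply: (@csum_fin _ _ _ ((size (undup A))%:R * chi)) => //.
apply: (@le_trans _ _ (csum (fun x => \sum_(a <- undup A) (pr (fun w => open_cluster w a x))%:E))%E).
  by apply: le_csum => // x; rewrite sumEFin lee_fin hull_pr_le.
rewrite csum_sum; last by move=> a x; rewrite lee_fin pr_ge0.
under eq_bigr do rewrite csum_cluster_pr e.
by rewrite sumEFin lee_fin big_const_seq count_predT iter_addr_0 mulr_natl.
Qed.

Lemma mean_hull_ge0 A : 0 <= F A.
Proof. by rewrite fine_ge0// csum_ge0. Qed.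

Lemma mean_hull_ext A B : A =i B -> F A = F B.
Proof.
move=> AB; congr fine; apply: eq_csum => x; congr EFin; apply: eq_pr => w.
exact: in_hull_ext.
Qed.

Lemma mean_hull_shift x A : F (shift x A) = F A.
Proof.
congr fine; rewrite -[LHS](@csum_bij _ _ (fun z : Z2 => z + x) (fun z : Z2 => z - x))//.
- by apply: eq_csum => z /=; rewrite hull_pr_shift.
- by move=> z; rewrite addrK.
- by move=> z; rewrite subrK.
Qed.

Lemma avoid_pr_ge0 z B : 0 <= D z B.
Proof. exact: pr_ge0. Qed.

Lemma avoid_pr_le z B : D z B <= tau z * (0 \notin B)%:R.
Proof.
case: (boolP (0 \in B)) => [B0|_]; last first.
  by rewrite mulr1; apply: pr_le => //; [exact: measurable_avoid|move=> w []].
rewrite mulr0 /avoid_pr pr_false// => w [_ []]; exists 0; split => //.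
exact: open_cluster_refl.
Qed.

Lemma avoid_pr_anti z (B B' : seq Z2) : {subset B <= B'} -> D z B' <= D z B.
Proof.
move=> BB'; apply: pr_le; [exact: measurable_avoid|exact: measurable_avoid|].
by move=> w [wz nh]; split => // -[a [aB a0]]; apply: nh; exists a; split => //; exact: BB'.
Qed.

(** When [x] belongs to the cluster of 0, the hull of [B] contains [x] exactly when it contains
    0. *)
Lemma hull_pr_cons B x : h (0 :: B) x = h B x + D x B.
Proof.
rewrite /h; transitivity (pr (fun w => open_cluster w 0 x \/ in_hull w B x)).
  by apply: eq_pr => w; exact: in_hull_cons.
rewrite prU_avoid//; congr (_ + _); apply: eq_pr => w.
split=> -[w0 nh]; split => // -[a [aB ax]]; apply: nh; exists a; split => //.
  exact: open_cluster_trans ax w0.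
exact: open_cluster_trans ax (open_cluster_sym w0).
Qed.

Lemma csum_avoid B : csum (fun x => (D x B)%:E) = (F (0 :: B) - F B)%:E.
Proof.
have D0 x : (0 <= (D x B)%:E)%E by rewrite lee_fin pr_ge0.
have /eqP := mean_hullE (0 :: B).
rewrite (eq_csum (g := fun x => (h B x)%:E + (D x B)%:E)%E); last by move=> x; rewrite hull_pr_cons.
rewrite csumD// mean_hullE => /eqP e.
have : (csum (fun x => (D x B)%:E) <= (F (0 :: B))%:E)%E by rewrite -e leeDr// lee_fin mean_hull_ge0.
move=> /(csum_fin D0) e2; rewrite e2 in e *; congr EFin.
by move: e; rewrite -EFinD => -[<-]; ring.
Qed.

Lemma avoid_pr_sum_le Z B : uniq Z -> \sum_(z <- Z) D z B <= F (0 :: B) - F B.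
Proof.
move=> uZ; rewrite -lee_fin -csum_avoid -sumEFin; apply: csum_ge => //.
by move=> x; rewrite lee_fin pr_ge0.
Qed.

(** [avoid_pr z B] is dominated by [tau z], which is summable, so one finite [Z] serves all [B]. *)
Lemma avoid_pr_sum_ge (e : R) : 0 < e -> exists2 Z, uniq Z &
  forall B, F (0 :: B) - F B <= \sum_(z <- Z) D z B + e.
Proof.
move=> e0; have [chi [chi0 E]] := csum_tau_fin.
have [||Z uZ HZ] := @csum_approx _ _ (fun x => (tau x)%:E) e _ _ e0 => //.
  by rewrite E ltry.
exists Z => // B; rewrite -lee_fin -csum_avoid EFinD -sumEFin.
have D0 x : (0 <= (D x B)%:E)%E by rewrite lee_fin pr_ge0.
apply: csum_le => // Z' uZ'.
have Dt z : D z B <= tau z.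
  by apply: le_trans (avoid_pr_le z B) _; rewrite ler_piMr ?pr_ge0// lern1 leq_b1.
rewrite !sumEFin -EFinD lee_fin (bigID (mem Z)) /= lerD//.
  rewrite -[leLHS]big_filter [leRHS](bigID (mem Z')) /= ler_wpDr ?sumr_ge0//.
    by move=> z _; exact: pr_ge0.
  rewrite le_eqVlt -[X in _ == X]big_filter; apply/orP; left; apply/eqP.
  apply: perm_big; apply: uniq_perm; rewrite ?filter_uniq//.
  by move=> z; rewrite !mem_filter andbC.
apply: (@le_trans _ _ (\sum_(z <- Z' | z \notin Z) tau z)); first by apply: ler_sum => z _.
have uC : uniq (Z ++ [seq z <- Z' | z \notin Z]).
  rewrite cat_uniq uZ filter_uniq// andbT /=; apply/hasPn => z; rewrite mem_filter => /andP [].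
  by [].
have := le_trans (csum_ge tau0 uC) HZ.
by rewrite !sumEFin -EFinD lee_fin big_cat /= big_filter lerD2l.
Qed.

(** By translation, the term of [x] is the probability that [x] is connected to 0 while no later
    point of [l] is. These events are disjoint, and their union says that [l] meets the cluster of
    0, which is certain when 0 is in [l]. *)
Lemma avoid_pr_last_exit (l : seq Z2) : 0 \in l ->
  sum_suffixes (fun x m => D (- x) (shift (- x) m)) l = 1.
Proof.
move=> l0; have -> : sum_suffixes (fun x m => D (- x) (shift (- x) m)) l = h l 0.
  elim: l {l0} => [|x l IHl] /=.
    by rewrite /hull_pr pr_false// => w [a []].
  rewrite IHl [RHS](_ : _ = pr (fun w => open_cluster w x 0 \/ in_hull w l 0)); last first.
    by apply: eq_pr => w; exact: in_hull_cons.
  rewrite prU_avoid// addrC; congr (_ + _).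
  rewrite /avoid_pr -(pr_translate hPp x (measurable_avoid _ _)); apply: eq_pr => w.
  rewrite open_cluster_tr in_hull_tr shift_shift subrr shift0 add0r addNr.
  by split=> -[w0 nh]; split => // -[a [al ax]]; apply: nh; exists a; split => //;
     [exact: open_cluster_trans ax (open_cluster_sym w0)|exact: open_cluster_trans ax w0].
apply: pr_true => w; exists 0; split => //; exact: open_cluster_refl.
Qed.

Lemma mean_hull_cat A B :
  (F A + F B)%:E = ((F (A ++ B))%:E + csum (fun x => (pr (fun w => in_hull w A x /\ in_hull w B x))%:E))%E.
Proof.
have m0 x : (0 <= (pr (fun w => in_hull w A x /\ in_hull w B x))%:E)%E by rewrite lee_fin pr_ge0.
rewrite EFinD -!mean_hullE -!csumD//; apply: eq_csum => x.
rewrite -!EFinD; congr EFin; rewrite /h prD//; congr (_ + _).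
by apply: eq_pr => w; rewrite in_hull_cat.
Qed.

Lemma mean_hull_inter_ge0 A B : 0 <= F A + F B - F (A ++ B).
Proof.
rewrite subr_ge0 -lee_fin mean_hull_cat leeDl// csum_ge0// => x.
by rewrite lee_fin pr_ge0.
Qed.

Lemma kappa_ge0 z : 0 <= kappa z.
Proof. by rewrite fine_ge0// csum_ge0// => x; rewrite lee_fin pr_ge0. Qed.

Lemma kappaE z : csum (fun x => (pr (fun w => open_cluster w 0 x /\ open_cluster w z x))%:E) = (kappa z)%:E.
Proof.
have [chi [chi0 e]] := csum_tau_fin.
apply: (@csum_fin _ _ _ chi) => [x|]; first by rewrite lee_fin pr_ge0.
rewrite -e; apply: le_csum => x; rewrite lee_fin ?pr_ge0//.
by apply: pr_le => //; [exact: measurable_and|move=> w []].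
Qed.

(** A site in both hulls lies in the clusters of some [a] and some [b]; the mean number of sites
    common to these two clusters is [kappa (b - a)] by translation. *)
Lemma mean_hull_inter A B : F A + F B - F (A ++ B) <=
  \sum_(a <- undup A) \sum_(b <- undup B) kappa (b - a).
Proof.
have kE a b : (kappa (b - a))%:E =
    csum (fun x => (pr (fun w => open_cluster w a x /\ open_cluster w b x))%:E).
  rewrite -kappaE -[RHS](@csum_bij _ _ (fun z : Z2 => z + a) (fun z : Z2 => z - a))//.
  - apply: eq_csum => x /=; congr EFin.
    rewrite -(pr_translate hPp a (measurable_and (measurable_open_cluster 0 x) (measurable_open_cluster (b - a) x))).
    by apply: eq_pr => w; rewrite !open_cluster_tr add0r subrK.
  - by move=> z; rewrite addrK.
  - by move=> z; rewrite subrK.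
  - by move=> z; rewrite lee_fin pr_ge0.
have -> : \sum_(a <- undup A) \sum_(b <- undup B) kappa (b - a) =
  \sum_(ab <- [seq (a, b) | a <- undup A, b <- undup B]) kappa (ab.2 - ab.1).
  by rewrite big_allpairs_dep.
rewrite lerBlDl -lee_fin mean_hull_cat EFinD leeD2l// -sumEFin.
under eq_bigr do rewrite kE.
rewrite -csum_sum; last by move=> ab x; rewrite lee_fin pr_ge0.
apply: le_csum => x; first by rewrite lee_fin pr_ge0.
rewrite sumEFin lee_fin.
apply: pr_sum => [|ab|w]; [exact: measurable_and|exact: measurable_and|].
apply: ind_le_sum => -[[a [aA ax]] [b [bB bx]]].
by exists (a, b) => //; apply/allpairsP; exists (a, b); rewrite !mem_undup.
Qed.

End Interface.

(** * Summability, moments and variance for hulls of fixed sets *)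

Section HullMoments.
Variables (R : realType) (p : R) (Pp : probability config_space R).
Hypothesis hPp : bernoulli_percolation_law p Pp.
Hypothesis finite_mean : exists chi : R,
  forall Z : seq Z2, uniq Z -> \sum_(z <- Z) @tau R Pp z <= chi.
Local Notation pr := (@pr R Pp).
Local Notation tau := (@tau R Pp).
Local Notation N := (@cluster_size R).
Local Notation K := (@hull_size R).
Local Notation h := (@hull_pr R Pp).
Local Notation F := (@mean_hull R Pp).
Local Hint Resolve measurable_in_hull measurable_open_cluster measurable_cluster_size : core.

Lemma cluster_moment_translate k x : (\int[Pp]_w N w x ^+ k = \int[Pp]_w N w 0%R ^+ k)%E.
Proof.
have N0 w : (0 <= N w 0%R ^+ k)%E by rewrite expe_ge0// cluster_size_ge0.
have mN : measurable_fun setT (fun w : config_space => (N w 0%R ^+ k)%E).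
  by apply: measurable_expe; exact: measurable_cluster_size.
rewrite -(integral_translate hPp x N0 mN); apply: eq_integral => w _.
by rewrite /translate cluster_size_tr add0r.
Qed.

(** When 0 and [z] are connected, [(nrm z).+1] is at most the cluster size, so [4 + 2 * sqn R z] is
    at most 6 times its square. Summing over the sites of the cluster yields a third moment. *)
Lemma tau_sum_sqr : exists C : R, forall Z, uniq Z ->
  \sum_(z <- Z) (4 + 2 * sqn R z) * tau z <= C.
Proof.
have [C [C0 HC]] := cluster_moment hPp finite_mean 3.
have s0 z : 0 <= 4 + 2 * sqn R z.
  by rewrite addr_ge0// mulr_ge0// /sqn ler0z addr_ge0 ?sqr_ge0.
pose f z (w : config_space) : \bar R :=
  ((4 + 2 * sqn R z)%:E * (ind R (fun w => open_cluster w 0%R z) w)%:E)%E.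
have f0 z w : (0 <= f z w)%E by rewrite mule_ge0 ?ind_ge0// lee_fin.
have mf z : measurable_fun setT (f z).
  apply: emeasurable_funM; first exact: measurable_cst.
  by apply: measurable_indE; exact: measurable_open_cluster.
exists (6 * C) => Z uZ; rewrite -lee_fin -sumEFin.
apply: (@le_trans _ _ (\int[Pp]_w csum (f ^~ w))%E).
  rewrite integral_csum//.
  apply: le_trans (csum_ge _ uZ); last by move=> z; exact: integral_ge0.
  rewrite le_eqVlt; apply/orP; left; apply/eqP; apply: eq_bigr => z _.
  rewrite ge0_integralZl_EFin//.
  - by rewrite integral_ind// EFinM.
  - by move=> w _; exact: ind_ge0.
  - by apply: measurable_indE; exact: measurable_open_cluster.
apply: (@le_trans _ _ (\int[Pp]_w (6%:E * N w 0%R ^+ 3))%E); last first.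
  rewrite ge0_integralZl_EFin//.
  - by rewrite EFinM lee_pmul2l.
  - by move=> w _; rewrite expe_ge0// cluster_size_ge0.
  - exact: measurable_expe.
apply: ge0_le_integral => //.
- by move=> w _; exact: csum_ge0.
- exact: measurable_csum.
- apply: emeasurable_funM; first exact: measurable_cst.
  exact: measurable_expe.
move=> w _; have N0 := cluster_size_ge0 R w 0.
have -> : (6%:E * N w 0%R ^+ 3 = csum (fun z => 6%:E * N w 0%R ^+ 2 * (ind R (fun w => open_cluster w 0%R z) w)%:E))%E.
  rewrite csumZl_ge0 -?cluster_sizeE ?mule_ge0 ?expe_ge0//; last by move=> z; exact: ind_ge0.
  by rewrite expeS [(N w 0%R * _)%E]muleC muleA.
apply: le_csum => // z; rewrite /f /ind; case: asboolP => [c|_]; last by rewrite !mule0.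
rewrite !mule1.
apply: (@le_trans _ _ (6%:E * ((nrm z).+1%:R%:E) ^+ 2)%E).
  rewrite -EFin_expe -EFinM lee_fin /sqn /nrm; case: z {c} => a b /=.
  rewrite -natrX -[6]/(6%:Z%:~R) -[4]/(4%:Z%:~R) -[2]/(2%:Z%:~R) -!intrM -intrD.
  rewrite pmulrn -intrM ler_int; nia.
rewrite lee_pmul2l//; apply: lee_expe; first by rewrite lee_fin.
by have := cluster_size_ge R c; rewrite subr0.
Qed.

(** A site of the cluster of 0 also lies in the cluster of [z] exactly when [z] is in that cluster,
    so the sum over [z] is the mean squared cluster size. *)
Lemma kappa_summable : exists C : R, forall Z, uniq Z -> \sum_(z <- Z) kappa Pp z <= C.
Proof.
have [C [C0 HC]] := cluster_moment hPp finite_mean 2.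
exists C => Z uZ; rewrite -lee_fin; apply: le_trans HC; rewrite -sumEFin.
pose A z x (w : edge -> bool) := open_cluster w 0 x /\ open_cluster w z x.
have mA z x : measurable [set w : config_space | A z x w] by exact: measurable_and.
apply: (@le_trans _ _ (csum (fun z => (kappa Pp z)%:E))).
  by apply: csum_ge => // z; rewrite lee_fin kappa_ge0.
rewrite (eq_csum (g := fun z => csum (fun x => (pr (A z x))%:E))); last first.
  by move=> z; rewrite (kappaE finite_mean).
rewrite csum_csum; last by move=> *; rewrite lee_fin pr_ge0.
rewrite (eq_csum (g := fun x => \int[Pp]_w csum (fun z => (ind R (A z x) w)%:E))%E); last first.
  by move=> x; rewrite integral_csum_ind.
rewrite -integral_csum; last 2 first.
- by move=> x w; apply: csum_ge0 => z; exact: ind_ge0.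
- move=> x; apply: (@measurable_csum _ _ _ _ (fun z (w : config_space) => (ind R (A z x) w)%:E)).
    by move=> z w; exact: ind_ge0.
  by move=> z; exact: measurable_indE.
rewrite le_eqVlt; apply/orP; left; apply/eqP; apply: eq_integral => w _.
rewrite expe2 [X in _ = (X * _)%E]cluster_sizeE muleC -csumZl_ge0 ?cluster_size_ge0//; last first.
  by move=> x; exact: ind_ge0.
apply: eq_csum => x; rewrite [in RHS]/ind; case: asboolP => c.
  rewrite mule1 (cluster_size_eq R c) cluster_sizeE; apply: eq_csum => z.
  rewrite /ind; congr (_%:R%:E); congr nat_of_bool; apply: asbool_equiv_eq.
  by split=> [[_ /open_cluster_sym]|/open_cluster_sym].
rewrite mule0; apply/eqP; rewrite eq_le csum_ge0 ?andbT; last by move=> z; exact: ind_ge0.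
apply: csum_le => [z|Z' _]; first exact: ind_ge0.
by rewrite big1// => z _; rewrite /ind asboolF// => -[].
Qed.

Lemma measurable_hull_size A : measurable_fun setT (fun w : config_space => K w A).
Proof.
apply: (@measurable_csum _ _ _ _ (fun x (w : config_space) => (ind R (fun w => in_hull w A x) w)%:E)).
  by move=> x w; exact: ind_ge0.
by move=> x; exact: measurable_indE.
Qed.

Lemma hull_size_ge0 w A : (0 <= K w A)%E.
Proof. by apply: csum_ge0 => x; exact: ind_ge0. Qed.

Lemma integral_hull_size A : (\int[Pp]_w K w A = (F A)%:E)%E.
Proof. by rewrite -(mean_hullE hPp finite_mean) -integral_csum_ind. Qed.

Lemma hull_size_le w A : (K w A <= \sum_(a <- undup A) N w a)%E.
Proof.
under eq_bigr do rewrite cluster_sizeE.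
rewrite -csum_sum; last by move=> a x; exact: ind_ge0.
apply: le_csum => x; first exact: ind_ge0.
rewrite sumEFin lee_fin; apply: ind_le_sum => -[a [aA ax]].
by exists a => //; rewrite mem_undup.
Qed.

Lemma epower_mean (T : eqType) (l : seq T) (a : T -> \bar R) k : (forall x, 0 <= a x)%E ->
  ((\sum_(x <- l) a x) ^+ k.+1 <= ((size l)%:R ^+ k)%:E * (\sum_(x <- l) a x ^+ k.+1))%E.
Proof.
move=> a0; case: (boolP (all (fun x => a x \is a fin_num) l)) => [afin|/allPn [x xl ax]].
  have aE : (\sum_(x <- l) a x = (\sum_(x <- l) fine (a x))%:E)%E.
    rewrite -sumEFin; elim: l afin => [|x l IHl]; first by rewrite !big_nil.
    by move=> /= /andP [ax /IHl e]; rewrite !big_cons e fineK.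
  have akE : (\sum_(x <- l) a x ^+ k.+1 = (\sum_(x <- l) (fine (a x)) ^+ k.+1)%:E)%E.
    rewrite -sumEFin; elim: l afin {aE} => [|x l IHl]; first by rewrite !big_nil.
    by move=> /= /andP [ax /IHl e]; rewrite !big_cons e EFin_expe fineK.
  rewrite aE akE -EFin_expe -EFinM lee_fin; apply: power_mean => x.
  exact: fine_ge0.
have {}ax : a x = +oo%E by move: ax (a0 x); case: (a x).
rewrite (_ : (\sum_(x <- l) a x ^+ k.+1 = +oo)%E); last first.
  pose f y := (a y ^+ k.+1)%E; have f0 y : (0 <= f y)%E by exact: expe_ge0.
  have fx : f x = +oo%E by rewrite /f ax expe_pinfty.
  change (\sum_(y <- l) f y = +oo)%E; clearbody f.
  by rewrite (big_rem x xl) /= fx addye// gt_eqF// (@lt_le_trans _ _ 0%E)// sume_ge0.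
rewrite gt0_muley ?leey// lte_fin exprn_gt0// ltr0n.
by case: (l) xl.
Qed.

Lemma hull_size_moment k : exists C : R, 0 <= C /\ forall A,
  (\int[Pp]_w K w A ^+ k.+1 <= (C * (size (undup A))%:R ^+ k.+1)%:E)%E.
Proof.
have [C [C0 HC]] := cluster_moment hPp finite_mean k.+1.
exists C; split => // A; set l := undup A.
have N0 (w : config_space) a : (0 <= N w a ^+ k.+1)%E by rewrite expe_ge0// cluster_size_ge0.
have mN a : measurable_fun setT (fun w : config_space => (N w a ^+ k.+1)%E).
  by apply: measurable_expe; exact: measurable_cluster_size.
have mS : measurable_fun setT (fun w : config_space => (\sum_(a <- l) N w a ^+ k.+1)%E).
  by apply: emeasurable_sum => a.
have S0 (w : config_space) : (0 <= \sum_(a <- l) N w a ^+ k.+1)%E by exact: sume_ge0.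
apply: (@le_trans _ _ (\int[Pp]_w (((size l)%:R ^+ k)%:E * \sum_(a <- l) N w a ^+ k.+1))%E).
  apply: ge0_le_integral => //.
  - by move=> w _; rewrite expe_ge0// hull_size_ge0.
  - by apply: measurable_expe; exact: measurable_hull_size.
  - by apply: emeasurable_funM => //; exact: measurable_cst.
  - move=> w _; apply: le_trans (epower_mean _ _ (fun a => cluster_size_ge0 R w a)).
    by apply: lee_expe; [exact: hull_size_ge0|exact: hull_size_le].
rewrite ge0_integralZl_EFin// ge0_integral_sum//.
under eq_bigr do rewrite cluster_moment_translate.
apply: (@le_trans _ _ (((size l)%:R ^+ k)%:E * \sum_(a <- l) C%:E)%E).
  rewrite lee_wpmul2l ?lee_fin//; exact: lee_sum.
rewrite sumEFin -EFinM lee_fin big_const_seq count_predT iter_addr_0.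
by rewrite -[C *+ _]mulr_natr exprSr mulrCA.
Qed.

Lemma csum_ind_le (Q : Z2 -> Prop) (l : seq Z2) : (forall z, Q z -> z \in l) ->
  (csum (fun z => (`[< Q z >]%:R : R)%:E) <= (size l)%:R%:E)%E.
Proof.
move=> Ql; apply: csum_le => [z|Z uZ]; first by rewrite lee_fin.
have -> : (\sum_(z <- Z) (`[< Q z >]%:R : R)%:E = (count (fun z => `[< Q z >]) Z)%:R%:E)%E.
  elim: Z {uZ} => [|z Z IHZ]; first by rewrite big_nil.
  by rewrite big_cons IHZ /= natrD EFinD.
rewrite lee_fin ler_nat -size_filter; apply: uniq_leq_size; first exact: filter_uniq.
by move=> z; rewrite mem_filter => /andP [/asboolP /Ql].
Qed.

(* Events local to the balls around x and y of radius smaller than half_dist x y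
   are independent. *)
Definition half_dist (x y : Z2) : nat := ((nrm (x - y)%R).+1)./2.

Lemma half_distC x y : half_dist x y = half_dist y x.
Proof. by rewrite /half_dist -nrmN opprB. Qed.

(** If the cluster of [x] has [s] sites and reaches half the distance to [y], then [y] is within
    $2s$ of [x]; there are at most $(4s+1)^2\le25s^2$ such sites. *)
Lemma csum_reach_le w x :
  (csum (fun y => (ind R (fun w => reach setT w x (half_dist x y)) w)%:E) <= 25%:E * N w x ^+ 2)%E.
Proof.
case: (cluster_size_cases R w x) => [->|[l [ul lP lE]]].
  by rewrite expe_pinfty gt0_muley ?leey.
pose s := size l.
have s1 : (0 < s)%N.
  by have := cluster_size_ge R (open_cluster_refl w x); rewrite lE lee_fin ler_nat; apply: leq_trans.
apply: le_trans (csum_ind_le (l := [seq z + x | z <- box (2 * s)]) _) _.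
  move=> y [z [kz c]]; apply/mapP; exists (y - x); last by rewrite subrK.
  rewrite mem_box -nrmN opprB.
  have := cluster_size_ge R ((open_clusterE w x z).2 c); rewrite lE lee_fin ler_nat.
  by rewrite -/s; move: kz; rewrite /half_dist; move: (nrm _) (nrm _) => a b; lia.
rewrite size_map lE -EFin_expe -EFinM lee_fin -natrX -[25]/(25%:R) -natrM ler_nat.
by apply: leq_trans (size_box _) _; rewrite -/s; nia.
Qed.

Definition in_hull_within (D : set Z2) (w : edge -> bool) (A : seq Z2) (x : Z2) : Prop :=
  exists a, a \in A /\ conn_in D w x a.

Lemma measurable_in_hull_within D A x : measurable [set w : config_space | in_hull_within D w A x].
Proof.
apply: measurable_exists => a; apply: measurable_and; first exact: measurable_prop.
exact: measurable_conn.
Qed.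

Lemma depends_in_hull_within D A x : depends (edges_in D) (fun w => in_hull_within D w A x).
Proof.
move=> w w' ww' [a [aA c]]; exists a; split => //; exact: depends_conn ww' c.
Qed.

Lemma in_hull_local w A x k : in_hull w A x -> in_hull_within (ball2 x k) w A x \/ reach setT w x k.+1.
Proof.
move=> [a [aA /open_cluster_sym /open_clusterE [s [ps ls _]]]].
have [all_in|] := boolP (all (fun z => (nrm (z - x)%R <= k)%N) (x :: s)).
  left; exists a; split => //; exists s; split => // z zs; exact: (allP all_in).
rewrite -has_predC => /hasP [z zs /=]; rewrite -ltnNge => kz; right; exists z; split => //.
move: zs; rewrite inE => /orP [/eqP ->|zs]; first exact: conn_refl.
case/splitPr: zs ps => s1 s2; rewrite -cat_rcons cat_path => /andP [ps1 _].
by exists (rcons s1 z); split => //; rewrite last_rcons.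
Qed.

(** The two balls of radius [k] have no common edge, so the local events are independent. *)
Lemma pr_in_hull2_local A x y k : (2 * k < nrm (x - y)%R)%N ->
  pr (fun w => in_hull_within (ball2 x k) w A x /\ in_hull_within (ball2 y k) w A y) <= h A x * h A y.
Proof.
move=> kxy; set n := (nrm x + nrm y + k)%N.
have ballN z : (nrm z <= nrm x + nrm y)%N -> ball2 z k `<=` ball2 0 n.
  move=> zn u; rewrite /ball2 /= subr0 => uz; have := nrm_triangle (u - z) z.
  rewrite subrK => /leq_trans; apply; rewrite /n addnC; exact: leq_add.
have mh z : measurable [set w : config_space | in_hull_within (ball2 z k) w A z] by exact: measurable_in_hull_within.
have disj : edges_in (ball2 x k) `&` edges_in (ball2 y k) = set0.
  apply/seteqP; split => // e [[ex _] [ey _]]; move: ex ey; rewrite /ball2 /=.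
  set u := e.1 => ux uy.
  have := nrm_triangle (x - u) (u - y); rewrite addrA subrK.
  rewrite -[nrm (x - u)]nrmN opprB => h.
  have := leq_trans kxy (leq_trans h (leq_add ux uy)).
  by rewrite mul2n -addnn ltnn.
have := Pp_indep hPp (box_edges_uniq n) (edges_in_box (ballN x (leq_addr _ _)))
  (edges_in_box (ballN y (leq_addl _ _))) (@depends_in_hull_within _ A x) (@depends_in_hull_within _ A y) disj.
rewrite !prE//; last exact: measurable_and.
rewrite -EFinM => -[->].
have le z : pr (fun w => in_hull_within (ball2 z k) w A z) <= h A z.
  apply: pr_le => // w [a [aA c]]; exists a; split => //; apply: open_cluster_sym.
  by apply/open_clusterE; apply: conn_sub c.
by apply: ler_pM; rewrite ?pr_ge0.
Qed.

Let far A x y w := in_hull w A x /\ reach setT w x (half_dist x y).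

Let mfar A x y : measurable [set w : config_space | far A x y w].
Proof. by apply: measurable_and => //; exact: measurable_reach. Qed.

(** Either both sites are joined to [A] inside disjoint balls, or one of them has a cluster reaching
    radius [half_dist x y]. For $x=y$ this radius is 0 and the second case is automatic. *)
Lemma pr_in_hull2 A x y : pr (fun w => in_hull w A x /\ in_hull w A y) <=
  h A x * h A y + (pr (far A x y) + pr (far A y x)).
Proof.
have mm : measurable [set w : config_space | in_hull w A x /\ in_hull w A y] by exact: measurable_and.
case: (posnP (half_dist x y)) => [d0|].
  apply: (@le_trans _ _ (pr (far A x y))).
    apply: pr_le => // w [wx _]; split => //; rewrite d0; exists x; split => //.
    exact: conn_refl.
  by rewrite addrCA lerDl addr_ge0 ?mulr_ge0 ?pr_ge0.
case dE : (half_dist x y) => [//|k] _.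
have kxy : (2 * k < nrm (x - y)%R)%N.
  by move: dE; rewrite /half_dist; move: (nrm _) => a; lia.
apply: le_trans (_ : _ <= pr (fun w => in_hull_within (ball2 x k) w A x /\ in_hull_within (ball2 y k) w A y) +
   (pr (far A x y) + pr (far A y x))) _; last by rewrite lerD2r; exact: pr_in_hull2_local.
pose B (i : nat) : (edge -> bool) -> Prop := if i is 0%N then
  (fun w => in_hull_within (ball2 x k) w A x /\ in_hull_within (ball2 y k) w A y)
  else if i is 1%N then far A x y else far A y x.
have -> : pr (fun w => in_hull_within (ball2 x k) w A x /\ in_hull_within (ball2 y k) w A y) +
   (pr (far A x y) + pr (far A y x)) = \sum_(i <- [:: 0; 1; 2]%N) pr (B i).
  by rewrite !big_cons big_nil addr0.
apply: pr_sum => // [[|[|i]] //=|w].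
  by apply: measurable_and; exact: measurable_in_hull_within.
apply: ind_le_sum => -[wx wy].
have [lx|rx] := in_hull_local k wx; last by exists 1%N => //=; split => //; rewrite dE.
have [ly|ry] := in_hull_local k wy; first by exists 0%N.
by exists 2%N => //=; split => //; rewrite half_distC dE.
Qed.

(** Summing over [y] gives at most $25|C_x|^2$. The sites [x] of the hull lie in the clusters $C_a$
    with $a\in A$, each of which contributes $25|C_a|^3$. *)
Lemma csum_far_le : exists C : R, 0 <= C /\ forall A,
  (csum (fun x => csum (fun y => (pr (far A x y))%:E)) <= (C * (size (undup A))%:R)%:E)%E.
Proof.
have [C [C0 HC]] := cluster_moment hPp finite_mean 3.
exists (25 * C); split; first by rewrite mulr_ge0.
move=> A; set l := undup A.
have i0 x y w : (0 <= (ind R (far A x y) w)%:E)%E by exact: ind_ge0.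
have mi x y : measurable_fun setT (fun w : config_space => (ind R (far A x y) w)%:E).
  exact: measurable_indE.
rewrite (eq_csum (g := fun x => \int[Pp]_w csum (fun y => (ind R (far A x y) w)%:E))%E); last first.
  by move=> x; rewrite integral_csum_ind.
rewrite -integral_csum; last 2 first.
- by move=> x w; exact: csum_ge0.
- by move=> x; exact: (@measurable_csum _ _ _ _ (fun y (w : config_space) => (ind R (far A x y) w)%:E)).
have N0 (w : config_space) a : (0 <= N w a ^+ 3)%E by rewrite expe_ge0// cluster_size_ge0.
have mN a : measurable_fun setT (fun w : config_space => (N w a ^+ 3)%E).
  by apply: measurable_expe; exact: measurable_cluster_size.
have mS : measurable_fun setT (fun w : config_space => (\sum_(a <- l) N w a ^+ 3)%E).
  by apply: emeasurable_sum => a.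
have S0 (w : config_space) : (0 <= \sum_(a <- l) N w a ^+ 3)%E by exact: sume_ge0.
apply: (@le_trans _ _ (\int[Pp]_w (25%:E * \sum_(a <- l) N w a ^+ 3))%E); last first.
  rewrite ge0_integralZl_EFin// ge0_integral_sum//.
  under eq_bigr do rewrite cluster_moment_translate.
  apply: (@le_trans _ _ (25%:E * \sum_(a <- l) C%:E)%E).
    rewrite lee_wpmul2l ?lee_fin//; exact: lee_sum.
  rewrite sumEFin -EFinM lee_fin big_const_seq count_predT iter_addr_0.
  by rewrite -[C *+ _]mulr_natr mulrA.
apply: ge0_le_integral => //.
- by move=> w _; apply: csum_ge0 => x; exact: csum_ge0.
- apply: (@measurable_csum _ _ _ _ (fun x (w : config_space) => csum (fun y => (ind R (far A x y) w)%:E))).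
    by move=> x w; exact: csum_ge0.
  by move=> x; exact: (@measurable_csum _ _ _ _ (fun y (w : config_space) => (ind R (far A x y) w)%:E)).
- by apply: emeasurable_funM => //; exact: measurable_cst.
move=> w _.
have c0 x : (0 <= 25%:E * N w x ^+ 2)%E by rewrite mule_ge0// expe_ge0// cluster_size_ge0.
have -> : (25%:E * \sum_(a <- l) N w a ^+ 3 =
   csum (fun x => \sum_(a <- l) (25%:E * N w a ^+ 2 * (ind R (fun w => open_cluster w a x) w)%:E)))%E.
  rewrite csum_sum; last by move=> a x; rewrite mule_ge0 ?ind_ge0.
  rewrite ge0_sume_distrr//; apply: eq_bigr => a _.
  rewrite csumZl_ge0// -?cluster_sizeE; last by move=> x; exact: ind_ge0.
  by rewrite expeS [(N w a * _)%E]muleC muleA.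
apply: le_csum => x; first exact: csum_ge0.
have s0 a : (0 <= 25%:E * N w a ^+ 2 * (ind R (fun w => open_cluster w a x) w)%:E)%E.
  by rewrite mule_ge0 ?ind_ge0.
have [[a [aA ax]]|nh] := pselect (in_hull w A x); last first.
  rewrite (_ : csum _ = 0%E) ?sume_ge0//.
  apply/eqP; rewrite eq_le csum_ge0// andbT; apply: csum_le => // Z _.
  by rewrite big1// => y _; rewrite /ind asboolF// => -[].
apply: (@le_trans _ _ (25%:E * N w x ^+ 2)%E).
  apply: le_trans (csum_reach_le w x); apply: le_csum => // y.
  rewrite lee_fin ler_nat; case: asboolP => // -[_ rxy].
  by rewrite asboolT.
rewrite (big_rem a) ?mem_undup//= {1}/ind asboolT// mule1 (cluster_size_eq R ax).
by apply: leeDl; apply: sume_ge0 => y _; exact: s0.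
Qed.

(** Covariances in excess of the product term are summed by [csum_far_le], so the variance is at
    most linear in the number of distinct sites. *)
Lemma hull_size_sqr : exists C : R, 0 <= C /\ forall A,
  (\int[Pp]_w K w A ^+ 2 <= ((F A) ^+ 2 + C * (size (undup A))%:R)%:E)%E.
Proof.
have [C [C0 HC]] := csum_far_le.
exists (2 * C); split; first by rewrite mulr_ge0.
move=> A; pose B x y w := in_hull w A x /\ in_hull w A y.
have mB x y : measurable [set w : config_space | B x y w] by exact: measurable_and.
have i0 x y w : (0 <= (ind R (B x y) w)%:E)%E by exact: ind_ge0.
have mi x y : measurable_fun setT (fun w : config_space => (ind R (B x y) w)%:E).
  exact: measurable_indE.
have h0 x : (0 <= (h A x)%:E)%E by rewrite lee_fin pr_ge0.
have p0 E : (0 <= (pr E)%:E)%E by rewrite lee_fin pr_ge0.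
have -> : (\int[Pp]_w K w A ^+ 2 = csum (fun x => csum (fun y => (pr (B x y))%:E)))%E.
  rewrite [RHS](eq_csum (g := fun x => \int[Pp]_w csum (fun y => (ind R (B x y) w)%:E))%E); last first.
    by move=> x; rewrite integral_csum_ind.
  rewrite -integral_csum; last 2 first.
  - by move=> x w; exact: csum_ge0.
  - by move=> x; exact: (@measurable_csum _ _ _ _ (fun y (w : config_space) => (ind R (B x y) w)%:E)).
  apply: eq_integral => w _; rewrite expe2 /hull_size csum_mul; try by move=> x; exact: ind_ge0.
  apply: eq_csum => x; apply: eq_csum => y.
  by rewrite -EFinM /ind asbool_and -mulnb natrM.
apply: (@le_trans _ _ (csum (fun x => csum (fun y => (h A x)%:E * (h A y)%:E +
   ((pr (far A x y))%:E + (pr (far A y x))%:E)))))%E.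
  apply: le_csum => x; first exact: csum_ge0.
  by apply: le_csum => // y; rewrite -EFinM -!EFinD lee_fin; exact: pr_in_hull2.
rewrite (eq_csum (g := fun x => csum (fun y => (h A x)%:E * (h A y)%:E) +
  (csum (fun y => (pr (far A x y))%:E) + csum (fun y => (pr (far A y x))%:E))))%E; last first.
  by move=> x; rewrite !csumD// => y; [rewrite mule_ge0|rewrite adde_ge0].
rewrite !csumD; last 4 first.
- by move=> x; exact: csum_ge0.
- by move=> x; exact: csum_ge0.
- by move=> x; apply: csum_ge0 => y; rewrite mule_ge0.
- by move=> x; rewrite adde_ge0// csum_ge0.
rewrite -csum_mul// (mean_hullE hPp finite_mean) [X in (_ + (_ + X))%E]csum_csum//.
apply: (@le_trans _ _ ((F A)%:E * (F A)%:E + ((C * (size (undup A))%:R)%:E + (C * (size (undup A))%:R)%:E))%E).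
  by rewrite leeD2l// leeD.
by rewrite -EFinM -!EFinD lee_fin; lra.
Qed.

End HullMoments.

(** * The law of the walk and the product law *)

Section WalkLaw.
Variables (R : realType) (P0 : probability walk_space R).
Hypothesis hP0 : simple_random_walk_law P0.

Lemma words_uniq n : uniq (words n).
Proof.
elim: n => // n IHn; rewrite wordsS; apply: allpairs_uniq => //.
by move=> [a b] [c e] _ _ /= [-> ->].
Qed.

Lemma nth_trace t i : (i < size t)%N ->
  nth 0 (trace t) i.+1 = nth 0 (trace t) i + nth 0 t i.
Proof.
elim: t i => [//|d t IHt] [|i] /= it.
  by rewrite trace_head /= addr0 add0r.
by rewrite /shift !(nth_map 0) ?size_trace// ?IHt ?addrA// ltnW.
Qed.

Lemma trace_inj n t t' : t \in words n -> t' \in words n -> trace t = trace t' -> t = t'.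
Proof.
move=> /size_words st /size_words st' e; apply: (@eq_from_nth _ 0); first by rewrite st st'.
move=> i; rewrite st => iN; apply: (@addrI _ (nth 0 (trace t) i)).
by rewrite -nth_trace ?st// {2}e e -nth_trace ?st'.
Qed.

Definition path_of (n : nat) (s : nat -> Z2) : seq Z2 := [seq s i | i <- iota 0 n.+1].

Lemma measurable_path n l : measurable [set s : walk_space | path_of n s = l].
Proof.
rewrite /path_of; elim: (iota 0 n.+1) l => [|i r IHr] [|x l] /=.
- exact: measurable_prop.
- exact: measurable_prop.
- by rewrite (_ : [set s | _] = set0)//; apply/seteqP; split.
rewrite (_ : [set s | _] = [set s : walk_space | s i = x /\ [seq s i | i <- r] = l]).
  apply: measurable_and; last exact: IHr.
  by apply: sub_sigma_algebra; exists i, x.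
by apply/seteqP; split => s /= [-> ->].
Qed.

Lemma path_law n t : t \in words n ->
  P0 [set s : walk_space | path_of n s = trace t] = (4^-1 ^+ n)%:E.
Proof.
move=> tn; have st := size_words tn; have td := mem_words tn.
rewrite (_ : [set s | _] = [set s : walk_space | forall i, (i <= n)%N -> s i = nth 0 (trace t) i]).
  rewrite hP0; congr EFin.
  have -> : nth 0 (trace t) 0 = 0 by rewrite trace_head.
  rewrite eqxx mul1r (eq_bigr (fun=> 4^-1)) ?prodr_const ?card_ord// => i _.
  rewrite nth_trace ?st// /transition ifT//.
  have : nth 0 t i \in dirs by apply: td; rewrite mem_nth ?st.
  move: (nth 0 (trace t) i) (nth 0 t i) => [a b] [c e].
  rewrite /nearest_neighbor !inE /= !opprD !addrA !subrr !sub0r !normrN.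
  by rewrite !xpair_eqE => /orP [|/orP [|/orP [|]]] /andP [/eqP -> /eqP ->]; rewrite ?normrN1.
apply/seteqP; split => s /=.
  move=> <- i iN; rewrite /path_of (nth_map 0%N) ?size_iota ?ltnS//.
  by rewrite nth_iota ?ltnS.
move=> h; apply: (@eq_from_nth _ 0); first by rewrite size_map size_iota size_trace st.
rewrite size_map size_iota => i iN; rewrite /path_of (nth_map 0%N) ?size_iota//.
by rewrite nth_iota// h.
Qed.

(** The $4^n$ nearest-neighbour paths from 0 already carry total mass 1, so all other trajectories
    form a null set. *)
Lemma integral_path n (G : seq Z2 -> \bar R) : (forall l, 0 <= G l)%E ->
  (\int[P0]_s G (path_of n s) = \sum_(t <- words n) (4^-1 ^+ n)%:E * G (trace t))%E.
Proof.
move=> G0; pose E t := [set s : walk_space | path_of n s = trace t /\ t \in words n].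
have mE t : measurable (E t).
  by apply: measurable_and; [exact: measurable_path|exact: measurable_prop].
have EE t : t \in words n -> E t = [set s : walk_space | path_of n s = trace t].
  by move=> tn; apply/seteqP; split => [s []|s].
have mG (f : seq Z2 -> \bar R) (B : set walk_space) : measurable B -> measurable_fun B (fun s : walk_space => f (path_of n s)).
  move=> mB _ Y mY; apply: measurableI => //.
  rewrite (_ : _ @^-1` Y = [set s : walk_space | exists l, path_of n s = l /\ Y (f l)]).
    by apply: measurable_exists => l; apply: measurable_and; [exact: measurable_path|exact: measurable_prop].
  by apply/seteqP; split => s /=; [exists (path_of n s)|move=> [l [<-]]].
have tE : trivIset [set` words n] E.
  move=> t t' _ _ [s [[st tn] [st' tn']]]; apply: (trace_inj tn tn').
  by rewrite -st -st'.
pose D := \big[setU/set0]_(t <- words n) E t.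
have mD : measurable D by apply: bigsetU_measurable => t _.
have int_D (f : seq Z2 -> \bar R) : (forall l, 0 <= f l)%E ->
    (\int[P0]_(s in D) f (path_of n s) = \sum_(t <- words n) (4^-1 ^+ n)%:E * f (trace t))%E.
  move=> f0; rewrite ge0_integral_bigsetU//; [|exact: words_uniq|exact: mG].
  rewrite big_seq [RHS]big_seq; apply: eq_bigr => t tn.
  rewrite (eq_integral (cst (f (trace t)))) => [|s]; last by rewrite inE => -[->].
  rewrite integral_cst// muleC; congr (_ * _)%E.
  by apply: etrans (path_law tn); congr (P0 _); exact: EE.
have PD : P0 D = 1%E.
  have := int_D (cst 1%E) (fun=> lee01); rewrite integral_cst// mul1e => ->.
  rewrite (eq_bigr (fun=> (4^-1 ^+ n)%:E)) => [|t _]; last by rewrite mule1.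
  rewrite sumEFin; congr EFin; have := walkE_cst n (1 : R).
  by rewrite /walkE mulr_suml => e; rewrite -[RHS]e; apply: eq_bigr => t _; rewrite mul1r exprVn.
have mDC : measurable (~` D) by exact: measurableC.
have PDC : P0 (~` D) = 0%E by rewrite probability_setC// PD subee.
rewrite -[in LHS](setUv D) ge0_integral_setU//; last 2 first.
- by rewrite setUv; exact: mG.
- by apply/disj_setPS; rewrite setICr.
rewrite int_D// [X in (_ + X)%E](null_set_integral mDC) ?adde0//.
exact: mG.
Qed.

Lemma integral_path_EFin n (g : seq Z2 -> R) : (forall l, 0 <= g l) ->
  (\int[P0]_s (g (path_of n s))%:E = (walkE n (fun t => g (trace t)))%:E)%E.
Proof.
move=> g0; rewrite (@integral_path n (fun l => (g l)%:E)) => [|l]; last by rewrite lee_fin.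
under eq_bigr do rewrite -EFinM.
rewrite sumEFin; congr EFin; rewrite /walkE mulr_suml; apply: eq_bigr => t _.
by rewrite mulrC exprVn.
Qed.

End WalkLaw.

Section ProductLaw.
Variables (R : realType) (P0 : probability walk_space R) (Pp : probability config_space R).
Hypothesis hP0 : simple_random_walk_law P0.
Variables (n : nat) (G : config_space -> seq Z2 -> \bar R).
Hypothesis G0 : forall w l, (0 <= G w l)%E.
Hypothesis mG : forall l, measurable_fun setT (G ^~ l).

(** The path takes countably many values, so measurability in the configuration for each fixed path
    suffices. *)
Lemma measurable_path_fun : measurable_fun setT
  (fun sw : (walk_space * config_space)%type => G sw.2 (path_of n sw.1)).
Proof.
move=> _ Y mY; rewrite setTI (_ : _ @^-1` Y = [set sw : (walk_space * config_space)%type |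
  exists l, path_of n sw.1 = l /\ Y (G sw.2 l)]); last first.
  by apply/seteqP; split => s /=; [exists (path_of n s.1)|move=> [l [<-]]].
apply: measurable_exists => l.
rewrite (_ : [set sw | _] = [set s : walk_space | path_of n s = l] `*` [set w | Y (G w l)]).
  apply: measurableX; first exact: measurable_path.
  by have := mG l measurableT mY; rewrite setTI.
by apply/seteqP; split.
Qed.

Lemma integral_product : (\int[P0 \x Pp]_sw G sw.2 (path_of n sw.1) =
  \int[P0]_s \int[Pp]_w G w (path_of n s))%E.
Proof. by rewrite fubini_tonelli1//; exact: measurable_path_fun. Qed.

Lemma integral_product_eq (g : seq Z2 -> R) : (forall l, \int[Pp]_w G w l = (g l)%:E)%E ->
  (\int[P0 \x Pp]_sw G sw.2 (path_of n sw.1) = (walkE n (fun t => g (trace t)))%:E)%E.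
Proof.
move=> Gg; rewrite integral_product -(integral_path_EFin hP0).
  by apply: eq_integral => s _; rewrite Gg.
by move=> l; rewrite -lee_fin -Gg; exact: integral_ge0.
Qed.

Lemma integral_product_le (g : seq Z2 -> R) : (forall l, \int[Pp]_w G w l <= (g l)%:E)%E ->
  (\int[P0 \x Pp]_sw G sw.2 (path_of n sw.1) <= (walkE n (fun t => g (trace t)))%:E)%E.
Proof.
move=> Gg; rewrite integral_product (integral_path hP0 n (G := fun l => \int[Pp]_w G w l)%E).
  rewrite /walkE mulr_suml -sumEFin; apply: lee_sum => t _.
  rewrite mulrC EFinM exprVn lee_wpmul2l// lee_fin invr_ge0 exprn_ge0//.
by move=> l; exact: integral_ge0.
Qed.

End ProductLaw.

Lemma U_hull (R : realType) n (sw : walk_space * config_space) :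
  U R n sw = hull_size R sw.2 (path_of n sw.1).
Proof.
rewrite /U counting_csum; apply: eq_csum => x; rewrite /ind; congr (_%:R%:E); congr nat_of_bool.
apply: asbool_equiv_eq; split=> [[i /= iN c]|[a [/mapP [i]]]].
  by exists (sw.1 i); split => //; apply/mapP; exists i => //; rewrite mem_iota ltnS.
by rewrite mem_iota ltnS /= => iN -> c; exists i.
Qed.

(** * Asymptotics of the union of clusters along the walk *)

Section ExtendedSquares.
Variable R : realType.

(** Expansion of the square with the negative term moved to the left, so that it also holds at
    $+\infty$. *)
Lemma esquare_identity (x : \bar R) (c : R) : (0 <= x)%E -> 0 <= c ->
  ((x - c%:E) ^+ 2 + (2 * c)%:E * x = x ^+ 2 + (c ^+ 2)%:E)%E.
Proof.
move=> x0 c0; case: x x0 => [x||] // x0.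
  by rewrite -EFinB -!EFin_expe -EFinM -!EFinD; congr EFin; ring.
have e1 : (+oo - c%:E = +oo)%E by [].
rewrite e1 (expe_pinfty R 1) [RHS]addye// addye//.
have [->|c1] := eqVneq c 0; first by rewrite mulr0 mul0e.
by rewrite gt0_muley// lte_fin mulr_gt0// lt0r c1.
Qed.

Lemma emulB (x : \bar R) (a b : R) : (0 <= x)%E -> 0 < a ->
  (a%:E * x - (a * b)%:E = a%:E * (x - b%:E))%E.
Proof.
move=> x0 a0; case: x x0 => [x||] // x0.
  by rewrite -EFinM -!EFinB -EFinM; congr EFin; ring.
by rewrite gt0_muley ?lte_fin// !addye// gt0_muley ?lte_fin.
Qed.

Context d (T : measurableType d) (P : probability T R) (X : T -> \bar R).
Hypothesis X0 : forall w, (0 <= X w)%E.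
Hypothesis mX : measurable_fun setT X.

Lemma measurable_esub (c : R) : measurable_fun setT (fun w => (X w - c%:E)%E).
Proof. by apply: emeasurable_funB => //; exact: measurable_cst. Qed.

Lemma esquare_ge0 (x : \bar R) : (0 <= x ^+ 2)%E.
Proof. by rewrite expe2; case: x => [x||] //; rewrite -EFinM lee_fin -expr2 sqr_ge0. Qed.

Lemma integral_esquare (m s c : R) : (\int[P]_w X w = m%:E)%E ->
  (\int[P]_w X w ^+ 2 <= s%:E)%E -> 0 <= c ->
  (\int[P]_w (X w - c%:E) ^+ 2 <= (s - m ^+ 2 + (m - c) ^+ 2)%:E)%E.
Proof.
move=> Xm Xs c0.
have mS : measurable_fun setT (fun w => (X w - c%:E) ^+ 2)%E.
  by apply: measurable_expe; exact: measurable_esub.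
have : (\int[P]_w ((X w - c%:E) ^+ 2 + (2 * c)%:E * X w) = \int[P]_w (X w ^+ 2 + (c ^+ 2)%:E))%E.
  by apply: eq_integral => w _; exact: esquare_identity.
rewrite ge0_integralD//; last 3 first.
- by move=> w _; exact: esquare_ge0.
- by move=> w _; rewrite mule_ge0// lee_fin mulr_ge0.
- by apply: emeasurable_funM => //; exact: measurable_cst.
rewrite ge0_integralD//; last 3 first.
- by move=> w _; exact: esquare_ge0.
- exact: measurable_expe.
- by move=> w _; rewrite lee_fin sqr_ge0.
have ic : (\int[P]_w (c ^+ 2)%:E = (c ^+ 2)%:E)%E.
  by rewrite -[RHS]mule1 -(probability_setT P); apply: integral_cst.
rewrite ge0_integralZl_EFin ?mulr_ge0// Xm ic.
move=> e; have : (\int[P]_w (X w - c%:E) ^+ 2 + (2 * c)%:E * m%:E <= s%:E + (c ^+ 2)%:E)%E.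
  by rewrite e leeD2r.
rewrite -EFinM -EFinD -leeBrDr// -EFinB => /le_trans; apply.
by rewrite lee_fin; lra.
Qed.

End ExtendedSquares.

Section UnionOfClusters.
Variables (R : realType) (p : R) (P0 : probability walk_space R) (Pp : probability config_space R).
Hypothesis hP0 : simple_random_walk_law P0.
Hypothesis hPp : bernoulli_percolation_law p Pp.
Hypothesis hp : p < p_T R.
Local Notation L n := (ln (n%:R : R)).
Local Notation F := (@mean_hull R Pp).
Local Notation mu := (P0 \x Pp)%E.
Local Notation m n := (walkE n (fun t => F (trace t))).

Let finite_mean := subcritical_mean hPp hp.

Lemma U_ge0 n (sw : walk_space * config_space) : (0 <= U R n sw)%E.
Proof. by rewrite U_hull hull_size_ge0. Qed.

Lemma measurable_U n : measurable_fun setT (U R n).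
Proof.
rewrite (_ : U R n = fun sw => hull_size R sw.2 (path_of n sw.1)); last first.
  by apply/funext => sw; exact: U_hull.
by apply: (@measurable_path_fun R n (fun w l => hull_size R w l)) => l; exact: measurable_hull_size.
Qed.

Lemma mean_U n : (\int[mu]_sw U R n sw = (m n)%:E)%E.
Proof.
under eq_integral do rewrite U_hull.
apply: (@integral_product_eq _ _ Pp hP0 n (fun w l => hull_size R w l)).
- by move=> w l; exact: hull_size_ge0.
- by move=> l; exact: measurable_hull_size.
- by move=> l; exact: integral_hull_size hPp finite_mean l.
Qed.

Lemma mean_U_asymp : exists C : R, 0 <= C /\ forall n, (2 <= n)%N ->
  `|m n - pi * (n%:R / L n)| <= C * (n%:R / L n ^+ 2).
Proof.
have [K HK] := tau_sum_sqr hPp finite_mean.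
apply: (@walkE_trace_asymp R F (@avoid_pr R Pp) (@tau R Pp) K) => //.
- exact: mean_hull_shift hPp.
- exact: avoid_pr_ge0.
- exact: avoid_pr_le.
- exact: avoid_pr_anti.
- exact: avoid_pr_sum_le hPp finite_mean.
- exact: avoid_pr_sum_ge hPp finite_mean.
- exact: avoid_pr_last_exit hPp.
Qed.

(** Given the walk, the moment is at most a constant times the same power of the number of visited
    sites, to which [range_moment] applies. *)
Lemma moment_U k : exists C : R, 0 <= C /\ forall n, (2 <= n)%N ->
  (\int[mu]_sw U R n sw ^+ k.+1 <= (C * (n%:R / L n) ^+ k.+1)%:E)%E.
Proof.
have [C [C0 HC]] := hull_size_moment hPp finite_mean k.
have [c [c0 Hc]] := sum_escape R.
exists (C * (k.+1`!%:R * c ^+ k.+1)); split; first by rewrite !mulr_ge0// exprn_ge0.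
move=> n n2.
under eq_integral do rewrite U_hull.
apply: le_trans (@integral_product_le _ _ Pp hP0 n (fun w l => hull_size R w l ^+ k.+1)%E _ _ _ HC) _.
- by move=> w l; rewrite expe_ge0// hull_size_ge0.
- by move=> l; apply: measurable_expe; exact: measurable_hull_size.
rewrite lee_fin walkEZ -mulrA ler_wpM2l//.
apply: le_trans (range_moment R k.+1 n) _.
rewrite -mulrA ler_wpM2l// -exprMn lerXn2r ?nnegrE ?Hc//.
  by apply: sumr_ge0 => i _; exact: escape_ge0.
by apply: mulr_ge0 => //; apply: divr_ge0 => //; exact/ltW/ln_nat_gt0.
Qed.

Lemma ln_pow4_le n : (1 <= n)%N -> L n ^+ 4 <= 4 ^+ 4 * n%:R.
Proof.
move=> n1; have n0 : 0 < n%:R :> R by rewrite ltr0n.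
set s := Num.sqrt (Num.sqrt (n%:R : R)).
have s0 : 0 < s by rewrite !sqrtr_gt0.
have s4 : s ^+ 4 = n%:R by rewrite (exprM s 2 2) !sqr_sqrtr// ?sqrtr_ge0// ltW.
have -> : L n = 4 * ln s by rewrite -s4 lnXn// mulr_natl.
rewrite exprMn -s4; apply: ler_wpM2l; first exact: exprn_ge0.
apply: lerXn2r; rewrite ?nnegrE ?(ltW s0)//.
  apply: ln_ge0; rewrite -(@ler_pXn2r _ 4) ?nnegrE ?ler01 ?(ltW s0)//.
  by rewrite expr1n s4 ler1n.
exact: ltW (ln_sublinear s0).
Qed.

(** Total variance: the mean of [F ^+ 2] is [m n ^+ 2] plus the variance bounded by halving, and the
    variance given the walk has mean $O(n/\log n)$, absorbed into $n^2/\log^4 n$ through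
    [ln_pow4_le]. *)
Lemma square_U : exists C : R, 0 <= C /\ forall n, (2 <= n)%N ->
  (\int[mu]_sw U R n sw ^+ 2 <= (m n ^+ 2 + C * (n%:R ^+ 2 / L n ^+ 4))%:E)%E.
Proof.
have [C [C0 HC]] := hull_size_sqr hPp finite_mean.
have [c [c0 Hc]] := sum_escape R.
have [K HK] := kappa_summable hPp finite_mean.
have [D [D0 HD]] : exists D : R, 0 <= D /\ forall n, (2 <= n)%N ->
    walkE n (fun s => (F (trace s) - m n) ^+ 2) <= D * (n%:R ^+ 2 / L n ^+ 4).
  apply: (@walkE_variance R F (@kappa R Pp) K) => //.
  - by move=> A B; exact: mean_hull_ext.
  - exact: mean_hull_shift hPp.
  - exact: kappa_ge0.
  - exact: mean_hull_inter_ge0 hPp finite_mean.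
  - exact: mean_hull_inter hPp finite_mean.
exists (D + C * (c * (2 * 4 ^+ 4))); split.
  exact: addr_ge0 D0 (mulr_ge0 C0 (mulr_ge0 c0 (mulr_ge0 (ler0n _ _) (exprn_ge0 _ (ler0n _ _))))).
move=> n n2; have L0 := ln_nat_gt0 R n2.
have n0 : 0 < n%:R :> R by rewrite ltr0n; lia.
under eq_integral do rewrite U_hull.
apply: le_trans (@integral_product_le _ _ Pp hP0 n (fun w l => hull_size R w l ^+ 2)%E _ _ _ HC) _.
- by move=> w l; rewrite expe_ge0// hull_size_ge0.
- by move=> l; apply: measurable_expe; exact: measurable_hull_size.
rewrite lee_fin walkED walkEZ mulrDl addrA lerD//.
  have -> : walkE n (fun t => F (trace t) ^+ 2) =
      m n ^+ 2 + walkE n (fun s => (F (trace s) - m n) ^+ 2).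
    have -> : walkE n (fun s => (F (trace s) - m n) ^+ 2) =
      walkE n (fun s => F (trace s) ^+ 2 - 2 * m n * F (trace s) + m n ^+ 2).
      by apply: eq_walkE => s _; ring.
    by rewrite walkED walkEB walkEZ walkE_cst; ring.
  by rewrite lerD2l HD.
rewrite -mulrA ler_wpM2l//.
rewrite (eq_walkE (g := fun s => (range_size s)%:R ^+ 1)) => [|s _]; last by rewrite expr1.
apply: le_trans (range_moment R 1 n) _; rewrite expr1 mul1r; apply: le_trans (Hc n n2) _.
rewrite -mulrA ler_wpM2l//.
have L4 : 0 < L n ^+ 4 by rewrite exprn_gt0.
rewrite mulrA ler_pdivlMr// mulrAC -mulrA.
have l2 : (L n)^-1 <= 2 by rewrite invf_ple ?posrE// ln_nat_ge.
have h4 := ln_pow4_le (ltnW n2).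
rewrite (_ : 2 * 4 ^+ 4 * n%:R ^+ 2 = n%:R * ((4 ^+ 4 * n%:R) * 2)); last first.
  by move: (4 ^+ 4 : R) => q; ring.
by rewrite mulrA -mulrA ler_wpM2l ?(ltW n0)// ler_pM// ?invr_ge0 ltW.
Qed.

(** The centre [c] is left free: the mean of [U R n] gives (b), and $\pi n/\log n$ gives the
    rescaled deviation. *)
Lemma deviation_U : exists C : R, 0 <= C /\ forall n, (2 <= n)%N ->
  forall c, 0 <= c -> (\int[mu]_sw (U R n sw - c%:E) ^+ 2 <=
    (C * (n%:R ^+ 2 / L n ^+ 4) + (m n - c) ^+ 2)%:E)%E.
Proof.
have [C [C0 HC]] := square_U; exists C; split => // n n2 c c0.
apply: le_trans (integral_esquare (@U_ge0 n) (measurable_U n) (mean_U n) (HC n n2) c0) _.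
by rewrite lee_fin; lra.
Qed.

Lemma scaled_deviation : exists C : R, 0 <= C /\ forall n, (2 <= n)%N ->
  (\int[mu]_sw ((L n / n%:R)%:E * U R n sw - pi%:E) ^+ 2 <= (C / L n ^+ 2)%:E)%E.
Proof.
have [C [C0 HC]] := deviation_U; have [D [D0 HD]] := mean_U_asymp.
exists (C + D ^+ 2); split; first by rewrite addr_ge0// sqr_ge0.
move=> n n2; have L0 := ln_nat_gt0 R n2; have p0 := pi_ge0 R.
have n0 : 0 < n%:R :> R by rewrite ltr0n; lia.
set a := L n / n%:R; have a0 : 0 < a by rewrite divr_gt0.
set c := pi * (n%:R / L n).
have c0 : 0 <= c by apply: mulr_ge0 => //; rewrite divr_ge0 ?ltW.
have ac : a * c = pi.
  by rewrite /a /c; move: (pi : R) => q; field; rewrite !gt_eqF.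
have mU2 : measurable_fun setT (fun sw : (walk_space * config_space)%type => (U R n sw - c%:E) ^+ 2)%E.
  by apply: measurable_expe; apply: measurable_esub; exact: measurable_U.
rewrite -ac (eq_integral (fun sw => (a ^+ 2)%:E * (U R n sw - c%:E) ^+ 2)%E); last first.
  move=> sw _; rewrite emulB ?U_ge0// !expe2 muleACA -EFinM.
  by rewrite -expr2.
rewrite ge0_integralZl_EFin ?sqr_ge0//; last by move=> sw _; exact: esquare_ge0.
apply: (@le_trans _ _ ((a ^+ 2)%:E * (C * (n%:R ^+ 2 / L n ^+ 4) + (m n - c) ^+ 2)%:E)%E).
  by rewrite lee_wpmul2l ?lee_fin ?sqr_ge0// HC.
rewrite -EFinM lee_fin.
have h : (m n - c) ^+ 2 <= (D * (n%:R / L n ^+ 2)) ^+ 2.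
  rewrite -[leLHS]real_normK ?num_real// lerXn2r ?nnegrE ?HD//.
  by rewrite mulr_ge0// divr_ge0 ?sqr_ge0// ltW.
apply: le_trans (ler_wpM2l (sqr_ge0 a) (_ : _ <= C * (n%:R ^+ 2 / L n ^+ 4) + (D * (n%:R / L n ^+ 2)) ^+ 2)) _.
  by rewrite lerD2l.
rewrite le_eqVlt; apply/orP; left; apply/eqP; rewrite /a.
by field; rewrite !gt_eqF.
Qed.

End UnionOfClusters.

(** * Deterministic tools for the limits *)

Section Subsequence.
Variable R : realType.
Local Notation L n := (ln (n%:R : R)).

(** Fourth root of $k+1$; it keeps the exponent $3/4$ polynomial, as [s k ^+ 3]. *)
Let s (k : nat) : R := Num.sqrt (Num.sqrt k.+1%:R).

Let s_gt0 k : 0 < s k.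
Proof. by rewrite !sqrtr_gt0. Qed.

Let s_pow4 k : s k ^+ 4 = k.+1%:R.
Proof. by rewrite (exprM (s k) 2 2) !sqr_sqrtr// sqrtr_ge0. Qed.

Let s_large (S : R) : exists K : nat, forall k, (K <= k)%N -> S <= s k.
Proof.
have [S0|S0] := ltP S 0; first by exists 0%N => k _; exact: le_trans (ltW S0) (ltW (s_gt0 k)).
exists (Num.bound (S ^+ 4)) => k Kk; rewrite -(@ler_pXn2r _ 4) ?nnegrE ?(ltW (s_gt0 k))// s_pow4.
apply: le_trans (ltW (archi_boundP (exprn_ge0 4 S0))) _.
by rewrite ler_nat; exact: leqW.
Qed.

Let s_ge1 k : 1 <= s k.
Proof.
rewrite -(@ler_pXn2r _ 4) ?nnegrE ?ler01 ?(ltW (s_gt0 k))// s_pow4 expr1n.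
by rewrite ler1n.
Qed.

(* The integers just above exp(k^{3/4}), k >= 1: sparse enough for the sum of 1/ln^2 to converge,
   dense enough for the ratio of consecutive terms to tend to 1. *)
Lemma exp_subsequence : exists N : nat -> nat, [/\ forall k, (2 <= N k)%N,
  forall K, \sum_(k < K) (L (N k) ^+ 2)^-1 <= 3,
  forall e : R, 0 < e -> exists K : nat, forall k, (K <= k)%N ->
    (N k.+1)%:R <= (1 + e) * (N k)%:R &
  forall n, exists k, (n < N k)%N].
Proof.
pose N k := (Num.truncn (expR (s k ^+ 3))).+1.
have NP k : expR (s k ^+ 3) < (N k)%:R <= expR (s k ^+ 3) + 1.
  have /andP [a b] := truncn_itv (expR_ge0 (s k ^+ 3)).
  by rewrite b /= /N -natr1 lerD2r.
have N_gt k : 1 + s k ^+ 3 < (N k)%:R.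
  by apply: le_lt_trans (expR_ge1Dx _) _; have /andP [] := NP k.
have s3 k : 1 <= s k ^+ 3 by rewrite exprn_ege1.
have N2 k : (2 <= N k)%N.
  by rewrite ltnW// -(ltr_nat R); apply: le_lt_trans (N_gt k); have := s3 k; lra.
have LN k : s k ^+ 3 <= L (N k).
  rewrite -[leLHS]expRK ler_ln ?posrE ?expR_gt0 ?ltr0n//.
  by have /andP [/ltW] := NP k.
exists N; split => //.
- move=> K; apply: (@le_trans _ _ (\sum_(k < K) (s k ^+ 6)^-1)).
    apply: ler_sum => k _; rewrite lef_pV2 ?posrE ?exprn_gt0 ?(lt_le_trans _ (LN k))//; last first.
      by rewrite exprn_gt0.
    by rewrite (exprM (s k) 3 2) lerXn2r ?nnegrE ?LN// ltW// ?exprn_gt0// (lt_le_trans _ (LN k))// exprn_gt0.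
  case: K => [|K]; first by rewrite big_ord0.
  (* Telescoping majorant for $\sum k^{-3/2}$: for consecutive values $a,b$ of [s k ^+ 2] one has
     $b^2=a^2+1$ and $b^{-3}\le2/a-2/b$. *)
  apply: (@le_trans _ _ (3 - 2 * (s K ^+ 2)^-1)); last first.
    by rewrite gerBl mulr_ge0// invr_ge0 exprn_ge0// ltW.
  elim: K => [|K IHK].
    rewrite big_ord1; have -> : s 0 = 1 by rewrite /s !sqrtr1.
    by rewrite !expr1n invr1; lra.
  rewrite big_ord_recr /=; apply: (le_trans (lerD IHK (lexx _))).
  have h : s K.+1 ^+ 4 = s K ^+ 4 + 1 by rewrite !s_pow4 -natr1.
  move: h; rewrite (exprM (s K) 2 2) (exprM (s K.+1) 2 2) (exprM (s K.+1) 2 3).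
  have a0 : 0 < s K ^+ 2 by rewrite exprn_gt0.
  have b0 : 0 < s K.+1 ^+ 2 by rewrite exprn_gt0.
  move: (s K ^+ 2) (s K.+1 ^+ 2) a0 b0 => a b a0 b0 h.
  have ab : a <= b by rewrite -(@ler_pXn2r _ 2) ?nnegrE ?ltW// h; lra.
  suff : (b ^+ 3)^-1 <= 2 * (b - a) / (a * b).
    have -> : 2 * (b - a) / (a * b) = 2 / a - 2 / b by field; rewrite !gt_eqF.
    lra.
  have -> : b - a = (a + b)^-1.
    have ab0 : a + b != 0 by rewrite gt_eqF// addr_gt0.
    by apply: (mulIf ab0); rewrite mulVf//; nra.
  have -> : 2 / (a + b) / (a * b) = 2 / ((a + b) * (a * b)).
    by field; rewrite !gt_eqF// addr_gt0.
  rewrite ler_pdivlMr ?mulr_gt0 ?addr_gt0// mulrC ler_pdivrMr ?exprn_gt0//.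
  rewrite !exprS expr0 mulr1; nra.
- move=> e e0; have [K HK] := s_large (2 + 4 / e); exists K => k /HK {HK}Sk.
  have e4 : 0 < 4 / e by rewrite divr_gt0.
  have /andP [Nk _] := NP k; have /andP [_ Nk1] := NP k.+1.
  apply: le_trans Nk1 _; apply: le_trans (ler_wpM2l _ (ltW Nk)); last by lra.
  (* $(k+2)^{3/4}\le(k+2)(k+1)^{-1/4}=(k+1)^{3/4}+(k+1)^{-1/4}$: consecutive exponents become
     arbitrarily close. *)
  have step : s k.+1 ^+ 3 <= s k ^+ 3 + (s k)^-1.
    have sk : s k <= s k.+1.
      by rewrite /s !ler_wsqrtr// ler_nat.
    have -> : s k.+1 ^+ 3 = k.+2%:R / s k.+1.
      by rewrite -s_pow4 [_ ^+ 4]exprSr mulfK// gt_eqF.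
    have -> : s k ^+ 3 + (s k)^-1 = k.+2%:R / s k.
      rewrite -(natr1 k.+1) -s_pow4 mulrDl mul1r; congr (_ + _).
      by rewrite [_ ^+ 4]exprSr mulfK// gt_eqF.
    by rewrite ler_wpM2l// lef_pV2 ?posrE.
  apply: (@le_trans _ _ (expR (s k ^+ 3 + (s k)^-1) + 1)); first by rewrite lerD2r ler_expR.
  rewrite expRD mulrDl mul1r addrC.
  have h1 : expR (s k)^-1 <= 1 + e / 4.
    have s1 : 4 / e <= s k - 1 by lra.
    have s10 : 0 < s k - 1 by apply: lt_le_trans s1.
    have -> : expR (s k)^-1 = (expR (- (s k)^-1))^-1 by rewrite expRN invrK.
    apply: (@le_trans _ _ (1 - (s k)^-1)^-1).
      have h : (s k)^-1 < 1 by rewrite invf_lt1//; lra.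
      by rewrite lef_pV2 ?posrE ?expR_gt0 ?subr_gt0// -[_ - _]/(1 + - (s k)^-1) expR_ge1Dx.
    have -> : (1 - (s k)^-1)^-1 = 1 + (s k - 1)^-1.
      by field; rewrite !gt_eqF//= -subr_gt0.
    by rewrite lerD2l -[e / 4]invrK invf_div lef_pV2 ?posrE// divr_gt0.
  (* The 1 added by rounding up to an integer is a small fraction of the exponential. *)
  have h2 : 1 <= e / 4 * expR (s k ^+ 3).
    apply: (@le_trans _ _ (e / 4 * s k)).
      rewrite -[leLHS](_ : e / 4 * (4 / e) = 1); last by field; rewrite gt_eqF.
      by rewrite ler_wpM2l ?divr_ge0 ?ltW//; lra.
    apply: ler_wpM2l; first by rewrite divr_ge0// ltW.
    apply: le_trans (_ : s k ^+ 3 <= _); first by rewrite -[leLHS]expr1 ler_weXn2l.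
    by apply: le_trans (expR_ge1Dx _); rewrite lerDr.
  apply: le_trans (lerD h2 (ler_wpM2l (expR_ge0 _) h1)) _.
  rewrite mulrDr mulr1 [expR _ * (e / 4)]mulrC.
  by have := expR_gt0 (s k ^+ 3); move: (expR _) => E; nra.
- move=> n; have [K HK] := s_large n%:R; exists K.
  rewrite -(ltr_nat R); apply: le_lt_trans (HK K (leqnn K)) _.
  apply: lt_trans (N_gt K); apply: le_lt_trans (_ : s K ^+ 3 < _); last by rewrite ltrDr.
  by rewrite -[leLHS]expr1 ler_weXn2l.
Qed.

(** For $N_k\le n<N_{k+1}$, monotonicity of [v] and of the logarithm compares the value at [n] with
    those at the two ends, up to the factor $1+h$ that bounds $N_{k+1}/N_k$. *)
Lemma cvg_monotone_subsequence (v : nat -> R) (N : nat -> nat) (c : R) :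
  (forall n, 0 <= v n) -> {homo v : m n / (m <= n)%N >-> m <= n} ->
  (forall k, (2 <= N k)%N) ->
  (forall e : R, 0 < e -> exists K : nat, forall k, (K <= k)%N ->
    (N k.+1)%:R <= (1 + e) * (N k)%:R) ->
  (forall n, exists k, (n < N k)%N) -> 0 <= c ->
  (L (N k) / (N k)%:R * v (N k)) @[k --> \oo] --> c ->
  (L n / n%:R * v n) @[n --> \oo] --> c.
Proof.
move=> v0 vmono N2 Nratio Nub c0 /cvgrPdist_le hc; apply/cvgrPdist_le => e e0.
(* The upper error $(c+h)(1+h)-c$ is at most $h(c+2)\le e$ when $h\le1$; the lower error is at most
   $h(c+1)$. *)
pose h := Num.min 1 (e / (c + 2)).
have h0 : 0 < h by rewrite lt_min ltr01 divr_gt0//; lra.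
have h1 : h <= 1 by rewrite ge_min lexx.
have he : h * (c + 2) <= e by rewrite -ler_pdivlMr ?ge_min ?lexx ?orbT//; lra.
have [K1 HK1] := Nratio h h0.
have [K2 _ HK2] := hc h h0.
pose K := maxn K1 K2; exists (\sum_(j < K.+1) N j)%N => // n /= Kn.
have small j : (j <= K)%N -> (N j <= n)%N.
  move=> jK; apply: leq_trans Kn; rewrite -ltnS in jK.
  by rewrite (bigD1 (Ordinal jK)) //= leq_addr.
case: (ex_minnP (Nub n)) => k nk mink.
have Kk : (K < k)%N by rewrite ltnNge; apply/negP => /small; rewrite leqNgt nk.
case: k nk mink Kk => // k nk mink; rewrite ltnS => Kk.
have kn : (N k <= n)%N by rewrite leqNgt; apply/negP => /mink; rewrite ltnn.
have n2 : (2 <= n)%N by exact: leq_trans (N2 k) kn.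
have /HK1 r : (K1 <= k)%N by apply: leq_trans Kk; exact: leq_maxl.
have K2k : (K2 <= k)%N by apply: leq_trans Kk; exact: leq_maxr.
have := HK2 k K2k; have := HK2 k.+1 (leqW K2k) => /=.
set b1 := _ * v (N k.+1); set b0 := _ * v (N k); rewrite !ler_distlC => /andP [_ b1c] /andP [cb0 _].
have pos m : (2 <= m)%N -> 0 < m%:R :> R by move=> m2; rewrite ltr0n (leq_trans _ m2).
have Nk0 := pos _ (N2 k); have Nk10 := pos _ (N2 k.+1); have n0 := pos _ n2.
have Lm m m' : (2 <= m)%N -> (m <= m')%N -> L m <= L m'.
  by move=> m2 mm; rewrite ler_ln ?posrE ?pos ?ler_nat// (leq_trans m2).
have L0 m : (2 <= m)%N -> 0 <= L m by move=> m2; exact/ltW/ln_nat_gt0.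
set x := _ * v n.
have x0 : 0 <= x by rewrite mulr_ge0// divr_ge0 ?L0.
have lower : b0 <= x * (1 + h).
  rewrite /b0 /x mulrAC -mulrA [X in _ <= X](_ : _ = L n * v n * ((1 + h) / n%:R)); last by ring.
  rewrite [leLHS](_ : _ = L (N k) * v (N k) * (N k)%:R^-1); last by ring.
  apply: ler_pM; rewrite ?mulr_ge0 ?invr_ge0 ?L0//.
    by rewrite ler_pM ?L0 ?Lm ?vmono.
  rewrite ler_pdivlMr// mulrC ler_pdivrMr//; apply: le_trans r.
  by rewrite ler_nat ltnW.
have upper : x <= b1 * (1 + h).
  rewrite /b1 /x [X in _ <= X](_ : _ = L (N k.+1) * v (N k.+1) * ((1 + h) / (N k.+1)%:R)); last by ring.
  rewrite [leLHS](_ : _ = L n * v n * n%:R^-1); last by ring.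
  apply: ler_pM; rewrite ?mulr_ge0 ?invr_ge0 ?L0//.
    by rewrite ler_pM ?L0 ?Lm ?vmono// ltnW.
  rewrite ler_pdivlMr// mulrC ler_pdivrMr//; apply: (le_trans r).
  by rewrite ler_wpM2l ?ler_nat//; lra.
move: lower upper cb0 b1c; move: b0 b1 x x0 => b0 b1 x x0 lower upper cb0 b1c.
apply/andP; split; last by nra.
have [xc|cx] := leP x c; nra.
Qed.

(** Three ranges: below $\min(e,1)$, $t^q\le t\le e$; above $\max(1,1/e)$, $t^q\le t^{d-1}\le
    e\,t^d$; in between, a multiple of $t^2$ suffices. So $L^2$ convergence with bounded higher
    moments gives $L^q$ convergence. *)
Lemma powR_le_split (q : R) (d : nat) (e : R) : 1 <= q -> q + 1 <= d%:R -> 0 < e ->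
  exists C : R, 0 <= C /\ forall t, 0 <= t -> t `^ q <= e + C * t ^+ 2 + e * t ^+ d.
Proof.
move=> q1 qd e0; pose a := Num.min e 1; pose T := Num.max 1 e^-1.
have a0 : 0 < a by rewrite lt_min e0 ltr01.
have T1 : 1 <= T by rewrite le_max lexx.
have q0 : 0 <= q by exact: le_trans q1.
exists (T `^ q / a ^+ 2); split; first by rewrite divr_ge0 ?powR_ge0 ?sqr_ge0.
move=> t t0; have Tq0 : 0 <= T `^ q / a ^+ 2 * t ^+ 2.
  by rewrite mulr_ge0 ?sqr_ge0// divr_ge0 ?powR_ge0 ?sqr_ge0.
have td0 : 0 <= e * t ^+ d by apply: mulr_ge0; [exact: ltW|exact: exprn_ge0].
have [ta|at_] := leP t a.
  apply: (@le_trans _ _ e); last by rewrite -addrA lerDl addr_ge0.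
  move: ta; rewrite le_min => /andP [te t1].
  apply: le_trans te; move: t0; rewrite le_eqVlt => /predU1P [<-|t0].
    by rewrite powR0// gt_eqF// (lt_le_trans ltr01).
  by rewrite -[leRHS]powRr1 ?(ltW t0)//; apply: ger_powR; rewrite ?t0.
have [tT|Tt] := leP t T.
  apply: (@le_trans _ _ (T `^ q / a ^+ 2 * t ^+ 2)); last by rewrite [e + _]addrC -addrA lerDl addr_ge0// ltW.
  apply: (@le_trans _ _ (T `^ q)); first by apply: ge0_ler_powR => //; rewrite nnegrE// (le_trans t0).
  rewrite mulrAC -mulrA ler_peMr ?powR_ge0// ler_pdivlMr ?exprn_gt0// mul1r.
  by rewrite lerXn2r ?nnegrE ?ltW// (lt_trans a0).
apply: (@le_trans _ _ (e * t ^+ d)); last by rewrite lerDr addr_ge0// ltW.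
have t1 : 1 <= t by exact: le_trans T1 (ltW Tt).
apply: (@le_trans _ _ (t `^ (d%:R - 1))); first by apply: ler_powR => //; lra.
have d1 : (1 <= d)%N by rewrite -(ler_nat R); lra.
have -> : d%:R - 1 = d.-1%:R :> R by case: (d) d1 => // d' _; rewrite -natr1 addrK.
rewrite powR_mulrn//; have -> : t ^+ d = t * t ^+ d.-1 by rewrite -exprS prednK.
rewrite mulrA ler_peMl ?exprn_ge0//.
have : e^-1 <= t by apply: le_trans (ltW Tt); rewrite le_max lexx orbT.
by rewrite -[e^-1]div1r ler_pdivrMr// mulrC.
Qed.

Lemma cvg_of_sum_sqr (y : nat -> \bar R) : (\sum_(k <oo) (y k) ^+ 2 < +oo)%E ->
  (forall k, y k \is a fin_num) /\ fine (y k) @[k --> \oo] --> 0.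
Proof.
move=> yoo; have y0 k : (0 <= (y k) ^+ 2)%E by exact: esquare_ge0.
have part n : (\sum_(0 <= k < n) (y k) ^+ 2 <= \sum_(k <oo) (y k) ^+ 2)%E.
  exact: nneseries_lim_ge.
have yfin k : y k \is a fin_num.
  have := le_lt_trans (part k.+1) yoo; rewrite big_nat_recr//.
  move=> h; have : ((y k) ^+ 2 < +oo)%E.
    by apply: le_lt_trans h; apply: leeDr; apply: sume_ge0 => i _; exact: y0.
  by case: (y k) => [r||]//; rewrite expe2 ?mulyy ?mulNyNy ltxx.
split => //.
pose f k := fine (y k) ^+ 2.
have fE k : ((y k) ^+ 2 = (f k)%:E)%E by rewrite /f -{1}(fineK (yfin k)) EFin_expe.
have cf : cvgn (series f).
  apply: nondecreasing_is_cvgn.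
    by apply: nondecreasing_series => k _ _; exact: sqr_ge0.
  have Sfin : (\sum_(k <oo) (y k) ^+ 2)%E \is a fin_num.
    by rewrite ge0_fin_numE//; apply: nneseries_ge0.
  exists (fine (\sum_(k <oo) (y k) ^+ 2)%E) => _ [n _ <-].
  rewrite -lee_fin fineK//; apply: le_trans (part n).
  by under eq_bigr do rewrite fE; rewrite sumEFin.
have /cvgrPdist_lt h := cvg_series_cvg_0 cf; apply/cvgrPdist_lt => e e0.
have e20 : 0 < e ^+ 2 by rewrite exprn_gt0.
apply: filterS (h _ e20) => k; rewrite !sub0r !normrN /f.
rewrite [X in X < _](ger0_norm (sqr_ge0 _)) -real_normK ?num_real//.
by rewrite ltr_pXn2r ?nnegrE// ltW.
Qed.

End Subsequence.

Lemma epoweR_le_split (R : realType) (q e D : R) (d : nat) : 0 < e -> 0 <= D ->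
  (forall t, 0 <= t -> t `^ q <= e + D * t ^+ 2 + e * t ^+ d.+1) ->
  forall y : \bar R, (`|y| `^ q <= e%:E + (D%:E * y ^+ 2 + e%:E * `|y| ^+ d.+1))%E.
Proof.
move=> e0 D0 H y.
have oo : (e%:E + (D%:E * y ^+ 2 + e%:E * +oo) = +oo)%E.
  rewrite gt0_muley ?lte_fin// addey// ?addey// gt_eqF// (@lt_le_trans _ _ 0%E)//.
  by rewrite mule_ge0 ?esquare_ge0.
case: y oo => [y||] oo.
- have -> : (`|y%:E| = `|y|%:E)%E by [].
  rewrite poweR_EFin -!EFin_expe -!EFinM -!EFinD lee_fin addrA.
  by have := H _ (normr_ge0 y); rewrite real_normK ?num_real.
- have -> : (`|+oo : \bar R| = +oo)%E by [].
  by rewrite (expe_pinfty R d) oo leey.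
- have -> : (`|-oo : \bar R| = +oo)%E by [].
  by rewrite (expe_pinfty R d) oo leey.
Qed.

(** * Almost sure and $L^q$ convergence *)

Section UnionOfClustersLimit.
Variables (R : realType) (p : R) (P0 : probability walk_space R) (Pp : probability config_space R).
Hypothesis hP0 : simple_random_walk_law P0.
Hypothesis hPp : bernoulli_percolation_law p Pp.
Hypothesis hp : p < p_T R.
Local Notation L n := (ln (n%:R : R)).
Local Notation mu := (P0 \x Pp)%E.
Local Notation Y n sw := ((L n / n%:R)%:E * U R n sw - pi%:E)%E.

Let mu_cst (c : R) : (\int[mu]_sw c%:E = c%:E)%E.
Proof.
rewrite -[RHS]mule1 -(probability_setT (P0 \x Pp)%E); exact: integral_cst.
Qed.

Lemma U_mono (sw : walk_space * config_space) : {homo U R ^~ sw : m n / (m <= n)%N >-> (m <= n)%E}.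
Proof.
move=> m n mn; rewrite !U_hull; apply: le_csum => x; first exact: ind_ge0.
rewrite lee_fin ler_nat; case: asboolP => // -[a [/mapP [i]]].
rewrite mem_iota ltnS /= => im -> c; rewrite asboolT//; exists (sw.1 i); split => //.
by apply/mapP; exists i => //; rewrite mem_iota ltnS /= (leq_trans im).
Qed.

Let measurable_Y n : measurable_fun setT (fun sw : (walk_space * config_space)%type => Y n sw).
Proof.
apply: emeasurable_funB; last exact: measurable_cst.
by apply: emeasurable_funM; [exact: measurable_cst|exact: measurable_U].
Qed.

(** The squared deviations along the subsequence have a sum of finite mean, hence finite almost
    surely, which replaces a Borel-Cantelli argument. Its finiteness also makes every [U R n sw]
    finite, by monotonicity in [n]. *)
Lemma ae_cvg_U : {ae mu, forall sw, ((L n / n%:R)%:E * U R n sw)%E @[n --> \oo] --> (pi : R)%:E}.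
Proof.
have [C [C0 HC]] := scaled_deviation hP0 hPp hp.
have [N [N2 Nsum Nratio Nub]] := exp_subsequence R.
pose f k (sw : (walk_space * config_space)%type) := (Y (N k) sw ^+ 2)%E.
have f0 k sw : (0 <= f k sw)%E by exact: esquare_ge0.
have mf k : measurable_fun setT (f k) by apply: measurable_expe; exact: measurable_Y.
pose Z sw := (\sum_(k <oo) f k sw)%E.
have Z0 sw : (0 <= Z sw)%E by apply: nneseries_ge0 => *; exact: f0.
have mZ : measurable_fun setT Z by exact: (@ge0_emeasurable_sum _ _ _ setT f xpredT).
have intZ : (\int[mu]_sw Z sw <= (C * 3)%:E)%E.
  rewrite integral_nneseries//; apply: lime_le.
    by apply: is_cvg_nneseries => *; exact: integral_ge0.
  apply: nearW => K; apply: (@le_trans _ _ (\sum_(0 <= k < K) (C / L (N k) ^+ 2)%:E)%E).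
    by apply: lee_sum => k _; exact: HC.
  by rewrite sumEFin lee_fin big_mkord -mulr_sumr ler_wpM2l.
have iZ : mu.-integrable setT Z.
  apply/integrableP; split => //.
  under eq_integral do rewrite gee0_abs//.
  by apply: le_lt_trans intZ _; rewrite ltry.
have := integrable_ae measurableT iZ; apply: filterS => sw /(_ I) Zfin.
have Zoo : (\sum_(k <oo) (Y (N k) sw) ^+ 2 < +oo)%E by rewrite -ge0_fin_numE//; exact: Z0.
have [Yfin Y0] := cvg_of_sum_sqr Zoo.
have n0 n : (2 <= n)%N -> 0 < L n / n%:R.
  by move=> n2; rewrite divr_gt0 ?ln_nat_gt0// ltr0n (leq_trans _ n2).
have UNfin k : U R (N k) sw \is a fin_num.
  have := Yfin k; have := U_ge0 R (N k) sw; case: (U R (N k) sw) => // _.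
  by rewrite gt0_muley ?lte_fin ?n0.
have Ufin n : U R n sw \is a fin_num.
  have [k nk] := Nub n; rewrite ge0_fin_numE ?U_ge0//.
  apply: le_lt_trans (U_mono sw (ltnW nk)) _.
  by rewrite -ge0_fin_numE ?U_ge0.
pose v n := fine (U R n sw).
have UE n : U R n sw = (v n)%:E by rewrite /v fineK.
have XE n : ((L n / n%:R)%:E * U R n sw)%E = (L n / n%:R * v n)%:E by rewrite UE.
under eq_fun do rewrite XE; apply: cvg_EFin; first exact: nearW.
apply: (cvg_monotone_subsequence (N := N)) => //.
- by move=> n; rewrite /v fine_ge0// U_ge0.
- by move=> m n mn; rewrite -lee_fin -!UE; exact: U_mono.
- exact: pi_ge0.
move/cvgrPdist_le : Y0 => Y0; apply/cvgrPdist_le => e e0.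
apply: filterS (Y0 e e0) => k; rewrite XE -EFinB /= sub0r opprB.
by [].
Qed.

(** $|X-\pi|^{k+1}\le2^k(X^{k+1}+\pi^{k+1})$, the power mean inequality for two terms. *)
Let deviation_moment k : exists M : R, 0 <= M /\ forall n, (2 <= n)%N ->
  (\int[mu]_sw `|Y n sw| ^+ k.+1 <= M%:E)%E.
Proof.
have [C [C0 HC]] := moment_U hP0 hPp hp k; have p0 := pi_ge0 R.
exists (2 ^+ k * (C + pi ^+ k.+1)); split.
  by apply: mulr_ge0; [exact: exprn_ge0|apply: addr_ge0 => //; exact: exprn_ge0].
move=> n n2; have L0 := ln_nat_gt0 R n2.
have n0 : 0 < n%:R :> R by rewrite ltr0n (leq_trans _ n2).
set a := L n / n%:R; have a0 : 0 < a by rewrite divr_gt0.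
pose g (sw : (walk_space * config_space)%type) := ((a ^+ k.+1)%:E * U R n sw ^+ k.+1)%E.
have g0 sw : (0 <= g sw)%E by rewrite mule_ge0 ?expe_ge0 ?U_ge0// lee_fin exprn_ge0// ltW.
have mU : measurable_fun setT (fun sw : (walk_space * config_space)%type => U R n sw ^+ k.+1)%E.
  by apply: measurable_expe; exact: measurable_U.
have mg : measurable_fun setT g by apply: emeasurable_funM => //; exact: measurable_cst.
apply: (@le_trans _ _ (\int[mu]_sw ((2 ^+ k)%:E * (g sw + (pi ^+ k.+1)%:E)))%E).
  apply: ge0_le_integral => //.
  - by move=> sw _; exact: expe_ge0.
  - by apply: measurable_expe; apply: measurableT_comp => //; exact: measurable_Y.
  - by apply: emeasurable_funM; [exact: measurable_cst|apply: emeasurable_funD => //; exact: measurable_cst].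
  - move=> sw _; pose c (b : bool) : \bar R := if b then (a%:E * U R n sw)%E else pi%:E.
    have aU0 : (0 <= a%:E * U R n sw)%E by rewrite mule_ge0 ?U_ge0// lee_fin ltW.
    have c0 b : (0 <= c b)%E by case: b => //=; rewrite lee_fin.
    have := epower_mean [:: true; false] k c0.
    rewrite !big_cons !big_nil /c !addr0 => h.
    apply: le_trans (_ : _ <= (a%:E * U R n sw + pi%:E) ^+ k.+1)%E _.
      apply: lee_expe => //; apply: le_trans (lee_abs_sub _ _) _.
      by rewrite !gee0_abs// lee_fin.
    apply: le_trans h _; rewrite le_eqVlt; apply/orP; left; apply/eqP.
    congr (_ * (_ + _))%E; last by rewrite EFin_expe.
    rewrite /g; elim: (k.+1) => [|j IHj]; first by rewrite !expe0 expr0 mule1.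
    by rewrite !expeS exprS EFinM IHj muleACA.
rewrite ge0_integralZl_EFin//; last 2 first.
- by move=> sw _; rewrite adde_ge0// lee_fin exprn_ge0.
- by apply: emeasurable_funD => //; exact: measurable_cst.
rewrite ge0_integralD//; last by move=> sw _; rewrite lee_fin exprn_ge0.
rewrite EFinM lee_wpmul2l ?lee_fin ?exprn_ge0// EFinD leeD//.
  rewrite ge0_integralZl_EFin ?exprn_ge0 ?(ltW a0)//; last by move=> sw _; rewrite expe_ge0 ?U_ge0.
  apply: (@le_trans _ _ ((a ^+ k.+1)%:E * (C * (n%:R / L n) ^+ k.+1)%:E)%E).
    by rewrite lee_wpmul2l ?HC// lee_fin exprn_ge0// ltW.
  rewrite -EFinM lee_fin mulrCA -exprMn /a.
  rewrite (_ : L n / n%:R * (n%:R / L n) = 1) ?expr1n ?mulr1//.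
  by field; rewrite !gt_eqF.
by rewrite mu_cst.
Qed.

Lemma Lnorm_cvg_U (q : R) : 1 <= q ->
  Lnorm mu q%:E (fun sw => Y n sw) @[n --> \oo] --> 0%E.
Proof.
move=> q1; have q0 : 0 < q by exact: lt_le_trans q1.
pose k := Num.bound (q + 1).
have qk : q + 1 <= k.+1%:R.
  apply: le_trans (ltW (archi_boundP _)) _; first by lra.
  by rewrite ler_nat.
have [M [M0 HM]] := deviation_moment k.
have [C [C0 HC]] := scaled_deviation hP0 hPp hp.
have small (d : R) : 0 < d -> exists n0 : nat, forall n, (n0 <= n)%N ->
    (\int[mu]_sw (`|Y n sw| `^ q) <= d%:E)%E.
  (* The constant and the high moment together cost [e * (1 + M)], that is [d / 2]; the quadratic
     term takes the other half once $\log n$ is large. *)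
  move=> d0; pose e := d / (2 * (1 + M)).
  have e0 : 0 < e by rewrite divr_gt0// mulr_gt0//; lra.
  have [D [D0 HD]] := powR_le_split q1 qk e0.
  have [n1 Hn1] := ln_large (1 + 2 * (D * C) / d).
  exists (maxn 2 n1) => n; rewrite geq_max => /andP [n2 /Hn1 Ln].
  pose f1 (sw : (walk_space * config_space)%type) := (D%:E * Y n sw ^+ 2)%E.
  pose f2 (sw : (walk_space * config_space)%type) := (e%:E * `|Y n sw| ^+ k.+1)%E.
  have mf1 : measurable_fun setT f1.
    apply: emeasurable_funM; first exact: measurable_cst.
    by apply: measurable_expe; exact: measurable_Y.
  have mf2 : measurable_fun setT f2.
    apply: emeasurable_funM; first exact: measurable_cst.
    by apply: measurable_expe; apply: measurableT_comp => //; exact: measurable_Y.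
  have f10 sw : (0 <= f1 sw)%E by rewrite mule_ge0 ?esquare_ge0.
  have f20 sw : (0 <= f2 sw)%E by rewrite mule_ge0 ?expe_ge0// lee_fin ltW.
  apply: (@le_trans _ _ (\int[mu]_sw (e%:E + (f1 sw + f2 sw)))%E).
    apply: ge0_le_integral => //.
    - by move=> sw _; exact: poweR_ge0.
    - apply: (@measurableT_comp _ _ _ _ _ _ (fun x : \bar R => (x `^ q)%E)).
        exact: measurable_poweR.
      by apply: measurableT_comp => //; exact: measurable_Y.
    - by apply: emeasurable_funD; [exact: measurable_cst|exact: emeasurable_funD].
    - by move=> sw _; exact: epoweR_le_split.
  rewrite ge0_integralD//; last 3 first.
  - by move=> sw _; rewrite lee_fin ltW.
  - by move=> sw _; rewrite adde_ge0.
  - exact: emeasurable_funD.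
  rewrite ge0_integralD// mu_cst.
  rewrite ge0_integralZl_EFin//; last 2 first.
  - by move=> sw _; exact: esquare_ge0.
  - by apply: measurable_expe; exact: measurable_Y.
  rewrite ge0_integralZl_EFin ?(ltW e0)//; last 2 first.
  - by move=> sw _; exact: expe_ge0.
  - by apply: measurable_expe; apply: measurableT_comp => //; exact: measurable_Y.
  apply: (@le_trans _ _ (e%:E + (D%:E * (C / L n ^+ 2)%:E + e%:E * M%:E))%E).
    rewrite leeD2l// leeD// lee_wpmul2l ?lee_fin ?(ltW e0)// ?HC ?HM//.
  rewrite -!EFinM -!EFinD lee_fin.
  have DC0 : 0 <= 2 * (D * C) / d by rewrite divr_ge0 ?mulr_ge0// ltW.
  have DC : D * (C / L n ^+ 2) <= d / 2.
    have L1 : 1 <= L n by lra.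
    rewrite mulrA ler_pdivrMr ?exprn_gt0 ?(lt_le_trans ltr01 L1)//.
    apply: (@le_trans _ _ (d / 2 * L n)); last first.
      rewrite ler_wpM2l ?divr_ge0 ?(ltW d0)// -[leLHS]expr1.
      by apply: ler_weXn2l.
    apply: (@le_trans _ _ (d / 2 * (1 + 2 * (D * C) / d))); last first.
      by rewrite ler_wpM2l ?divr_ge0 ?(ltW d0).
    have -> : d / 2 * (1 + 2 * (D * C) / d) = d / 2 + D * C by field; rewrite gt_eqF.
    by rewrite lerDr divr_ge0 ?(ltW d0).
  have eM : e + e * M = d / 2 by rewrite /e; field; rewrite gt_eqF//; lra.
  by rewrite addrCA eM; lra.
have Nq n : (0 <= Lnorm mu q%:E (fun sw => Y n sw))%E by exact: Lnorm_ge0.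
have {}small (d : R) : 0 < d -> exists n0 : nat, forall n, (n0 <= n)%N ->
    (Lnorm mu q%:E (fun sw => Y n sw) <= d%:E)%E.
  move=> d0; have [n0 Hn0] := small (d `^ q) (powR_gt0 q d0).
  exists n0 => n /Hn0 h; rewrite unlock.
  have -> : d%:E = ((d `^ q)%:E `^ q^-1)%E.
    by rewrite poweR_EFin -powRrM mulfV ?gt_eqF// powRr1// ltW.
  apply: gt0_ler_poweR => //; first by rewrite invr_ge0 ltW.
  - by rewrite in_itv /= leey andbT; apply: integral_ge0 => sw _; exact: poweR_ge0.
  - by rewrite in_itv /= leey andbT lee_fin powR_ge0.
apply/fine_cvgP; split.
  have [n0 Hn0] := small 1 ltr01; exists n0 => // n /= /Hn0 h.
  by rewrite ge0_fin_numE//; apply: le_lt_trans h _; rewrite ltry.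
apply/cvgrPdist_le => e e0; have [n0 Hn0] := small e e0; exists n0 => // n /= /Hn0 h.
rewrite sub0r normrN ger0_norm ?fine_ge0// -lee_fin fineK//.
by rewrite ge0_fin_numE//; apply: le_lt_trans h _; rewrite ltry.
Qed.

End UnionOfClustersLimit.

Theorem theorem1p8 (R : realType) (p : R)
    (P0 : probability walk_space R) (Pp : probability config_space R)
    (hP0 : simple_random_walk_law P0)
    (hPp : bernoulli_percolation_law p Pp)
    (hp0 : 0 <= p) (hp : p < p_T R) :
  let Pt : probability (walk_space * config_space)%type R := (P0 \x Pp)%E in
  [/\ exists C : R, \forall n \near \oo,
        (`|expect Pt (U R n) - (n%:R / ln n%:R * pi)%:E|
           <= (C * (n%:R / ln n%:R ^+ 2))%:E)%E,
      exists C : R, \forall n \near \oo,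
        (var Pt (U R n) <= (C * (n%:R ^+ 2 / ln n%:R ^+ 4))%:E)%E,
      {ae Pt, forall sw,
        ((ln n%:R / n%:R)%:E * U R n sw)%E @[n --> \oo] --> (pi : R)%:E} &
      forall q : R, 1 <= q ->
        Lnorm Pt q%:E (fun sw => (ln n%:R / n%:R)%:E * U R n sw - pi%:E)%E
          @[n --> \oo] --> 0%E].
Proof.
move=> Pt; have EU n := mean_U hP0 hPp hp n; split.
- have [C [C0 HC]] := mean_U_asymp hPp hp; exists C; exists 2%N => // n /= n2.
  by rewrite /expect EU -EFinB lee_fin mulrC HC.
(* Centred at the mean itself, the deviation is the variance and the bias term vanishes. *)
- have [C [C0 HC]] := deviation_U hP0 hPp hp; exists C; exists 2%N => // n /= n2.
  rewrite /var /expect EU; apply: le_trans (HC n n2 _ _) _.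
    by rewrite -lee_fin -EU; apply: integral_ge0 => sw _; exact: U_ge0.
  by rewrite subrr expr0n addr0.
- exact: ae_cvg_U hP0 hPp hp.
- by move=> q q1; exact: (Lnorm_cvg_U hP0 hPp hp q1).
Qed.
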